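(* Let $n,k\ge1$ be integers. Then $$\nabla_\ast^k e_n\big|_{t=1}=\sum_{L\in \mathrm{LD}_{k^n}}q^{\mathrm{area}(L)}\,\mathcal{X}_{k+1}^{L} =\sum_{L\in \mathrm{LD}^k_{k^n}}q^{\mathrm{area}(L)}\,e_{\eta(L)}\otimes\mathcal{X}_k^{L} =\sum_{L\in \mathrm{LLD}^k_{k^n}}q^{\mathrm{area}(L)}\,e_{\eta(L)}\otimes s_{\lambda^1(w(L))}\otimes\cdots\otimes s_{\lambda^k(w(L))}.$$
   Context: Macdonald side. $\Lambda$ is the ring of symmetric functions over $\mathbb{Q}(q,t)$; $[\cdot]$ is plethysm. $\widetilde{H}_\mu=\widetilde{H}_\mu(\boldsymbol{x};q,t)$ are the modified Macdonald polynomials, with the convention characterized by: $\widetilde H_\mu[\boldsymbol{x}(1-q)]\in\mathrm{span}\{s_\lambda:\lambda\ge\mu\}$, $\widetilde H_\mu[\boldsymbol{x}(1-t)]\in\mathrm{span}\{s_\lambda:\lambda\ge\mu'\}$, $\langle \widetilde H_\mu,s_{(n)}\rangle=1$ (e.g. $\widetilde H_{(3)}=s_3+(q+q^2)s_{21}+q^3s_{111}$). The operator $\nabla_\ast:\Lambda\to\Lambda\otimes\Lambda$ is the linear map $\widetilde H_\mu\mapsto\widetilde H_\mu\otimes\widetilde H_\mu$; its iterate $\nabla_\ast^k:\Lambda\to\Lambda^{\otimes(k+1)}$ is the linear map $\widetilde H_\mu\mapsto\widetilde H_\mu^{\otimes(k+1)}$. Tensor products are identified with products of symmetric functions in different sets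 of variables. Paths. $\mathbb{N}_+=\{1,2,\dots\}$. A $(kn\times n)$ Dyck path is a lattice path $\pi$ from $(0,0)$ to $(kn,n)$ with unit north and east steps that stays weakly above the line $ky=x$. Its area is the number of whole unit lattice cells between $\pi$ and this line. $\mathrm{col}_\pi(i)$ is the $x$-coordinate of the $i$-th north step of $\pi$. Multi-labeled Dyck paths. For $r\ge1$, $\mathrm{LD}^r_{k^n}$ is the set of pairs $L=(\pi,w)$ where $\pi$ is a $(kn\times n)$ Dyck path and $w=(w_1,\dots,w_n)$ with $w_i=(w_{i,1},\dots,w_{i,r})\in\mathbb{N}_+^r$, such that for all $1\le i<n$ $$\#\{j: w_{i,j}\ge w_{i+1,j}\}\le \mathrm{col}_\pi(i+1)-\mathrm{col}_\pi(i).$$ We write $w(L)=w$, $\mathrm{area}(L)=\mathrm{area}(\pi)$, $\mathrm{LD}_{k^n}=\mathrm{LD}_{k^n}^{k+1}$, and $$\mathcal{X}_r^{L}=(x_{w_{1,1}}x_{w_{2,1}}\cdots x_{w_{n,1}})\otimes\cdots\otimes(x_{w_{1,r}}x_{w_{2,r}}\cdots x_{w_{n,r}}).$$ For $L=(\pi,w)\in\mathrm{LD}_{k^n}^k$, $\eta(L)$ is the composition $(\eta_1,\dots,\eta_\ell)$ of $n$ whose set of partial sums $\{\eta_1,\eta_1+\eta_2,\dots,\eta_1+\dots+\eta_{\ell-1}\}$ is exactly the set of $1\le i<n$ such that $\#\{j: w_{i,j}\ge w_{i+1,j}\}<\mathrm{col}_\pi(i+1)-\mathrm{col}_\pi(i)$;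 and $e_\eta=e_{\eta_1}\cdots e_{\eta_\ell}$. Lattice labels. A sequence of positive integers is a lattice word if every prefix contains, for every $j\ge1$, at least as many $j$'s as $(j+1)$'s; its type is the partition $(m_1,m_2,\dots)$ where $m_j$ is the number of $j$'s in it. $\mathrm{LLD}^k_{k^n}$ is the set of $L\in\mathrm{LD}^k_{k^n}$ such that for each $1\le j\le k$ the word $w_{1,j}w_{2,j}\cdots w_{n,j}$ is a lattice word, and $\lambda^j(w(L))$ denotes its type. *)

(* Defs.v *)
From HB Require Import structures.
From mathcomp Require Import all_boot all_order all_algebra finmap multiset.
From mathcomp Require Import boolp classical_sets functions cardinality fsbigop.
Set Implicit Arguments.
Unset Strict Implicit.
Unset Printing Implicit Defensive.
Import GRing.Theory.
Local Open Scope classical_set_scope.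
Local Open Scope ring_scope.

(* The variables x_1, x_2, ... and the labels in N_+ are both indexed by nat:
   a : nat stands for the positive integer a.+1 (only the order of the labels
   and the successor relation ever matter).  A monomial is the multiset of the
   indices of its variables, and a formal power series is the function sending
   a monomial to its coefficient.  Every sum \sum_(i \in A) over an infinite
   set A below is taken coefficientwise, and for each coefficient only finitely
   many terms are nonzero. *)
Notation monom := {mset nat}%mset.

Definition series (R : Type) := monom -> R.

(* Power series in r sets of variables; they house the r-th tensor power of
   the ring of symmetric functions. *)
Definition tseries (r : nat) (R : Type) := ('I_r -> monom) -> R.

Section Series.
Variable R : comNzRingType.
Implicit Types f g : series R.

(* x_{s_1} x_{s_2} ... *)
Definition xmon (s : seq nat) : series R := fun m => (m == seq_mset s)%:R.

(* Cauchy product (as opposed to the pointwise product of functions) *)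
Definition smul f g : series R := fun m =>
  \sum_(ab \in [set ab : monom * monom | msetD ab.1 ab.2 = m]) f ab.1 * g ab.2.

Definition sprod (fs : seq (series R)) : series R :=
  foldr smul (xmon [::]) fs.

Definition tens r (f : 'I_r -> series R) : tseries r R :=
  fun m => \prod_j f j (m j).

(* f (x) G *)
Definition tcons r f (G : tseries r R) : tseries r.+1 R :=
  fun m => f (m ord0) * G (fun j => m (lift ord0 j)).

(* Symmetric functions: bounded degree, invariant under permutations of the
   variables. *)
Definition symfun f : Prop :=
  (exists d, forall m : monom, (d < size m)%N -> f m = 0) /\
  (forall (s : nat -> nat) (m : monom),
     bijective s -> f (seq_mset (map s m)) = f m).

Definition elem (n : nat) : series R := fun m =>
  \sum_(s \in [set s : seq nat | sorted ltn s /\ size s = n]) xmon s m.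

Definition elems (eta : seq nat) : series R := sprod (map elem eta).

(* Only meaningful for n > 0. *)
Definition psum (n : nat) : series R := fun m =>
  \sum_(i \in [set: nat]) xmon (nseq n i) m.

Definition psums (la : seq nat) : series R := sprod (map psum la).

(* Semistandard tableaux, as the sequence of their rows *)
Definition ssyt (la : seq nat) (T : seq (seq nat)) : Prop :=
  [/\ map size T = la, all (sorted leq) T &
      forall i j, (j < size (nth [::] T i.+1))%N ->
        (nth 0 (nth [::] T i) j < nth 0 (nth [::] T i.+1) j)%N].

Definition schur (la : seq nat) : series R := fun m =>
  \sum_(T \in [set T | ssyt la T]) xmon (flatten T) m.

End Series.

Definition is_part (la : seq nat) : bool := sorted geq la && (0%N \notin la).

Definition conj_part (mu : seq nat) : seq nat :=
  [seq count (ltn i) mu | i <- iota 0 (head 0%N mu)].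

(* The partitions la >= mu in dominance order *)
Definition dominating (mu : seq nat) : set (seq nat) :=
  [set la | [/\ is_part la, sumn la = sumn mu &
            forall i, (sumn (take i mu) <= sumn (take i la))%N]].

(* The partition (n), which is empty for n = 0 *)
Definition row_part (n : nat) : seq nat := if n is 0 then [::] else [:: n].

Section Symmetric.
Variable F : fieldType.
Implicit Types f g : series F.

Definition lincomb (l : seq (seq nat)) (c : seq nat -> F)
    (B : seq nat -> series F) : series F :=
  fun m => \sum_(la <- l) c la * B la m.

Definition schur_span (A : set (seq nat)) : set (series F) :=
  [set f | exists (l : seq (seq nat)) (c : seq nat -> F),
     (forall la, la \in l -> A la) /\ f = lincomb l c (schur F)].

(* g = f[x(1 - a)], where a is a monomial in q, t: plethysm by x(1 - a) is the
   algebra map p_n |-> (1 - a^n) p_n. *)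
Definition plethysm_1sub (a : F) f g : Prop :=
  exists (l : seq (seq nat)) (c : seq nat -> F),
    [/\ all is_part l,
        f = lincomb l c (psums F) &
        g = lincomb l (fun la => c la * \prod_(i <- la) (1 - a ^+ i)) (psums F)].

(* <f, g> = c for the bilinear form making the Schur functions orthonormal *)
Definition hall f g (c : F) : Prop :=
  exists (l : seq (seq nat)) (a b : seq nat -> F),
    [/\ uniq l /\ all is_part l,
        f = lincomb l a (schur F),
        g = lincomb l b (schur F) &
        c = \sum_(la <- l) a la * b la].

End Symmetric.

(* Q(q,t) is the fraction field of Q[q][t], with t the outer variable. *)
Definition Qq := {fraction {poly rat}}.
Definition Qqt := {fraction {poly {poly rat}}}.
Definition q_Qq : Qq := tofrac 'X.
Definition q_Qqt : Qqt := tofrac ('X%:P).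
Definition t_Qqt : Qqt := tofrac 'X.

(* f is regular at t = 1 and takes the value g there. *)
Definition at_t1 (f : Qqt) (g : Qq) : Prop :=
  exists a b : {poly {poly rat}},
    [/\ b.[1] != 0, f = tofrac a / tofrac b &
        g = tofrac a.[1] / tofrac b.[1]].

Definition modified_macdonald (H : seq nat -> series Qqt) : Prop :=
  forall mu, is_part mu ->
    [/\ symfun (H mu),
        (exists2 g, plethysm_1sub q_Qqt (H mu) g &
                    schur_span (dominating mu) g),
        (exists2 g, plethysm_1sub t_Qqt (H mu) g &
                    schur_span (dominating (conj_part mu)) g) &
        hall (H mu) (schur Qqt (row_part (sumn mu))) 1].

(* The k-th iterate of the linear map H_mu |-> H_mu (x) H_mu: since the H_mu
   form a basis of the symmetric functions, it is determined by its linearity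
   on them and by its values H_mu (x) ... (x) H_mu. *)
Definition is_nabla_iter (k : nat) (H : seq nat -> series Qqt)
    (nabla : series Qqt -> tseries k.+1 Qqt) : Prop :=
  (forall (a : Qqt) (f g : series Qqt), symfun f -> symfun g ->
     nabla (fun m => a * f m + g m) = (fun m => a * nabla f m + nabla g m)) /\
  (forall mu, is_part mu -> nabla (H mu) = tens (fun=> H mu)).

(* A path is the word of its steps, true for north and false for east; it lies
   weakly above k y = x iff all its vertices do. *)
Definition dyck (k n : nat) (p : seq bool) : Prop :=
  [/\ count id p = n, count negb p = (k * n)%N &
      forall i, (count negb (take i p) <= k * count id (take i p))%N].

(* x-coordinates of the successive north steps of a path starting at abscissa x *)
Fixpoint north_cols (x : nat) (p : seq bool) : seq nat :=
  match p with
  | [::] => [::]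
  | true :: p' => x :: north_cols x p'
  | false :: p' => north_cols x.+1 p'
  end.

(* North steps, like the rows of labels below, are numbered from 0. *)
Definition col (p : seq bool) (i : nat) : nat := nth 0%N (north_cols 0 p) i.

(* A cell is given by its lower left corner (c.1, c.2); it is to the right of
   the north step of its row, and its lower right corner is weakly above
   k y = x. *)
Definition area (k n : nat) (p : seq bool) : nat :=
  #|[pred c : 'I_(k * n) * 'I_n | (col p c.2 <= c.1 < k * c.2)%N]|.

Definition labeled_path (n r : nat) : Type := (seq bool * 'M[nat]_(n, r))%type.
HB.instance Definition _ n r := Choice.on (labeled_path n r).

Definition nweakdes n r (w : 'M[nat]_(n, r)) (i i' : 'I_n) : nat :=
  #|[pred j : 'I_r | (w i' j <= w i j)%N]|.

(* LD k n r is LD^r_{k^n}. *)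
Definition LD (k n r : nat) : set (labeled_path n r) :=
  [set L | dyck k n L.1 /\
     forall i i' : 'I_n, i' = i.+1 :> nat ->
       (nweakdes L.2 i i' <= col L.1 i' - col L.1 i)%N].

Arguments LD : clear implicits.

Definition word n r (w : 'M[nat]_(n, r)) (j : 'I_r) : seq nat :=
  [seq w i j | i <- enum 'I_n].

Definition Xmon (R : comNzRingType) n r (L : labeled_path n r) : tseries r R :=
  tens (fun j => xmon R (word L.2 j)).

(* The partial sums of eta, in increasing order: the 0-based number i' of a row
   is the 1-based number of the preceding row i. *)
Definition eta_sums n r (L : labeled_path n r) : seq nat :=
  [seq val i' | i' : 'I_n <- enum 'I_n &
     [exists i : 'I_n, (i' == i.+1 :> nat) &&
        (nweakdes L.2 i i' < col L.1 i' - col L.1 i)%N]].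

Definition eta n r (L : labeled_path n r) : seq nat :=
  pairmap (fun a b => (b - a)%N) 0%N (rcons (eta_sums L) n).

Definition lattice_word (s : seq nat) : Prop :=
  forall i a, (count_mem a.+1 (take i s) <= count_mem a (take i s))%N.

(* A lattice word of length n has all its letters among the first n. *)
Definition word_type (s : seq nat) : seq nat :=
  [seq c <- [seq count_mem a s | a <- iota 0 (size s)] | (0 < c)%N].

(* LLD k n is LLD^k_{k^n}. *)
Definition LLD (k n : nat) : set (labeled_path n k) :=
  [set L | LD k n k L /\ forall j, lattice_word (word L.2 j)].

Arguments LLD : clear implicits.

(* The sum over L in A of q^area(L) F(L) *)
Definition area_sum (k n r r' : nat) (A : set (labeled_path n r))
    (G : labeled_path n r -> tseries r' Qq) : tseries r' Qq :=
  fun m => \sum_(L \in A) (q_Qq ^+ area k n L.1 * G L m).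

(* Main.v *)
(** At t = 1 the modified Macdonald polynomials are multiplicative: H_mu becomes
    the product of the W_r over the parts r of mu, where W_r enumerates the words
    of length r by a major index.  Indeed the first triangularity expands H_mu on
    the products of the W_r indexed by the partitions nu >= mu.  The second one,
    after applying omega, makes the coefficient of x^rho vanish in the same
    combination of the products of the omega h_r[x (1 - t) / (1 - q)], unless
    rho <= mu.  This coefficient is divisible by (1 - t)^l(rho), and the quotient
    at t = 1 is triangular for the number of parts, so that only nu = mu survives.

    A telescoping q-identity then expands e_n on the products of the W_r, with
    coefficients that do not depend on the statistic: for any statistic asc on
    pairs of letters, the same combination enumerates the sequences b_1 = 0,
    b_(i+1) < b_i + asc(u_i, u_(i+1)) by their sum.  The statistics of several
    words read in parallel add up, and the sequences b are the area sequences of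
    the Dyck paths compatible with the labels, which gives the first sum.

    Summing over the first column of labels, which has to increase strictly
    exactly where the inequality is tight for the other columns, gives e_eta.
    Finally, for every set of weak descents, the words with this set enumerate
    the same symmetric function as the Schur functions of the types of the
    lattice words with this set: by Moebius inversion it is enough to bound the
    set from above, and then both sides are products of e_r, by iterating the
    Pieri rule along lattice words. *)

From HB Require Import structures.
From mathcomp Require Import all_boot all_order all_algebra finmap multiset.
From mathcomp Require Import boolp classical_sets functions cardinality fsbigop.
From mathcomp Require Import zify ring.
Require Import Defs.
Set Implicit Arguments.
Unset Strict Implicit.
Unset Printing Implicit Defensive.
Import GRing.Theory.
Local Open Scope ring_scope.

(** * The ring of power series *)

Section Splits.
Implicit Types m : monom.

(** The conditions defining H_mu say nothing about poles at t = 1, so H_mu cannot simply be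
    specialized. Its coefficients on the products of the W_r are first written as a common scalar
    times polynomials in t that do not all vanish at t = 1. The two triangularities determine the
    values of these polynomials up to a factor, and the condition <H_mu, s_(n)> = 1, read as the
    coefficient of x_1^n, then determines the scalar. The transition matrix is the identity at t = 1
    and so is its inverse, which makes the coefficients of e_n on the H_mu regular.

    Omega is applied because la >= mu' does not bound the monomials of s_la from above, whereas la'
    <= mu does so for s_(la'). It is reached by expanding s_la on the h_nu and omega s_la on the
    e_nu with the same coefficients, through Pieri rules for both kinds of strips.

    The expansion of e_n is proved word by word over an arbitrary alphabet: it can then be applied
    to the word of the positions of a labelling, with the sum of the statistics of its k + 1
    columns. *)

Definition words m : seq (seq nat) := permutations (enum_mset m).

Lemma mem_words m u : (u \in words m) = (m == seq_mset u).
Proof.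
rewrite mem_permutations; apply/idP/eqP => [/eq_seq_msetP ->|->].
  by rewrite seq_mset_id.
by rewrite perm_sym perm_eq_seq_mset.
Qed.

Lemma words_uniq m : uniq (words m).
Proof. exact: permutations_uniq. Qed.

Lemma seq_mset_cat (u v : seq nat) :
  seq_mset (u ++ v) = msetD (seq_mset u) (seq_mset v).
Proof. by apply/msetP => a; rewrite msetE2 !mset_seqE count_cat. Qed.

(** A duplicate-free finite list of the index set of the sum in [smul]: every factorization of a
    monomial arises by cutting one of its words. *)
Definition splits m : seq (monom * monom) :=
  undup [seq (seq_mset (take i u), seq_mset (drop i u)) |
          u <- words m, i <- iota 0 (size u).+1].

Lemma splits_uniq m : uniq (splits m).
Proof. exact: undup_uniq. Qed.

Lemma mem_splits m p : (p \in splits m) = (msetD p.1 p.2 == m).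
Proof.
rewrite mem_undup; apply/allpairsPdep/eqP => [[u [i [um _ ->]]]|].
  by rewrite -seq_mset_cat cat_take_drop; apply/esym/eqP; rewrite -mem_words.
case: p => A B /= <-; exists (enum_mset A ++ enum_mset B), (size (enum_mset A)).
rewrite mem_words seq_mset_cat !seq_mset_id eqxx; split => //.
  by rewrite -[_ :: _]/(iota 0 (size (enum_mset A ++ enum_mset B)).+1) mem_iota size_cat ltnS leq_addr.
by rewrite /= take_size_cat // drop_size_cat // !seq_mset_id.
Qed.

End Splits.

Section Ring.
Variable R : comNzRingType.
Implicit Types (f g h : series R) (m : monom).

Lemma smulE f g m : smul f g m = \sum_(p <- splits m) f p.1 * g p.2.
Proof.
rewrite /smul (fsbigE (splits m)) ?splits_uniq //.
- rewrite big_seq_cond [RHS]big_seq_cond; apply: eq_bigl => p; rewrite andbT.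
  case: (boolP (p \in splits m)) => //=; rewrite mem_splits => /eqP E.
  by apply/asboolP.
- by move=> p /=; rewrite mem_splits => /eqP.
- by move=> p /= /eqP; rewrite -mem_splits => ->.
Qed.

Lemma smulC : commutative (@smul R).
Proof.
move=> f g; apply/funext => m; rewrite !smulE.
rewrite (perm_big [seq (p.2, p.1) | p <- splits m]) /=.
  by rewrite big_map; apply: eq_bigr => p _; rewrite mulrC.
apply: uniq_perm; rewrite ?splits_uniq ?map_inj_uniq ?splits_uniq //.
  by move=> [a b] [c d] /= [-> ->].
move=> [a b]; rewrite mem_splits; apply/idP/mapP => /= [ab|[[c d]]].
  by exists (b, a); rewrite // mem_splits /= msetDC.
by rewrite mem_splits /= msetDC => ? [-> ->].
Qed.

Lemma smulA : associative (@smul R).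
Proof.
move=> f g h; apply/funext => m.
pose L1 := [seq (p.1, p'.1, p'.2) | p <- splits m, p' <- splits p.2].
pose L2 := [seq (p'.1, p'.2, p.2) | p <- splits m, p' <- splits p.1].
have -> : smul f (smul g h) m = \sum_(x <- L1) f x.1.1 * g x.1.2 * h x.2.
  rewrite smulE big_allpairs_dep; apply: eq_bigr => p _ /=.
  by rewrite smulE mulr_sumr; apply: eq_bigr => p' _; rewrite mulrA.
have -> : smul (smul f g) h m = \sum_(x <- L2) f x.1.1 * g x.1.2 * h x.2.
  rewrite smulE big_allpairs_dep; apply: eq_bigr => p _ /=.
  by rewrite smulE mulr_suml.
apply: perm_big; apply: uniq_perm.
- apply: allpairs_uniq_dep => [|p _|]; try exact: splits_uniq.
  move=> x y /allpairsPdep[[a b] [[c d] [/= _ X ->]]].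
  move=> /allpairsPdep[[a' b'] [[c' d'] [/= _ Y ->]]] /=.
  by move: X Y; rewrite !mem_splits /= => /eqP <- /eqP <- [-> -> ->].
- apply: allpairs_uniq_dep => [|p _|]; try exact: splits_uniq.
  move=> x y /allpairsPdep[[a b] [[c d] [/= _ X ->]]].
  move=> /allpairsPdep[[a' b'] [[c' d'] [/= _ Y ->]]] /=.
  by move: X Y; rewrite !mem_splits /= => /eqP <- /eqP <- [-> -> ->].
move=> [[a b] c]; apply/allpairsPdep/allpairsPdep.
- move=> [[a' x] [[b' c'] [/= + + [-> -> ->]]]].
  rewrite !mem_splits /= => /eqP <- /eqP <-.
  by exists (msetD a' b', c'), (a', b'); rewrite !mem_splits /= eqxx msetDA.
- move=> [[x a'] [[b' c'] [/= + + [-> -> ->]]]].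
  rewrite !mem_splits /= => /eqP <- /eqP <-.
  by exists (b', msetD c' a'), (c', a'); rewrite !mem_splits /= eqxx msetDA.
Qed.

Lemma xmonE s m : xmon R s m = (m == seq_mset s)%:R.
Proof. by []. Qed.

Lemma smul_xmon s f m : smul (xmon R s) f (msetD (seq_mset s) m) = f m.
Proof.
rewrite smulE (bigD1_seq (seq_mset s, m)) ?splits_uniq ?mem_splits //=.
rewrite xmonE eqxx mul1r big1_seq ?addr0 // => -[a b] /= /andP[].
rewrite mem_splits /= xmonE; case: (a =P _) => [->|]; last by rewrite mul0r.
move=> + /eqP E; case/negP; apply/eqP; congr (_, _).
by rewrite -(msetDKB (seq_mset s) b) E msetDKB.
Qed.

Lemma smul_xmon0 s f m : ~~ msubset (seq_mset s) m -> smul (xmon R s) f m = 0.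
Proof.
move=> sm; rewrite smulE big1_seq // => -[a b] /=.
rewrite mem_splits xmonE /= => /eqP E.
case: (a =P _) => [as_|]; last by rewrite mul0r.
case/negP: sm; rewrite -E as_; apply/msubsetP => x.
by rewrite msetE2 leq_addr.
Qed.

Lemma seq_mset_nil : seq_mset [::] = mset0 :> monom.
Proof. by apply/msetP => a; rewrite mset_seqE mset0E. Qed.

Lemma smul1 : left_id (xmon R [::]) (@smul R).
Proof.
by move=> f; apply/funext => m; rewrite -{1}[m]mset0D -seq_mset_nil smul_xmon.
Qed.

Lemma smulDl : left_distributive (@smul R) (fun f g m => f m + g m).
Proof.
move=> f g h; apply/funext => m; rewrite !smulE -big_split.
by apply: eq_bigr => p _; rewrite mulrDl.
Qed.

Lemma series1_neq0 : (xmon R [::] : series R) <> (fun=> 0).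
Proof.
move=> /(congr1 (fun f : series R => f mset0)) /eqP.
by rewrite xmonE seq_mset_nil eqxx oner_eq0.
Qed.

Lemma sscaleAl (a : R) f g :
  (fun m => a * smul f g m) = smul (fun m => a * f m) g.
Proof.
apply/funext => m; rewrite !smulE mulr_sumr.
by apply: eq_bigr => p _; rewrite mulrA.
Qed.

End Ring.

HB.instance Definition _ (R : Type) := gen_eqMixin (series R).
HB.instance Definition _ (R : Type) := gen_choiceMixin (series R).

Section Instances.
Variable R : comNzRingType.

Fact saddA : associative (fun f g : series R => (fun m => f m + g m) : series R).
Proof. by move=> f g h; apply/funext => m; rewrite addrA. Qed.
Fact saddC : commutative (fun f g : series R => (fun m => f m + g m) : series R).
Proof. by move=> f g; apply/funext => m; rewrite addrC. Qed.
Fact sadd0 : left_id ((fun=> 0) : series R) (fun f g : series R => (fun m => f m + g m) : series R).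
Proof. by move=> f; apply/funext => m; rewrite add0r. Qed.
Fact saddN : left_inverse ((fun=> 0) : series R) (fun f : series R => (fun m => - f m) : series R)
   (fun f g : series R => (fun m => f m + g m) : series R).
Proof. by move=> f; apply/funext => m; rewrite addNr. Qed.

HB.instance Definition _ := GRing.isZmodule.Build (series R) saddA saddC sadd0 saddN.

Fact sone_neq0 : (xmon R [::] : series R) != 0.
Proof. by apply/eqP; apply: series1_neq0. Qed.

HB.instance Definition _ := GRing.Zmodule_isComNzRing.Build (series R)
  (@smulA R) (@smulC R) (@smul1 R) (@smulDl R) sone_neq0.

Fact sscaleA (a b : R) (f : series R) :
  (fun m => a * (b * f m)) = ((fun m => (a * b) * f m) : series R).
Proof. by apply/funext => m; rewrite mulrA. Qed.
Fact sscale1 : left_id 1 (fun (a : R) (f : series R) => (fun m => a * f m) : series R).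
Proof. by move=> f; apply/funext => m; rewrite mul1r. Qed.
Fact sscaleDr : right_distributive (fun (a : R) (f : series R) => (fun m => a * f m) : series R) +%R.
Proof. by move=> a f g; apply/funext => m; rewrite mulrDr. Qed.
Fact sscaleDl (f : series R) :
  {morph (fun (a : R) => (fun m => a * f m) : series R) : a b / a + b >-> a + b}.
Proof. by move=> a b; apply/funext => m; rewrite mulrDl. Qed.

HB.instance Definition _ := GRing.Zmodule_isLmodule.Build R (series R)
  sscaleA sscale1 sscaleDr sscaleDl.
HB.instance Definition _ := GRing.Lmodule_isLalgebra.Build R (series R) (@sscaleAl R).
HB.instance Definition _ := GRing.Lalgebra_isComAlgebra.Build R (series R).

Implicit Types f g : series R.

Lemma saddE f g m : (f + g) m = f m + g m. Proof. by []. Qed.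
Lemma soppE f m : (- f) m = - f m. Proof. by []. Qed.
Lemma szeroE m : (0 : series R) m = 0. Proof. by []. Qed.
Lemma sscaleE (a : R) f m : (a *: f) m = a * f m. Proof. by []. Qed.
Lemma smul_def f g : f * g = smul f g. Proof. by []. Qed.
Lemma sone_def : (1 : series R) = xmon R [::]. Proof. by []. Qed.

Lemma ssumE (I : Type) (r : seq I) (P : pred I) (F : I -> series R) m :
  (\sum_(i <- r | P i) F i) m = \sum_(i <- r | P i) F i m.
Proof. by elim/big_rec2: _ => // i a b _ <-. Qed.

Lemma sprodE (fs : seq (series R)) : sprod fs = \prod_(f <- fs) f.
Proof.
by elim: fs => [|f fs IH]; rewrite ?big_nil ?big_cons //= -?IH // sone_def.
Qed.

Lemma xmonM s t : xmon R s * xmon R t = xmon R (s ++ t).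
Proof.
apply/funext => m; rewrite smul_def.
case: (boolP (msubset (seq_mset s) m)) => [/msetBDKC <-|sm].
  rewrite smul_xmon !xmonE seq_mset_cat; congr (_%:R); congr nat_of_bool.
  apply/eqP/eqP => [->//|E].
  by rewrite -[LHS](msetDKB (seq_mset s)) E msetDKB.
rewrite smul_xmon0 // xmonE; case: eqP => // E; case/negP: sm.
by rewrite E seq_mset_cat; apply/msubsetP => x; rewrite msetE2 leq_addr.
Qed.

End Instances.

Lemma lincombE (F : fieldType) (l : seq (seq nat)) c (B : seq nat -> series F) :
  lincomb l c B = \sum_(la <- l) c la *: B la.
Proof. by apply/funext => m; rewrite ssumE. Qed.

(** * Series as sums over words *)

Section WordSums.
Variable R : comNzRingType.
Implicit Types (a b : seq nat -> R) (m : monom) (u : seq nat).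

(* A function on words, seen as a series in noncommuting variables, and its
   image in commuting variables. *)
Definition wsum a : series R := fun m => \sum_(u <- words m) a u.

Lemma eq_wsum a b : a =1 b -> wsum a = wsum b.
Proof. by move=> ab; apply/funext => m; apply: eq_bigr. Qed.

Lemma wsum_sum (I : Type) (r : seq I) (P : pred I) (F : I -> seq nat -> R) :
  wsum (fun u => \sum_(i <- r | P i) F i u) = \sum_(i <- r | P i) wsum (F i).
Proof. by apply/funext => m; rewrite ssumE /wsum exchange_big. Qed.

Lemma wsumZ c a : wsum (fun u => c * a u) = c *: wsum a.
Proof. by apply/funext => m; rewrite sscaleE /wsum mulr_sumr. Qed.

Lemma wsum_pred1 s : wsum (fun u => (u == s)%:R) = xmon R s.
Proof.
apply/funext => m; rewrite /wsum xmonE -mem_words.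
case: (boolP (s \in words m)) => sm; last first.
  by rewrite big1_seq // => u /= um; case: eqP um sm => // -> ->.
rewrite (bigD1_seq s) ?words_uniq //= eqxx big1 ?addr0 // => u.
by case: (u =P s).
Qed.

(** Since [a] is homogeneous of degree i, a word of the product can only be cut at position i. The
    splits of m, with a word for each half, then correspond to the words of m of length at least
    i. *)
Lemma wsumM i a b : (forall u, size u != i -> a u = 0) ->
  wsum a * wsum b = wsum (fun u => a (take i u) * b (drop i u)).
Proof.
move=> a0; apply/funext => m; rewrite smul_def smulE.
transitivity (\sum_(p <- splits m) \sum_(u <- words p.1 | size u == i)
   \sum_(v <- words p.2) a u * b v).
  apply: eq_bigr => p _; rewrite /wsum mulr_suml [LHS](bigID (fun u => size u == i)) /=.
  rewrite [X in _ + X]big1 ?addr0 => [|u]; last by move/a0->; rewrite mul0r.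
  by apply: eq_bigr => u _; rewrite mulr_sumr.
rewrite /wsum [RHS](bigID (fun u => (i <= size u)%N)) /= [X in _ = _ + X]big1 ?addr0; last first.
  by move=> u iu; rewrite a0 ?mul0r // size_take; case: ifP => *; lia.
pose M := [seq (take i w, drop i w) | w <- words m & (i <= size w)%N].
have <- : \sum_(x <- M) a x.1 * b x.2 =
   \sum_(w <- words m | (i <= size w)%N) a (take i w) * b (drop i w).
  by rewrite big_map big_filter.
pose L p := [seq (u, v) | u <- [seq u <- words p.1 | size u == i], v <- words p.2].
have -> : \sum_(p <- splits m) \sum_(u <- words p.1 | size u == i)
    \sum_(v <- words p.2) a u * b v =
  \sum_(x <- [seq x | p <- splits m, x <- L p]) a x.1 * b x.2.
  rewrite big_allpairs_dep; apply: eq_bigr => p _.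
  by rewrite /L big_allpairs big_filter.
apply: perm_big; apply: uniq_perm.
- apply: allpairs_uniq_dep => [|p _|]; first exact: splits_uniq.
    apply: allpairs_uniq; rewrite ?filter_uniq ?words_uniq //.
    by move=> [a1 b1] [a2 b2] _ _ /= [-> ->].
  move=> x y /allpairsPdep[[p p'] [[u v] [/= _ X ->]]].
  move=> /allpairsPdep[[q q'] [[u' v'] [/= _ Y ->]]] /= [E1 E2].
  move: X Y; rewrite {}E1 {}E2 => /allpairsP[[? ?] /= [A1 A2 [-> ->]]].
  move=> /allpairsP[[? ?] /= [B1 B2 [E1 E2]]].
  move: A1 A2 B1 B2; rewrite -{}E1 -{}E2 !mem_filter !mem_words.
  by do 2![move=> /andP[_ /eqP->] /eqP->].
- rewrite map_inj_in_uniq ?filter_uniq ?words_uniq // => x y _ _ [E1 E2].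
  by rewrite -[x](cat_take_drop i) E1 E2 cat_take_drop.
move=> [u v]; apply/allpairsPdep/mapP.
  move=> [[p q] [[u' v'] [/= + + [-> ->]]]]; rewrite mem_splits /= => /eqP <-.
  move=> /allpairsP[[? ?] /= [A1 A2 [-> ->]]].
  move: A1 A2; rewrite mem_filter !mem_words => /andP[/eqP <- /eqP->] /eqP->.
  eexists (_ ++ _); rewrite ?take_size_cat ?drop_size_cat //.
  by rewrite mem_filter mem_words seq_mset_cat size_cat leq_addr eqxx.
move=> [w]; rewrite mem_filter mem_words => /andP[iw /eqP->] [-> ->].
exists (seq_mset (take i w), seq_mset (drop i w)), (take i w, drop i w).
rewrite mem_splits /= -seq_mset_cat cat_take_drop eqxx; split=> //.
apply/allpairsP; exists (take i w, drop i w); rewrite /= mem_filter !mem_words.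
by rewrite !eqxx andbT size_take_min; split => //; apply/eqP/minn_idPl.
Qed.

(** The noncommutative counterpart of a product of homogeneous series, the word being cut into
    blocks of lengths [rs]. The alphabet is arbitrary because blocks will also be read on words of
    positions. *)
Fixpoint blk (T : Type) (a : nat -> seq T -> R) (rs : seq nat) (u : seq T) : R :=
  if rs is r :: rs' then a r (take r u) * blk a rs' (drop r u)
  else (nilp u)%:R.

Lemma wsum_blk (a : nat -> seq nat -> R) rs :
  (forall r u, size u != r -> a r u = 0) ->
  wsum (blk a rs) = \prod_(r <- rs) wsum (a r).
Proof.
move=> a0; elim: rs => [|r rs IH].
  rewrite big_nil sone_def -wsum_pred1; apply: eq_wsum => u /=.
  by case: u.
by rewrite big_cons -IH (wsumM (i := r)) // => u; apply: a0.
Qed.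

Lemma blk_size (T : Type) (a : nat -> seq T -> R) rs (u : seq T) :
  (forall r (v : seq T), size v != r -> a r v = 0) -> size u != sumn rs -> blk a rs u = 0.
Proof.
move=> a0; elim: rs u => [|r rs IH] u /=; first by case: u.
case: (leqP r (size u)) => ru su.
  by rewrite IH ?mulr0 // size_drop; apply: contra su => /eqP <-; rewrite subnKC.
by rewrite a0 ?mul0r // take_oversize ?(ltnW ru) // neq_ltn ru.
Qed.

Lemma blk_map (S T : Type) (f : S -> T) (a : nat -> seq T -> R) rs (u : seq S) :
  blk a rs (map f u) = blk (fun r v => a r (map f v)) rs u.
Proof.
by elim: rs u => [|r rs IH] u /=; [case: u | rewrite -map_take -map_drop IH].
Qed.

Lemma eq_blk (T : Type) (a a' : nat -> seq T -> R) rs (u : seq T) :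
  (forall r v, a r v = a' r v) -> blk a rs u = blk a' rs u.
Proof. by move=> aa; elim: rs u => //= r rs IH u; rewrite aa IH. Qed.

(** Makes the index set independent of [m], so that a product of such sums over several columns can
    be distributed. *)
Lemma wsum_tuple n N a m : (forall u, size u != n -> a u = 0) ->
  (forall x, x \in enum_mset m -> (x < N)%N) ->
  wsum a m = \sum_(x : n.-tuple 'I_N)
    (m == seq_mset (map val x))%:R * a (map val x).
Proof.
move=> a0 mN; rewrite /wsum.
rewrite [LHS](bigID (fun u => size u == n)) /= [X in _ + X]big1 ?addr0; last first.
  by move=> u; apply: a0.
rewrite [RHS](bigID (fun x : n.-tuple 'I_N => m == seq_mset (map val x))) /=.
rewrite [X in _ + X]big1 ?addr0; last by move=> x /negbTE ->; rewrite mul0r.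
rewrite -big_filter -[RHS]big_filter.
have -> : \sum_(x <- [seq x <- index_enum _ | m == seq_mset (map val (tval x))])
    (m == seq_mset (map val x))%:R * a (map val (x : n.-tuple 'I_N)) =
  \sum_(u <- [seq map val (tval x) | x : n.-tuple 'I_N <- [seq x <- index_enum _ |
     m == seq_mset (map val (tval x))]]) a u.
  rewrite big_map big_seq [RHS]big_seq; apply: eq_bigr => x.
  by rewrite mem_filter => /andP[-> _]; rewrite mul1r.
apply: perm_big; apply: uniq_perm.
- by rewrite filter_uniq ?words_uniq.
- rewrite map_inj_uniq; first by rewrite filter_uniq ?index_enum_uniq.
  by move=> x y /(inj_map val_inj) /val_inj.
move=> u; rewrite mem_filter mem_words; apply/andP/mapP; last first.
  move=> [x]; rewrite mem_filter => /andP[/eqP-> _ ->].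
  by rewrite size_map size_tuple !eqxx.
move=> [/eqP su /eqP mu].
have uN : all (fun x => (x < N)%N) u.
  apply/allP => x xu; apply: mN; rewrite mu.
  by rewrite (perm_mem (perm_eq_seq_mset u)).
have [v vE] : exists v : seq 'I_N, map val v = u.
  elim: {su mu} u uN => [|x u IH] /=; first by exists [::].
  by move=> /andP[xN /IH[v <-]]; exists (Ordinal xN :: v).
have sv : size v == n by rewrite -su -vE size_map.
exists (Tuple sv); rewrite ?vE //.
by rewrite mem_filter /= vE mu eqxx mem_index_enum.
Qed.

End WordSums.

(** * Chains of words and their q-enumeration *)

Section Families.
Variable R : comNzRingType.

Lemma fsum_xmon (A : set (seq nat)) :
  (fun m => \sum_(s \in A) xmon R s m) = wsum (fun u => (u \in A)%:R).
Proof.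
apply/funext => m; rewrite /wsum.
rewrite (fsbigE [seq u <- words m | u \in A]) ?filter_uniq ?words_uniq //.
- rewrite big_filter_cond big_seq_cond [RHS](bigID (mem A)) /= [X in _ = _ + X]big1 ?addr0.
    rewrite [RHS]big_seq_cond; apply: eq_big => [u|u].
      by rewrite andbb.
    by rewrite xmonE -mem_words => /andP[-> /andP[-> _]].
  by move=> u /negbTE ->.
- by move=> u /=; rewrite mem_filter => /andP[/set_mem].
- move=> u Au /=; rewrite mem_filter (mem_set Au) /= xmonE mem_words.
  by move=> /negbTE->.
Qed.

Definition incr_word r (u : seq nat) : R := ((size u == r) && sorted ltn u)%:R.
Definition const_word r (u : seq nat) : R := ((size u == r) && constant u)%:R.

Lemma incr_word0 r u : size u != r -> incr_word r u = 0.
Proof. by rewrite /incr_word => /negbTE->. Qed.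
Lemma const_word0 r u : size u != r -> const_word r u = 0.
Proof. by rewrite /const_word => /negbTE->. Qed.

Lemma elemE n : elem R n = wsum (incr_word n).
Proof.
rewrite /elem fsum_xmon; apply: eq_wsum => u; congr (_%:R); congr nat_of_bool.
by apply/idP/andP => [/set_mem[-> ->]|[/eqP sn su]]; rewrite ?eqxx ?mem_set.
Qed.

Lemma psumE n : (0 < n)%N -> psum R n = wsum (const_word n).
Proof.
move=> n0; transitivity (fun m => \sum_(s \in (nseq n) @` [set: nat]) xmon R s m).
  apply/funext => m; rewrite fsbig_image // => i j _ _.
  by case: n n0 => // n _ [].
rewrite fsum_xmon; apply: eq_wsum => u; congr (_%:R); congr nat_of_bool.
apply/idP/andP => [/set_mem[i _ <-]|[/eqP sn]].
  by rewrite size_nseq eqxx; split=> //; case: n {n0} => //= n; rewrite all_pred1_nseq.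
case: u sn => [|i u] /=; first by move=> /eqP; rewrite ltn_eqF.
move=> sn /all_pred1P uE; apply/mem_set; exists i => //.
by rewrite -sn /= -uE.
Qed.

Lemma elemsE eta : elems R eta = wsum (blk incr_word eta).
Proof.
rewrite /elems sprodE big_map wsum_blk; last by move=> *; apply: incr_word0.
by apply: eq_bigr => i _; rewrite elemE.
Qed.

Lemma psumsE la : 0%N \notin la -> psums R la = wsum (blk const_word la).
Proof.
move=> la0; rewrite /psums sprodE big_map wsum_blk; last by move=> *; apply: const_word0.
rewrite big_seq [RHS]big_seq; apply: eq_bigr => i il; rewrite psumE //.
by case: i il la0 => // ->.
Qed.

End Families.

Section Chains.
Variables (F : fieldType) (q : F).
Hypothesis q1 : forall i, 1 - q ^+ i.+1 != 0.

Definition qfact n : F := \prod_(i < n) (1 - q ^+ i.+1).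

Lemma qfactS n : qfact n.+1 = qfact n * (1 - q ^+ n.+1).
Proof. by rewrite /qfact big_ord_recr. Qed.

Lemma qfact_neq0 n : qfact n != 0.
Proof. by apply/prodf_neq0 => i _. Qed.

Section Letters.
Variables (T : Type) (asc : T -> T -> nat).
Implicit Types u : seq T.

(** A major index read from the right: each value [asc x y] is weighted by the number of letters
    that follow x. *)
Fixpoint fstat u : nat :=
  if u is x :: u' then
    ((if u' is y :: _ then size u' * asc x y else 0) + fstat u')%N
  else 0%N.

Definition phi u : F := q ^+ fstat u / qfact (size u).

Fixpoint echain s x u : F :=
  if u is y :: u' then q ^+ s * \sum_(s' < s + asc x y) echain s' y u'
  else q ^+ s.

(* [ech s u] is the sum of q^(b_1 + b_2 + ...) over the sequences of naturals
   with b_1 = s and b_(i+1) < b_i + asc u_i u_(i+1). *)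
Definition ech s u : F := if u is x :: u' then echain s x u' else 1.

Lemma geometric (z : F) n : z != 1 -> \sum_(i < n) z ^+ i = (1 - z ^+ n) / (1 - z).
Proof.
move=> z1; have z1' : 1 - z != 0 by rewrite subr_eq0 eq_sym.
apply: (mulIf z1'); rewrite divfK // mulrC.
elim: n => [|n IH]; first by rewrite big_ord0 mulr0 expr0 subrr.
by rewrite big_ord_recr /= mulrDr IH exprS; ring.
Qed.

(** Induction on the word. The cuts after the first letter give the same sum for the tail, summed
    over the admissible second entries s'. This is a geometric sum of ratio q to the length of the
    tail, and its constant term cancels the cut just after x. *)
Lemma chain_cancel s x u :
  \sum_(j < (size u).+1)
    (-1) ^+ j.+1 * ech s (take j.+1 (x :: u)) * phi (drop j.+1 (x :: u)) =
  - (q ^+ (s * (size u).+1 + fstat (x :: u)) / qfact (size u)).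
Proof.
elim: u s x => [|y u IH] s x.
  by rewrite big_ord1 /= /phi /= muln1 !addn0 expr0 /qfact big_ord0 invr1 expr1 !mulr1 mulN1r.
rewrite big_ord_recl.
have -> : \sum_(i < size (y :: u)) (-1) ^+ (lift ord0 i).+1 *
     ech s (take (lift ord0 i).+1 [:: x, y & u]) *
     phi (drop (lift ord0 i).+1 [:: x, y & u]) =
   - q ^+ s * \sum_(s' < s + asc x y) \sum_(j < (size u).+1)
    (-1) ^+ j.+1 * ech s' (take j.+1 (y :: u)) * phi (drop j.+1 (y :: u)).
  rewrite exchange_big mulr_sumr /=; apply: eq_bigr => j _; rewrite /bump /=.
  rewrite -mulr_suml -mulr_sumr !add0n add1n exprS.
  move: (phi _) ((-1) ^+ _) (q ^+ s) (\sum_(_ < _) _) => P a b S.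
  by ring.
under eq_bigr do rewrite IH.
rewrite sumrN -[fstat [:: x, y & u]]/((size u).+1 * asc x y + fstat (y :: u))%N.
rewrite -[phi (drop _ _)]/(phi (y :: u)) -[ech s _]/(q ^+ s) -[size (y :: u)]/(size u).+1.
set f := fstat (y :: u); set n := (size u).+1.
have -> : \sum_(i < s + asc x y) q ^+ (i * n + f) / qfact (size u) =
   (1 - q ^+ (n * (s + asc x y))) / (1 - q ^+ n) * (q ^+ f / qfact (size u)).
  rewrite exprM -geometric; last by rewrite eq_sym -subr_eq0 q1.
  rewrite mulr_suml; apply: eq_bigr => i _.
  by rewrite exprD mulnC exprM mulrA.
rewrite expr1 /phi -[size (y :: u)]/n -/f qfactS -/n.
have -> : (s * n.+1 + (n * asc x y + f) = s + n * (s + asc x y) + f)%N by lia.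
rewrite !exprD; field.
by rewrite qfact_neq0 q1.
Qed.

(** For strict ascents [ech 0] detects increasing words, and summing over words gives E(-z) W(z) =
    W(qz). The identity holds for each word and each statistic [asc]. *)
Lemma chain_sum u :
  \sum_(j < (size u).+1) (-1) ^+ j * ech 0 (take j u) * phi (drop j u) =
  q ^+ size u * phi u.
Proof.
case: u => [|x u]; first by rewrite big_ord1 /= !mul1r.
rewrite big_ord_recl /= chain_cancel /phi /= qfactS mul0n add0n.
rewrite !mul1r; set f := (_ + fstat u)%N; field.
by rewrite qfact_neq0 q1.
Qed.

End Letters.
End Chains.

(** Compositions are built by appending the last part, as in the recursion that [chain_sum] yields
    for [ech]. *)
Fixpoint comps_rec fuel n : seq (seq nat) :=
  if fuel is f.+1 then
    [:: n] :: flatten [seq [seq rcons al (n - j)%N | al <- comps_rec f j] | j <- iota 1 n.-1]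
  else [::].

Definition comps n := comps_rec n n.

Lemma comps_recP f n al : (0 < n)%N -> al \in comps_rec f n ->
  [/\ al != [::], sumn al = n & 0%N \notin al].
Proof.
elim: f n al => [|f IH] n al n0 //=.
rewrite inE => /orP[/eqP->|/flattenP[s /mapP[j]]].
  by rewrite /= addn0 inE eq_sym -lt0n n0.
rewrite mem_iota => jn -> /mapP[be]; have j0 : (0 < j)%N by lia.
move=> /(IH _ _ j0)[_ sb b0] ->; rewrite sumn_rcons sb mem_rcons inE negb_or b0.
by split; [case: (be) | lia | lia].
Qed.

(** * Expansion of the chain enumerator on products of blocks *)

Section Expansion.
Variables (F : fieldType) (q : F).
Hypothesis q1 : forall i, 1 - q ^+ i.+1 != 0.

Definition kfac a : F := (-1) ^+ a / qfact q a.

(* The coefficients of e_n on the products of the H_(a) at t = 1 *)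
Definition kcoef (al : seq nat) : F :=
  if al is a :: al' then
    (q ^+ a - 1) * kfac a * \prod_(b <- al') (- kfac b)
  else 1.

Lemma kcoef_rcons al a : al != [::] -> kcoef (rcons al a) = - (kcoef al * kfac a).
Proof.
by case: al => //= b al _; rewrite big_rcons /= [X in _ * X]mulrC; ring.
Qed.

Definition wblock (T : Type) (asc : T -> T -> nat) r (v : seq T) : F :=
  (size v == r)%:R * q ^+ fstat asc v.

Lemma wblock0 (T : Type) (asc : T -> T -> nat) r (v : seq T) :
  size v != r -> wblock asc r v = 0.
Proof. by rewrite /wblock => /negbTE->; rewrite mul0r. Qed.

Lemma blk_rcons (T : Type) (a : nat -> seq T -> F) rs r (u : seq T) :
  (forall r (v : seq T), size v != r -> a r v = 0) ->
  blk a (rcons rs r) u = blk a rs (take (sumn rs) u) * a r (drop (sumn rs) u).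
Proof.
move=> a0; elim: rs u => [|b rs IH] u /=.
  rewrite take0 drop0 mul1r; have [su|su] := eqVneq (size u) r.
    by rewrite -su take_size drop_size mulr1.
  rewrite (a0 r u su); case: (ltngtP (size u) r) su => // ru _.
    by rewrite take_oversize ?(ltnW ru) // a0 ?mul0r // neq_ltn ru.
  by rewrite /nilp size_drop subn_eq0 leqNgt ru mulr0.
rewrite IH mulrA drop_drop [(sumn rs + b)%N]addnC; congr (_ * _ * _).
  by rewrite take_takel // leq_addr.
by rewrite take_drop addnC.
Qed.

(** [chain_sum] is solved for its last term, which is [ech] of the whole word; the other terms
    involve proper prefixes, followed by one block. The coefficients depend on lengths only, hence
    not on [asc]. *)
Lemma ech_expansion (T : Type) (asc : T -> T -> nat) (u : seq T) :
  (0 < size u)%N ->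
  ech q asc 0 u = \sum_(al <- comps (size u)) kcoef al * blk (wblock asc) al u.
Proof.
suff H f : forall u : seq T, (0 < size u <= f)%N -> ech q asc 0 u =
    \sum_(al <- comps_rec f (size u)) kcoef al * blk (wblock asc) al u.
  by move=> u0; apply: H; rewrite u0 leqnn.
elim: f => [|f IH] {}u; first by case: (size u).
case sn: (size u) => [//|n] nf.
have blk1 : blk (wblock asc) [:: n.+1] u = wblock asc n.+1 u.
  by rewrite /blk -sn take_size drop_size mulr1.
rewrite [comps_rec _ _]/= big_cons blk1 big_flatten big_map.
have := chain_sum q1 asc u; rewrite sn big_ord_recl big_ord_recr /= /bump /=.
rewrite take0 drop0 !mul1r add1n -sn take_size drop_size sn.
have -> : phi q asc [::] = 1 by rewrite /phi /= /qfact big_ord0 divr1.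
rewrite mulr1 => E.
have -> : ech q asc 0 u = (-1) ^+ n.+1 * ((q ^+ n.+1 - 1) * phi q asc u -
    \sum_(i < n) (-1) ^+ (1 + i) * ech q asc 0 (take (1 + i) u) * phi q asc (drop (1 + i) u)).
  have -> : ech q asc 0 u = (-1) ^+ n.+1 * ((-1) ^+ n.+1 * ech q asc 0 u).
    by rewrite mulrA -expr2 sqrr_sign mul1r.
  congr (_ * _); move: E; set S := \sum_(_ < n) _; set e := _ * ech _ _ _ _.
  by move=> E; rewrite mulrBl -E; ring.
rewrite mulrBr; congr (_ + _).
  rewrite /kcoef big_nil mulr1.
  by rewrite /wblock sn eqxx mul1r /kfac /phi sn; ring.
rewrite mulr_sumr -sumrN -[iota 1 n]/(iota (1 + 0) n) iotaDl big_map.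
rewrite -[in RHS](subn0 n) -/(index_iota 0 n) big_mkord; apply: eq_bigr => i _.
have il : (1 + i < size u)%N by rewrite sn; case: i => /=; lia.
have si : size (take (1 + i) u) = (1 + i)%N by rewrite size_takel // ltnW.
rewrite IH si; last by case: (i) => /=; lia.
rewrite big_map mulr_sumr mulr_suml mulr_sumr -sumrN.
rewrite big_seq [RHS]big_seq; apply: eq_bigr => al /comps_recP[] // al0 sal _.
rewrite kcoef_rcons // blk_rcons; last by move=> *; apply: wblock0.
rewrite sal /wblock size_drop sn subn0 eqxx mul1r /kfac /phi size_drop sn.
have -> : (-1) ^+ (n.+1 - (1 + i)) = (-1) ^+ n.+1 * (-1) ^+ (1 + i) :> F.
  by rewrite -signr_odd oddB ?signr_addb ?signr_odd //; lia.
ring.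
Qed.
End Expansion.

(** * Restriction to finitely many variables *)

Section Truncation.
Variable R : comNzRingType.
Implicit Types (f g : series R) (m : monom).

Definition letters_lt N m := all (fun a => a < N)%N (enum_mset m).

Lemma letters_ltP N m : reflect (forall a, a \in m -> (a < N)%N) (letters_lt N m).
Proof. exact: allP. Qed.

Lemma letters_ltD N m m' :
  letters_lt N (msetD m m') = letters_lt N m && letters_lt N m'.
Proof.
apply/letters_ltP/andP => [H|[/letters_ltP H /letters_ltP H'] a].
  by split; apply/letters_ltP => a am; apply: H; rewrite in_msetD am ?orbT.
by rewrite in_msetD => /orP[/H|/H'].
Qed.

Lemma letters_lt_seq N u : letters_lt N (seq_mset u) = all (fun a => a < N)%N u.
Proof. exact/perm_all/perm_eq_seq_mset. Qed.

Lemma letters_ltW N N' m : (N <= N')%N -> letters_lt N m -> letters_lt N' m.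
Proof. by move=> NN /letters_ltP H; apply/letters_ltP => a /H/leq_trans; apply. Qed.

Lemma ex_letters_lt m : exists N, letters_lt N m.
Proof.
exists (\max_(a <- enum_mset m) a).+1; apply/letters_ltP => a am.
by rewrite ltnS; apply: (leq_bigmax_seq (F := id)).
Qed.

(** Sets the variables of index at least N to zero. Two series that agree after every such
    specialization are equal ([trunc_inj]). *)
Definition trunc N f : series R := fun m => if letters_lt N m then f m else 0.

Lemma truncM N f g : trunc N (f * g) = trunc N f * trunc N g.
Proof.
apply/funext => m; rewrite /trunc !smul_def !smulE; case: ifP => mN.
  apply: eq_big_seq => -[a b]; rewrite mem_splits /= => /eqP E.
  by move: mN; rewrite -E letters_ltD => /andP[-> ->].
rewrite big1_seq // => -[a b] /=; rewrite mem_splits /= => /eqP E.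
move: mN; rewrite -E letters_ltD.
by do 2!case: letters_lt; rewrite // ?mulr0 ?mul0r.
Qed.

Lemma trunc1 N : trunc N 1 = 1.
Proof.
apply/funext => m; rewrite /trunc sone_def xmonE seq_mset_nil.
by case: eqP => [->|_]; rewrite ?if_same // /letters_lt enum_mset0.
Qed.

Lemma truncD N f g : trunc N (f + g) = trunc N f + trunc N g.
Proof. by apply/funext => m; rewrite /trunc !saddE; case: ifP; rewrite ?addr0. Qed.

Lemma truncN N f : trunc N (- f) = - trunc N f.
Proof. by apply/funext => m; rewrite /trunc !soppE; case: ifP; rewrite ?oppr0. Qed.

Lemma truncZ N c f : trunc N (c *: f) = c *: trunc N f.
Proof. by apply/funext => m; rewrite /trunc !sscaleE; case: ifP; rewrite ?mulr0. Qed.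

Lemma trunc0 N : trunc N 0 = 0.
Proof. by apply/funext => m; rewrite /trunc if_same. Qed.

Lemma trunc_sum N (I : Type) (r : seq I) (P : pred I) (f : I -> series R) :
  trunc N (\sum_(i <- r | P i) f i) = \sum_(i <- r | P i) trunc N (f i).
Proof. exact: (big_morph (trunc N) (truncD N) (trunc0 N)). Qed.

Lemma trunc_prod N (I : Type) (r : seq I) (P : pred I) (f : I -> series R) :
  trunc N (\prod_(i <- r | P i) f i) = \prod_(i <- r | P i) trunc N (f i).
Proof. exact: (big_morph (trunc N) (truncM N) (trunc1 N)). Qed.

Lemma truncE N f m : letters_lt N m -> trunc N f m = f m.
Proof. by rewrite /trunc => ->. Qed.

Lemma trunc_inj f g : (forall N, trunc N f = trunc N g) -> f = g.
Proof.
move=> fg; apply/funext => m; have [N mN] := ex_letters_lt m.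
by rewrite -(truncE f mN) fg truncE.
Qed.

Definition xvar a : series R := xmon R [:: a].

Fixpoint xvars N : seq (series R) :=
  if N is N'.+1 then xvar N' :: xvars N' else [::].

Lemma xvarX a k : xvar a ^+ k = xmon R (nseq k a).
Proof.
elim: k => [|k IH]; first by rewrite expr0 sone_def.
rewrite exprS IH xmonM; reflexivity.
Qed.

Lemma seq_mset_nseq k (a : nat) : seq_mset (nseq k a) = msetn k a.
Proof. by apply/msetP => b; rewrite mset_seqE count_nseq msetnE /= eq_sym; case: eqP; rewrite ?mul1n. Qed.

Lemma xvarXM a k f m :
  (xvar a ^+ k * f) m = if (k <= m a)%N then f (msetB m (msetn k a)) else 0.
Proof.
rewrite xvarX smul_def; case: ifP => km.
  have sm : msubset (msetn k a) m.
    by apply/msubsetP => b; rewrite msetnE; case: eqP => [->|].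
  by rewrite -{1}(msetBDKC sm) -seq_mset_nseq smul_xmon.
apply: smul_xmon0; apply: contraFN km => /msubsetP/(_ a).
by rewrite seq_mset_nseq msetnxx.
Qed.

Lemma elem_count n m : elem R n m = ((size (enum_mset m) == n) && uniq m)%:R.
Proof.
rewrite elemE /wsum; case: (boolP (_ && _)) => [/andP[/eqP sm um]|H].
  have sw : sort leq (enum_mset m) \in words m by rewrite mem_permutations perm_sort.
  rewrite (bigD1_seq _ sw) ?words_uniq //= big1_seq ?addr0.
    by rewrite /incr_word size_sort sm eqxx ltn_sorted_uniq_leq sort_uniq um (sort_sorted leq_total).
  move=> u /andP[us]; rewrite mem_permutations => pu.
  rewrite /incr_word; case: (boolP (sorted ltn u)) => su; last by rewrite andbF.
  case/negP: us; apply/eqP; apply: (sorted_eq leq_trans anti_leq).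
  - by rewrite ltn_sorted_uniq_leq in su; case/andP: su.
  - exact: (sort_sorted leq_total).
  - by rewrite perm_sym perm_sort perm_sym.
rewrite big1_seq // => u /= ; rewrite mem_permutations => pu.
rewrite /incr_word; case: (boolP (_ && _)) => // /andP[/eqP su].
rewrite ltn_sorted_uniq_leq => /andP[uu _]; case/negP: H.
by rewrite -(perm_size pu) su eqxx -(perm_uniq pu).
Qed.

Lemma elem0 : elem R 0 = 1.
Proof.
apply/funext => m; rewrite elem_count sone_def xmonE seq_mset_nil.
have -> : (m == mset0) = (size (enum_mset m) == 0).
  apply/eqP/eqP => [->|/size0nil E]; first by rewrite enum_mset0.
  by rewrite -[m]seq_mset_id E seq_mset_nil.
by case: eqP => // /size0nil ->.
Qed.

Lemma trunc_elemS N j : trunc N.+1 (elem R j.+1) =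
  trunc N (elem R j.+1) + xvar N * trunc N (elem R j).
Proof.
apply/funext => m; rewrite saddE -[xvar N]expr1 xvarXM.
rewrite /trunc; case: ifP => mN1; last first.
  rewrite ifN ?add0r; last by apply: contraFN mN1; apply: letters_ltW.
  case: ifP => // Nm; rewrite ifN //; apply: contraFN mN1 => /letters_ltP H.
  apply/letters_ltP => a am; case: (ltngtP a N) => [|aN|->//]; first exact: leqW.
  have: (a < N)%N; last by rewrite ltnNge (ltnW aN).
  by apply: H; rewrite in_msetB msetnE gtn_eqF // mset_gt0.
case: (posnP (m N)) => mN.
  rewrite addr0 ifT //; apply/letters_ltP => a am.
  have := letters_ltP _ _ mN1 a am; rewrite ltnS leq_eqVlt => /orP[/eqP aN|//].
  by move: am; rewrite -mset_gt0 aN mN.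
rewrite [X in X + _]ifF ?add0r; last first.
  by apply/negP => /letters_ltP/(_ N); rewrite ltnn -mset_gt0 mN => /(_ isT).
have mE : m = msetD (msetn 1 N) (msetB m (msetn 1 N)).
  by rewrite msetBDKC //; apply/msubsetP => b; rewrite msetnE; case: eqP => [->|].
set m' := msetB m _ in mE *.
have pm : perm_eq (enum_mset m) (N :: enum_mset m').
  apply/eq_seq_msetP; rewrite -cat1s seq_mset_cat !seq_mset_id {1}mE.
  by rewrite -(seq_mset_nseq 1).
case: ifP => m'N.
  rewrite !elem_count (perm_size pm) (perm_uniq pm) /= eqSS.
  case: (boolP (N \in enum_mset m')) => //= Nm'.
  by have := letters_ltP _ _ m'N N Nm'; rewrite ltnn.
rewrite elem_count (perm_uniq pm) /= [X in X && uniq _]negbTE ?andbF //.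
rewrite negbK; apply: contraFT m'N => Nm'; apply/letters_ltP => a am'.
have : (a < N.+1)%N by apply: (letters_ltP _ _ mN1); rewrite mE in_msetD am' orbT.
by rewrite ltnS leq_eqVlt => /orP[/eqP aN|//]; rewrite -aN am' in Nm'.
Qed.

(** The elementary symmetric polynomial e_j at the elements of [xs]. *)
Definition ecoef (A : comNzRingType) (xs : seq A) j : A := (\prod_(x <- xs) (1 + x *: 'X))`_j.

Lemma ecoef_cons0 (A : comNzRingType) (x : A) xs : ecoef (x :: xs) 0 = ecoef xs 0.
Proof. by rewrite /ecoef big_cons mulrDl mul1r -scalerAl coefD coefZ coefXM mulr0 addr0. Qed.

Lemma ecoef_consS (A : comNzRingType) (x : A) xs j :
  ecoef (x :: xs) j.+1 = ecoef xs j.+1 + x * ecoef xs j.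
Proof. by rewrite /ecoef big_cons mulrDl mul1r -scalerAl coefD coefZ coefXM. Qed.

Lemma ecoef0 (A : comNzRingType) (xs : seq A) : ecoef xs 0 = 1.
Proof. by elim: xs => [|x xs IH]; rewrite ?ecoef_cons0 // /ecoef big_nil coefC. Qed.

Lemma trunc_elem N j : trunc N (elem R j) = ecoef (xvars N) j.
Proof.
elim: N j => [|N IH] [|j].
- by rewrite /ecoef big_nil coefC elem0 trunc1.
- rewrite /ecoef big_nil coef1 /= mulr0n; apply/funext => m; rewrite szeroE.
  by rewrite /trunc elem_count /letters_lt; case: (enum_mset m).
- rewrite elem0 trunc1 /= ecoef_cons0 -IH elem0 trunc1; reflexivity.
- rewrite trunc_elemS /= ecoef_consS !IH; reflexivity.
Qed.

Lemma trunc_psum N n : (0 < n)%N -> trunc N (psum R n) = \sum_(x <- xvars N) x ^+ n.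
Proof.
move=> n0; have -> : \sum_(x <- xvars N) x ^+ n = \sum_(a < N) xvar a ^+ n.
  elim: N => [|N IH]; first by rewrite big_nil big_ord0.
  by rewrite big_cons IH big_ord_recr addrC.
apply/funext => m; rewrite ssumE.
under eq_bigr do rewrite xvarX xmonE.
rewrite /trunc; case: ifP => mN; last first.
  rewrite big1 // => a _; case: eqP => // E; case/negP: mN.
  by rewrite E letters_lt_seq all_nseq ltn_ord orbT.
rewrite /psum (fsbigE [seq val a | a : 'I_N <- index_enum _]) //.
- by rewrite big_map; apply: eq_bigl => a; apply/mem_set.
- by rewrite map_inj_uniq ?index_enum_uniq //; apply: val_inj.
move=> a _ /=; rewrite xmonE; case: eqP => // E; case/negP.
have aN : (a < N)%N.
  move: mN; rewrite E letters_lt_seq all_nseq; case: n n0 {E} => //=.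
by apply/mapP; exists (Ordinal aN); rewrite ?mem_index_enum.
Qed.

End Truncation.

(** * Exponential generating functions *)

Section ExpFamilies.
Variables (F : fieldType) (A : comAlgType F).
Hypothesis char0 : forall n, n.+1%:R != 0 :> F.
Implicit Types (P g : nat -> A).

(* [\sum_n g_n z^n = exp (\sum_(i > 0) P_i z^i / i)]; the value [P 0] is
   irrelevant. *)
Definition isexp P g :=
  g 0%N = 1 /\ forall n, n.+1%:R *: g n.+1 = \sum_(i < n.+1) P i.+1 * g (n - i)%N.

Lemma isexp_rec P g n : isexp P g ->
  g n.+1 = n.+1%:R^-1 *: \sum_(i < n.+1) P i.+1 * g (n - i)%N.
Proof. by case=> _ <-; rewrite scalerA mulVf ?scale1r ?char0. Qed.

Lemma isexp_uniq P P' g g' : isexp P g -> isexp P' g' ->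
  (forall i, P i.+1 = P' i.+1) -> g =1 g'.
Proof.
move=> Eg Eg' PP n; elim/ltn_ind: n => -[|n] IH; first by case: Eg Eg' => -> _ [->].
rewrite (isexp_rec n Eg) (isexp_rec n Eg'); congr (_ *: _).
by apply: eq_bigr => i _; rewrite PP IH // ltnS leq_subr.
Qed.

Definition conv g g' n : A := \sum_(i < n.+1) g i * g' (n - i)%N.

Lemma coefM_eq (p p' r : {poly A}) n : (forall i, (i <= n)%N -> p`_i = p'`_i) ->
  (p * r)`_n = (p' * r)`_n.
Proof.
move=> pp; rewrite !coefM; apply: eq_bigr => i _; rewrite pp //.
by rewrite -ltnS.
Qed.

(** The recursion is the differential equation z G' = P G up to degree n. In this form the
    exponential of a sum follows from the Leibniz rule. *)
Lemma isexp_poly P g n : isexp P g -> forall i, (i <= n)%N ->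
  ('X * (\poly_(i < n.+1) g i)^`())`_i =
  ((\poly_(i < n.+1) (if i == 0%N then 0 else P i)) * \poly_(i < n.+1) g i)`_i.
Proof.
move=> Eg [|i] ni; first by rewrite coefXM coefM big_ord1 !coef_poly /= mul0r.
rewrite coefXM /= coef_deriv coef_poly ltnS ni.
rewrite coefM big_ord_recl coef_poly /= mul0r add0r -scaler_nat.
case: Eg => _ ->; apply: eq_bigr => j _; rewrite !coef_poly /bump /= add1n subSS.
have -> : (j.+1 < n.+1)%N by case: j => /= *; lia.
by have -> : (i - j < n.+1)%N by case: j => /= *; lia.
Qed.

Lemma isexpM P P' g g' : isexp P g -> isexp P' g' ->
  isexp (fun i => P i + P' i) (conv g g').
Proof.
move=> Eg Eg'; split.
  by rewrite /conv big_ord1 subn0; case: Eg Eg' => -> _ [-> _]; rewrite mulr1.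
move=> n; pose G := \poly_(i < n.+2) g i; pose G' := \poly_(i < n.+2) g' i.
pose Q := \poly_(i < n.+2) (if i == 0%N then 0 else P i).
pose Q' := \poly_(i < n.+2) (if i == 0%N then 0 else P' i).
have GG m : (m <= n.+1)%N -> (G * G')`_m = conv g g' m.
  move=> mn; rewrite coefM; apply: eq_bigr => i _; rewrite !coef_poly.
  have -> : (i < n.+2)%N by case: i => /= *; lia.
  by have -> : (m - i < n.+2)%N by case: i => /= *; lia.
have <- : ('X * (G * G')^`())`_n.+1 = n.+1%:R *: conv g g' n.+1.
  by rewrite coefXM /= coef_deriv GG // scaler_nat.
have -> : 'X * (G * G')^`() = ('X * G^`()) * G' + ('X * G'^`()) * G.
  by rewrite derivM; ring.
rewrite coefD (coefM_eq _ (isexp_poly Eg)) (coefM_eq _ (isexp_poly Eg')) -coefD.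
have -> : Q * G * G' + Q' * G' * G = (Q + Q') * (G * G') by ring.
rewrite coefM big_ord_recl coefD !coef_poly /= addr0 mul0r add0r.
apply: eq_bigr => i _; rewrite coefD !coef_poly /bump /= add1n subSS GG ?leq_subr //.
  by have -> : (i.+1 < n.+2)%N by case: i => /= *; lia.
by case: i => /= *; lia.
Qed.

Lemma isexpZ c P g : isexp P g -> isexp (fun i => c ^+ i *: P i) (fun i => c ^+ i *: g i).
Proof.
move=> Eg; split; first by rewrite expr0 scale1r; case: Eg.
move=> n; rewrite scalerA mulrC -scalerA; case: Eg => _ ->.
rewrite scaler_sumr; apply: eq_bigr => i _.
rewrite -scalerAl -scalerAr scalerA -exprD.
by have -> : (i.+1 + (n - i) = n.+1)%N by case: i => /= *; lia.
Qed.

Lemma isexp0 P : (forall i, P i.+1 = 0) -> isexp P (fun n => (n == 0%N)%:R).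
Proof.
move=> P0; split=> // n; rewrite scaler0 big1 // => i _; by rewrite P0 mul0r.
Qed.

(** Course-of-values recursion: the list keeps all earlier values, since each of them occurs in the
    next one. *)
Fixpoint gexps P n : seq A :=
  if n is n'.+1 then
    rcons (gexps P n')
      (n%:R^-1 *: \sum_(i < n) P i.+1 * nth 0 (gexps P n') (n' - i))
  else [:: 1].

Definition gexp P n : A := nth 0 (gexps P n) n.

Lemma size_gexps P n : size (gexps P n) = n.+1.
Proof. by elim: n => //= n IH; rewrite size_rcons IH. Qed.

Lemma nth_gexps P n i : (i <= n)%N -> nth 0 (gexps P n) i = gexp P i.
Proof.
elim: n => [|n IH]; first by case: i.
rewrite leq_eqVlt => /orP[/eqP-> //|]; rewrite ltnS => ni.
by rewrite /= nth_rcons size_gexps ltnS ni IH.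
Qed.

Lemma gexpP P : isexp P (gexp P).
Proof.
split=> [|n]; first by [].
rewrite {1}/gexp /= nth_rcons size_gexps ltnn eqxx scalerA divff ?char0 // scale1r.
by apply: eq_bigr => i _; rewrite nth_gexps ?leq_subr.
Qed.

End ExpFamilies.

(** * Symmetric functions as exponentials of power sums *)

Section SeriesFamilies.
Variable F : fieldType.
Hypothesis char0 : forall n, n.+1%:R != 0 :> F.

Local Notation psum := (psum F).
Local Notation elem := (elem F).

Lemma isexp_trunc N (P g : nat -> series F) : isexp P g ->
  isexp (fun i => trunc N (P i)) (fun i => trunc N (g i)).
Proof.
move=> [g0 gS]; split; first by rewrite g0 trunc1.
move=> n; rewrite -truncZ gS trunc_sum; apply: eq_bigr => i _; exact: truncM.
Qed.

Lemma isexp_truncI (P g : nat -> series F) : g 0%N = 1 ->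
  (forall N, isexp (fun i => trunc N (P i)) (fun i => trunc N (g i))) -> isexp P g.
Proof.
move=> g0 H; split=> // n; apply: trunc_inj => N.
rewrite truncZ; case: (H N) => _ ->; rewrite trunc_sum; apply: eq_bigr => i _.
by rewrite truncM.
Qed.

Lemma eq_isexp (A : comAlgType F) (P P' g g' : nat -> A) :
  (forall i, P i.+1 = P' i.+1) -> g =1 g' -> isexp P g -> isexp P' g'.
Proof.
move=> PP gg [g0 H]; split=> [|n]; first by rewrite -gg.
by rewrite -gg H; apply: eq_bigr => i _; rewrite PP gg.
Qed.

(** exp (- sum of x^i z^i / i) = 1 - x z. *)
Lemma isexp_linear (A : comAlgType F) (x : A) :
  isexp (fun i => - x ^+ i) (fun j => if j is j'.+1 then (if j' is 0 then - x else 0) else 1).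
Proof.
split=> // -[|n]; first by rewrite big_ord1 scale1r mulr1.
rewrite scaler0 big_ord_recr big_ord_recr /= big1 => [|i _].
  by rewrite subnn subSn // subnn !exprS; ring.
rewrite subSn; last by case: i => /= *; lia.
have -> : (n - i = (n - i).-1.+1)%N by case: i => /= *; lia.
by rewrite mulr0.
Qed.

Lemma isexp_ecoef (xs : seq (series F)) :
  isexp (fun i => - \sum_(x <- xs) x ^+ i) (fun j => (-1) ^+ j *: ecoef xs j).
Proof.
elim: xs => [|x xs IH].
  split; first by rewrite /ecoef big_nil coefC scale1r.
  move=> n; rewrite /ecoef big_nil coefC /= scaler0 scaler0 big1 // => i _.
  by rewrite big_nil oppr0 mul0r.
have E := isexpM (isexp_linear x) IH.
apply: (eq_isexp _ _ E) => [i|j].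
  by rewrite big_cons opprD.
case: j => [|j]; first by rewrite /conv big_ord1 subn0 /= ecoef_cons0 mul1r.
rewrite /conv big_ord_recl big_ord_recl big1 /= => [|i _]; last by rewrite mul0r.
rewrite addr0 mul1r subn0 subSS subn0 ecoef_consS scalerDr; congr (_ + _).
by rewrite exprS mulN1r scaleNr scalerAr mulNr.
Qed.

Lemma isexp_elem : isexp (fun i => - psum i) (fun j => (-1) ^+ j *: elem j).
Proof.
apply: isexp_truncI => [|N]; first by rewrite elem0 scale1r.
have [H0 H] := isexp_ecoef (xvars F N).
split; first by rewrite truncZ trunc_elem.
move=> n; rewrite truncZ trunc_elem H; apply: eq_bigr => i _.
by rewrite truncN trunc_psum // truncZ trunc_elem.
Qed.


(** The complete homogeneous function h_n, introduced through power sums so that plethysm acts on it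
    directly. *)
Definition hser n : series F := gexp psum n.

Lemma elem_hser n :
  \sum_(i < n.+1) (-1) ^+ i *: elem i * hser (n - i) = (n == 0%N)%:R.
Proof.
have E := isexpM isexp_elem (gexpP char0 psum).
have Z : isexp (fun i => - psum i + psum i) (fun n => (n == 0%N)%:R).
  by apply: isexp0 => i; rewrite addNr.
rewrite -(isexp_uniq char0 E Z) //.
Qed.

Section Macdonald.
Variable q : F.
Hypothesis q1 : forall i, 1 - q ^+ i.+1 != 0.

Definition ltb_asc (x y : nat) : nat := (x < y)%N.

(* The modified Macdonald polynomial of a row *)
Definition Wser n : series F := wsum (wblock q ltb_asc n).

(** This is h_n[x / (1 - q)], as [wser_gexp] shows. *)
Definition wser n : series F := (qfact q n)^-1 *: Wser n.

(** With ascents in {0, 1}, a chain starting at 0 continues only at a strict ascent, and then with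
    the value 0 again. *)
Lemma ech_incr u : ech q ltb_asc 0 u = (sorted ltn u)%:R.
Proof.
case: u => //= x u; elim: u x => //= y u IH x.
rewrite expr0 mul1r add0n /ltb_asc; case: ltnP => _ /=.
  by rewrite big_ord1 IH.
by rewrite big_ord0.
Qed.

Lemma wser_rec n : \sum_(j < n.+1) (-1) ^+ j *: elem j * wser (n - j) = q ^+ n *: wser n.
Proof.
transitivity (wsum (fun u => (size u == n)%:R * (\sum_(j < (size u).+1)
   (-1) ^+ j * ech q ltb_asc 0 (take j u) * phi q ltb_asc (drop j u)))).
  transitivity (\sum_(j < n.+1) wsum (fun u => (-1) ^+ j * (qfact q (n - j)%N)^-1 *
       (incr_word F j (take j u) * wblock q ltb_asc (n - j)%N (drop j u)))).
    apply: eq_bigr => j _; rewrite wsumZ -wsumM; last by move=> u; apply: incr_word0.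
    rewrite -elemE /wser -scalerAl -scalerAr scalerA; reflexivity.
  rewrite -wsum_sum; apply: eq_wsum => u.
  have [su|su] := eqVneq (size u) n; last first.
    rewrite mul0r big1 // => j _; rewrite /wblock size_drop /incr_word size_take_min.
    case: eqP => /= [E1|]; last by rewrite mul0r mulr0.
    case: eqP => /= [E2|]; last by rewrite mul0r !mulr0.
    by case/eqP: su; case: j E1 E2 => /= j jn; lia.
  rewrite mul1r su; apply: eq_bigr => j _.
  have jn : (j <= n)%N by rewrite -ltnS.
  rewrite /incr_word /wblock size_take_min size_drop su (minn_idPl jn) !eqxx mul1r.
  by rewrite ech_incr /phi size_drop su; ring.
rewrite /wser /Wser scalerA -wsumZ; apply: eq_wsum => u.
rewrite (chain_sum q1) /wblock /phi; have [->|_] := eqVneq (size u) n.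
  by rewrite !mul1r; ring.
by rewrite !mul0r mulr0.
Qed.

Definition wexp_psum i : series F := (1 - q ^+ i)^-1 *: psum i.

Lemma Wser0 : Wser 0 = 1.
Proof.
rewrite sone_def -wsum_pred1; apply: eq_wsum => -[|x u]; rewrite /wblock ?mulr1 //.
exact: mul0r.
Qed.

(** Both families satisfy E(-z) G(z) = G(qz), which determines G from its constant term because no 1
    - q^n with n > 0 vanishes. *)
Lemma wser_gexp n : wser n = gexp wexp_psum n.
Proof.
elim/ltn_ind: n => n IH.
have E := isexpM isexp_elem (gexpP char0 wexp_psum).
have E' := isexpZ q (gexpP char0 wexp_psum).
have G := isexp_uniq char0 E E' _.
have {}G : conv (fun j => (-1) ^+ j *: elem j) (gexp wexp_psum) n = q ^+ n *: gexp wexp_psum n.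
  apply: G => i; rewrite /wexp_psum scalerA -[- psum _]scaleN1r -scalerDl.
  by congr (_ *: _); field; apply: q1.
have W := wser_rec n.
case: n => [|n] in IH G W *.
  by rewrite /wser /qfact big_ord0 invr1 scale1r Wser0.
move: W G; rewrite /conv big_ord_recl [\sum_(i < n.+2) _ * gexp _ _]big_ord_recl /= subn0 elem0 scale1r !mul1r.
set S := \sum_(i < _) _; set S' := \sum_(i < _) _.
have -> : S' = S.
  by apply: eq_bigr => i _; rewrite IH // /bump /=; lia.
move=> W G; have : (1 - q ^+ n.+1) *: wser n.+1 = (1 - q ^+ n.+1) *: gexp wexp_psum n.+1.
  rewrite !scalerBl !scale1r -W -G !opprD !addrA !subrr; reflexivity.
by move/(scalerI (q1 n)).
Qed.

End Macdonald.

End SeriesFamilies.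

(** * Linear independence of power sums *)

Lemma sumr_key_in (V : zmodType) (I K : eqType) (l : seq I) (key : I -> K)
    (G : I -> V) :
  \sum_(x <- l) G x = \sum_(k <- undup (map key l)) \sum_(x <- l | key x == k) G x.
Proof.
under [RHS]eq_bigr do rewrite big_mkcond.
rewrite exchange_big /= big_seq [RHS]big_seq; apply: eq_bigr => x xl.
rewrite (bigD1_seq (key x)) ?undup_uniq ?mem_undup ?map_f //= eqxx big1 ?addr0 // => k.
by rewrite eq_sym => /negbTE->.
Qed.

Section ContentWord.

Fixpoint content_from s (la : seq nat) : seq nat :=
  if la is a :: la' then nseq a s ++ content_from s.+1 la' else [::].

(* The monomial x^la *)
Definition content_word la := content_from 0 la.
Definition content_monom la : monom := seq_mset (content_word la).

Lemma count_content_from s la a :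
  count_mem a (content_from s la) = (if (s <= a)%N then nth 0%N la (a - s) else 0%N).
Proof.
elim: la s => [|b la IH] s /=; first by rewrite nth_nil if_same.
rewrite count_cat count_nseq IH /=; case: (ltngtP s a) => sa.
- by rewrite mul0n -[(a - s)%N]prednK ?subn_gt0 // subnS.
- by rewrite mul0n.
- by rewrite sa subnn mul1n addn0.
Qed.

Lemma count_content_word la a : count_mem a (content_word la) = nth 0%N la a.
Proof. by rewrite count_content_from subn0. Qed.

Lemma perm_undup_content la : 0%N \notin la ->
  perm_eq (undup (content_word la)) (iota 0 (size la)).
Proof.
move=> la0; apply: uniq_perm; rewrite ?undup_uniq ?iota_uniq // => a.
rewrite mem_undup mem_iota add0n -has_pred1 has_count count_content_word.
case: (ltnP a (size la)) => al; last by rewrite nth_default.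
by rewrite lt0n; apply: contra la0 => /eqP <-; apply: mem_nth.
Qed.

Lemma counts_content la : 0%N \notin la -> perm_eq
  [seq count_mem a (content_word la) | a <- undup (content_word la)] la.
Proof.
move=> la0; apply: perm_trans (perm_map _ (perm_undup_content la0)) _.
rewrite (eq_map (count_content_word la)) map_nth_iota0 // take_size //.
Qed.

End ContentWord.

Section ConstantBlocks.
Variable R : comNzRingType.

(** A concatenation of constant blocks has at most as many distinct letters as blocks. In case of
    equality each letter fills exactly one block, and the multiplicities are the block lengths. *)
Lemma blk_const la (u : seq nat) : 0%N \notin la -> blk (const_word R) la u != 0 ->
  (size (undup u) <= size la)%N /\
  (size (undup u) = size la -> perm_eq la [seq count_mem a u | a <- undup u]).
Proof.
elim: la u => [|r la IH] u /=; first by case: u; rewrite //= eqxx.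
rewrite inE negb_or => /andP[r0 la0] H.
have [c0 b0] : const_word R r (take r u) != 0 /\ blk (const_word R) la (drop r u) != 0.
  by split; apply: contraNneq H => ->; rewrite ?mul0r ?mulr0.
move: c0; rewrite /const_word; case: (boolP (_ && _)) => [/andP[/eqP sr cr] _|]; last by rewrite eqxx.
have [s1 s2] := IH _ la0 b0; set v := drop r u in b0 s1 s2 *.
have [x tE] : exists x, take r u = nseq r x.
  case: (take r u) sr cr => [|x w] /=; first by move=> E; rewrite -E in r0.
  by move=> <- /all_pred1P ->; exists x; rewrite size_nseq.
have uE : u = nseq r x ++ v by rewrite -tE cat_take_drop.
case: (boolP (x \in v)) => xv.
  have -> : undup u = undup v.
    rewrite uE; elim: (r) => //= k ->; rewrite mem_cat xv orbT //.
  by split; [exact: leqW | move=> E; move: s1; rewrite E ltnn].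
have -> : undup u = x :: undup v.
  rewrite uE; case: (r) r0 => // k _; elim: k => [|k IHk] /=; first by rewrite (negbTE xv).
  by move: IHk => /= ->; rewrite inE eqxx.
split; first by rewrite /= ltnS.
move=> /= [/s2 p2].
have -> : count_mem x u = r.
  by rewrite uE count_cat count_nseq /= eqxx mul1n (count_memPn xv) addn0.
rewrite perm_cons; apply: (perm_trans p2).
suff -> : [seq count_mem a u | a <- undup v] = [seq count_mem a v | a <- undup v] by [].
apply/eq_in_map => a; rewrite mem_undup => av.
rewrite uE count_cat count_nseq /=; case: eqP => [E|]; last by rewrite mul0n.
by rewrite E av in xv.
Qed.

Lemma part_perm_eq la ka : is_part la -> is_part ka -> perm_eq la ka -> la = ka.
Proof.
have tr : transitive geq by move=> a b c ba ac; apply: leq_trans ba.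
have an : antisymmetric geq by move=> a b; rewrite andbC => /anti_leq.
by move=> /andP[sl _] /andP[sk _]; apply: (sorted_eq tr an).
Qed.

Lemma const_content la ka u : is_part la -> is_part ka ->
  perm_eq u (content_word ka) -> blk (const_word R) la u != 0 ->
  la = ka \/ (size ka < size la)%N.
Proof.
move=> pl pk pu H; have /andP[_ la0] := pl; have /andP[_ ka0] := pk.
have [s1 s2] := blk_const la0 H.
have pun : perm_eq (undup u) (undup (content_word ka)).
  by apply: uniq_perm; rewrite ?undup_uniq // => a; rewrite !mem_undup (perm_mem pu).
have su : size (undup u) = size ka.
  by rewrite (perm_size pun) (perm_size (perm_undup_content ka0)) size_iota.
rewrite su in s1 s2; move: s1; rewrite leq_eqVlt => /orP[/eqP E|]; last by right.
left; apply: part_perm_eq => //; apply: (perm_trans (s2 E)).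
apply: perm_trans (counts_content ka0).
apply: perm_trans (perm_map _ pun) _.
suff -> : [seq count_mem a u | a <- undup (content_word ka)] =
  [seq count_mem a (content_word ka) | a <- undup (content_word ka)] by [].
by apply: eq_map => a; apply/permP.
Qed.

Lemma blk_const_content la : 0%N \notin la -> blk (const_word R) la (content_word la) = 1.
Proof.
suff H s : 0%N \notin la -> blk (const_word R) la (content_from s la) = 1 by apply: H.
elim: la s => [|r la IH] s //=.
rewrite inE negb_or => /andP[r0 la0].
rewrite take_size_cat ?size_nseq // drop_size_cat ?size_nseq // IH //.
rewrite /const_word size_nseq eqxx; case: r {r0} => [|r] /=; first by rewrite mulr1.
by rewrite all_pred1_nseq mulr1.
Qed.

Lemma blk_const_bool la u : blk (const_word R) la u = (blk (const_word R) la u != 0)%:R.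
Proof.
elim: la u => [|r la IH] u /=; first by case: nilp; rewrite ?oner_eq0 ?eqxx.
by rewrite /const_word; case: (_ && _); rewrite ?mul0r ?eqxx // !mul1r -IH.
Qed.

End ConstantBlocks.

Section Independence.
Variable F : fieldType.

(** Induction from the largest value of [mu] downwards: the coefficient at [x ka] involves only ka
    and indices of larger measure, whose coefficients are already known to vanish. *)
Lemma triangular_indep (B : seq nat -> series F) (L : seq (seq nat))
    (mu : seq nat -> nat) (x : seq nat -> monom) :
  uniq L -> (forall la, la \in L -> B la (x la) != 0) ->
  (forall la ka, la \in L -> ka \in L -> B la (x ka) != 0 ->
     la = ka \/ (mu ka < mu la)%N) ->
  forall c : seq nat -> F, \sum_(la <- L) c la *: B la = 0 ->
  forall la, la \in L -> c la = 0.
Proof.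
move=> uL Bd Bt c S0.
pose M := (\max_(la <- L) mu la)%N.
have muM la : la \in L -> (mu la <= M)%N.
  by move=> laL; apply: (leq_bigmax_seq (F := mu)).
suff H d la : la \in L -> (M - mu la < d)%N -> c la = 0 by move=> la /H; apply; exact: ltnSn.
elim: d la => // d IH ka kaL; rewrite ltnS => kd.
have := congr1 (fun f : series F => f (x ka)) S0.
rewrite ssumE szeroE (bigD1_seq ka) //= sscaleE big1_seq ?addr0.
  by move/eqP; rewrite mulf_eq0 (negbTE (Bd _ kaL)) orbF => /eqP.
move=> la /andP[lk laL]; rewrite sscaleE.
case: (eqVneq (B la (x ka)) 0) => [->|/(Bt _ _ laL kaL)]; first by rewrite mulr0.
case=> [E|mm]; first by rewrite E eqxx in lk.
rewrite IH ?mul0r //; have := muM _ laL; lia.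
Qed.

Hypothesis char0 : forall n, n.+1%:R != 0 :> F.

Lemma natr_neq0 n : (0 < n)%N -> n%:R != 0 :> F.
Proof. by case: n. Qed.

(** The coefficient is a number of words, among them the content word itself, so it is nonzero in
    characteristic 0. *)
Lemma psums_content_neq0 la : is_part la -> psums F la (content_monom la) != 0.
Proof.
move=> /andP[_ la0]; rewrite psumsE // /wsum.
under eq_bigr do rewrite blk_const_bool.
rewrite -natr_sum natr_neq0 //.
have cw : content_word la \in words (content_monom la) by rewrite mem_words.
by rewrite (bigD1_seq _ cw) ?words_uniq //= blk_const_content // oner_eq0.
Qed.

Lemma psums_indep (L : seq (seq nat)) (c : seq nat -> F) : uniq L -> all is_part L ->
  \sum_(la <- L) c la *: psums F la = 0 -> forall la, la \in L -> c la = 0.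
Proof.
move=> uL /allP pL; apply: (triangular_indep (mu := size) (x := content_monom)) => //.
  by move=> la /pL; apply: psums_content_neq0.
move=> la ka /pL pl /pL pk; rewrite psumsE; last by case/andP: pl.
rewrite /wsum => H.
have [u /= uw] : exists2 u, u \in words (content_monom ka) & blk (const_word F) la u != 0.
  apply/hasP; apply: contraNT H => /hasPn H; rewrite big1_seq // => u /= /H.
  by rewrite negbK => /eqP.
move: uw; rewrite mem_words => /eqP /eq_seq_msetP; rewrite perm_sym.
exact: const_content.
Qed.

End Independence.

(** * Plethysm *)

Section Plethysm.
Variable F : fieldType.
Hypothesis char0 : forall n, n.+1%:R != 0 :> F.
Implicit Types (u v : nat -> F) (f g : series F).

(* g is the image of f by the algebra map p_i |-> u_i p_i. *)
Definition pleth u f g := exists l : seq (F * seq nat),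
  [/\ forall x, x \in l -> 0%N \notin x.2, f = \sum_(x <- l) x.1 *: psums F x.2 &
      g = \sum_(x <- l) (x.1 * \prod_(i <- x.2) u i) *: psums F x.2].

Lemma psums_prod la : psums F la = \prod_(i <- la) psum F i.
Proof. by rewrite /psums sprodE big_map. Qed.

Lemma perm_psums la ka : perm_eq la ka -> psums F la = psums F ka.
Proof. by move=> p; rewrite !psums_prod; apply: perm_big. Qed.

Lemma plethysm_pleth a f g :
  plethysm_1sub a f g -> pleth (fun i => 1 - a ^+ i) f g.
Proof.
move=> [l [c [/allP pl -> ->]]]; exists [seq (c la, la) | la <- l]; split.
- by move=> _ /mapP[la lal ->]; have /andP[] := pl _ lal.
- by rewrite lincombE big_map.
- by rewrite lincombE big_map.
Qed.

Lemma sort_geq_part la : 0%N \notin la -> is_part (sort geq la).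
Proof.
by move=> la0; rewrite /is_part mem_sort la0 andbT sort_sorted // => a b; apply: leq_total.
Qed.

(** What makes [pleth] single-valued. Grouped by sorted index, a relation between products of power
    sums has only zero coefficients, and the factors u_i are constant on each group. *)
Lemma psums_sum0 u (l : seq (F * seq nat)) :
  (forall x, x \in l -> 0%N \notin x.2) ->
  \sum_(x <- l) x.1 *: psums F x.2 = 0 ->
  \sum_(x <- l) (x.1 * \prod_(i <- x.2) u i) *: psums F x.2 = 0.
Proof.
move=> l0; pose key (x : F * seq nat) := sort geq x.2.
rewrite !(sumr_key_in l key).
set L := undup _; pose c la := \sum_(x <- l | key x == la) x.1.
have uL : uniq L by apply: undup_uniq.
have pL : all is_part L.
  by apply/allP => la; rewrite mem_undup => /mapP[x /l0 xl ->]; apply: sort_geq_part.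
have pk x la : key x == la -> perm_eq x.2 la.
  by move=> /eqP <-; rewrite perm_sym perm_sort.
have -> : \sum_(k <- L) \sum_(x <- l | key x == k) x.1 *: psums F x.2 =
    \sum_(k <- L) c k *: psums F k.
  apply: eq_bigr => k _; rewrite scaler_suml; apply: eq_bigr => x /pk xk.
  by rewrite (perm_psums xk).
move=> /(psums_indep char0 uL pL) c0; rewrite big_seq big1 // => k kL.
transitivity ((c k * \prod_(i <- k) u i) *: psums F k); last by rewrite c0 // mul0r scale0r.
rewrite mulr_suml scaler_suml; apply: eq_bigr => x /pk xk.
by rewrite (perm_psums xk) (perm_big _ xk).
Qed.

Lemma pleth_sum0 u f g : pleth u f g -> f = 0 -> g = 0.
Proof. by move=> [l [l0 -> ->]]; apply: psums_sum0. Qed.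

Lemma plethD u f f' g g' : pleth u f g -> pleth u f' g' -> pleth u (f + f') (g + g').
Proof.
move=> [l [l0 -> ->]] [l' [l0' -> ->]]; exists (l ++ l'); split; rewrite ?big_cat //.
by move=> x; rewrite mem_cat => /orP[/l0|/l0'].
Qed.

Lemma plethZ u c f g : pleth u f g -> pleth u (c *: f) (c *: g).
Proof.
move=> [l [l0 -> ->]]; exists [seq (c * x.1, x.2) | x <- l]; split.
- by move=> _ /mapP[x /l0 xl ->].
- by rewrite big_map scaler_sumr; apply: eq_bigr => x _; rewrite scalerA.
- by rewrite big_map scaler_sumr; apply: eq_bigr => x _; rewrite scalerA mulrA.
Qed.

Lemma pleth0 u : pleth u 0 0.
Proof. by exists [::]; rewrite !big_nil. Qed.

Lemma pleth1 u : pleth u 1 1.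
Proof.
exists [:: (1, [::])]; rewrite !big_cons !big_nil psums_prod big_nil /= mul1r.
by rewrite scale1r addr0; split=> // x; rewrite inE => /eqP->.
Qed.

Lemma pleth_psum u i : (0 < i)%N -> pleth u (psum F i) (u i *: psum F i).
Proof.
move=> i0; exists [:: (1, [:: i])]; rewrite !big_cons !big_nil psums_prod /=.
rewrite !big_cons !big_nil mul1r !mulr1 scale1r !addr0; split=> // x.
by rewrite inE => /eqP-> /=; rewrite inE eq_sym -lt0n.
Qed.

Lemma pleth_sum u (I : eqType) (r : seq I) (G G' : I -> series F) :
  (forall i, i \in r -> pleth u (G i) (G' i)) ->
  pleth u (\sum_(i <- r) G i) (\sum_(i <- r) G' i).
Proof.
move=> H; rewrite big_seq [X in pleth _ _ X]big_seq.
by apply: big_rec2 => [|i f g /H p p']; [apply: pleth0 | apply: plethD].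
Qed.

Lemma plethM u f f' g g' : pleth u f g -> pleth u f' g' -> pleth u (f * f') (g * g').
Proof.
move=> [l [l0 -> ->]] [l' [l0' -> ->]]; rewrite !mulr_suml.
apply: pleth_sum => x /l0 xl; rewrite !mulr_sumr; apply: pleth_sum => y /l0' yl.
exists [:: (x.1 * y.1, x.2 ++ y.2)]; rewrite !big_cons !big_nil /= !addr0; split.
- by move=> z; rewrite inE => /eqP-> /=; rewrite mem_cat negb_or xl.
- by rewrite -scalerAl -scalerAr scalerA !psums_prod big_cat.
- by rewrite -scalerAl -scalerAr scalerA !psums_prod !big_cat /=; congr (_ *: _); rewrite mulrACA.
Qed.

Lemma pleth_prod u (r : seq nat) (G G' : nat -> series F) :
  (forall i, pleth u (G i) (G' i)) ->
  pleth u (\prod_(i <- r) G i) (\prod_(i <- r) G' i).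
Proof.
move=> H; apply: big_rec2 => [|i f g _ p]; first exact: pleth1.
exact: plethM.
Qed.

Lemma pleth_uniq u f g g' : pleth u f g -> pleth u f g' -> g = g'.
Proof.
move=> p p'; apply/eqP; rewrite -subr_eq0; apply/eqP.
apply: (pleth_sum0 (u := u) (f := f - f)); last by rewrite subrr.
by have := plethD p (plethZ (-1) p'); rewrite !scaleN1r; apply.
Qed.

Lemma pleth_inv u f g : (forall i, (0 < i)%N -> u i != 0) -> pleth u f g ->
  pleth (fun i => (u i)^-1) g f.
Proof.
move=> u0 [l [l0 -> ->]]; exists [seq (x.1 * \prod_(i <- x.2) u i, x.2) | x <- l].
split; rewrite ?big_map //; first by move=> _ /mapP[x /l0 xl ->].
rewrite big_seq [RHS]big_seq; apply: eq_bigr => x /l0 xl /=.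
rewrite -mulrA -big_split /= big_seq big1 ?mulr1 // => i il.
by rewrite divff // u0 // lt0n; apply: contra xl => /eqP <-.
Qed.

Lemma pleth_inj u f f' g : (forall i, (0 < i)%N -> u i != 0) ->
  pleth u f g -> pleth u f' g -> f = f'.
Proof. by move=> u0 /(pleth_inv u0) p /(pleth_inv u0); apply: pleth_uniq p. Qed.

Lemma pleth_gexp u (P P' g g' : nat -> series F) : isexp P g -> isexp P' g' ->
  (forall i, pleth u (P i.+1) (P' i.+1)) -> forall n, pleth u (g n) (g' n).
Proof.
move=> E E' PP n; elim/ltn_ind: n => -[|n] IH.
  by case: E E' => -> _ [-> _]; apply: pleth1.
rewrite (isexp_rec char0 n E) (isexp_rec char0 n E'); apply: plethZ.
apply: (@pleth_sum u _ (index_enum 'I_n.+1)) => i _.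
by apply: plethM => //; apply: IH; rewrite ltnS leq_subr.
Qed.

(** The coefficients of exp (sum of v_i p_i z^i / i). This covers h for v = 1, e for v_i =
    (-1)^(i-1) and h[x / (1 - q)] for v_i = 1 / (1 - q^i); plethysm multiplies v pointwise. *)
Definition pexp v n : series F := gexp (fun i => v i *: psum F i) n.

Lemma pleth_pexp u v w : (forall i, v i.+1 = u i.+1 * w i.+1) ->
  forall n, pleth u (pexp w n) (pexp v n).
Proof.
move=> vuw; apply: pleth_gexp; try exact: gexpP.
move=> i /=; rewrite vuw mulrC -scalerA; exact/plethZ/pleth_psum.
Qed.

Lemma hser_pexp n : hser F n = pexp (fun=> 1) n.
Proof.
apply: (isexp_uniq char0 (gexpP char0 _) (gexpP char0 _)) => i.
by rewrite scale1r.
Qed.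

Lemma elem_pexp n : elem F n = pexp (fun i => (-1) ^+ i.-1) n.
Proof.
have E := isexpZ (-1) (isexp_elem F).
have -> : elem F n = (-1) ^+ n *: ((-1) ^+ n *: elem F n).
  by rewrite scalerA -expr2 sqrr_sign scale1r.
apply: (isexp_uniq char0 E (gexpP char0 _)) => i /=.
by rewrite exprS mulN1r scaleNr scalerN opprK.
Qed.

Lemma wser_pexp q n : (forall i, 1 - q ^+ i.+1 != 0) ->
  wser q n = pexp (fun i => (1 - q ^+ i)^-1) n.
Proof. by move=> q1; rewrite wser_gexp. Qed.

(* The coefficients of [pexp v] in a single variable *)
Definition pexp1 v n : F := gexp (A := F^o) v n.

Lemma isexp_pexp1 v (x : series F) :
  isexp (fun i => v i *: x ^+ i) (fun i => pexp1 v i *: x ^+ i).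
Proof.
have [E0 E] := gexpP char0 (A := F^o) v.
split=> [|n]; first by rewrite /pexp1 E0 scale1r.
rewrite scalerA -[_ * _]/(n.+1%:R *: (pexp1 v n.+1 : F^o)) E scaler_suml.
apply: eq_bigr => i _; rewrite -scalerAl -scalerAr scalerA -exprD.
by have -> : (i.+1 + (n - i) = n.+1)%N by case: i => /= *; lia.
Qed.

(** Each p_i is a sum over the variables, so the exponential is the product of its one-variable
    versions. The induction splits off the variable of index N. *)
Lemma pexp_coef v n N m : letters_lt N m ->
  pexp v n m = (size (enum_mset m) == n)%:R * \prod_(a < N) pexp1 v (m a).
Proof.
move=> mN; rewrite -(truncE (pexp v n) mN).
have -> : trunc N (pexp v n) =
    gexp (fun i => \sum_(x <- xvars F N) v i *: x ^+ i) n.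
  apply: (isexp_uniq char0 (isexp_trunc N (gexpP char0 _)) (gexpP char0 _)) => i.
  by rewrite truncZ trunc_psum // scaler_sumr.
elim: N n m mN => [|N IH] n m mN.
  rewrite big_ord0 mulr1.
  have -> : m = seq_mset [::].
    by move: mN; rewrite /letters_lt -[X in X = _]seq_mset_id; case: (enum_mset m).
  have sz : size (enum_mset (seq_mset [::] : monom)) = 0%N.
    by rewrite seq_mset_nil enum_mset0.
  set P := fun i => _; have EP := gexpP char0 P; rewrite sz eq_sym.
  case: n => [|n].
    by case: EP => -> _; rewrite sone_def xmonE !eqxx.
  have P0 i : P i.+1 = 0 by exact: big_nil.
  rewrite (isexp_rec char0 n EP) big1 ?scaler0 // => i _.
  by rewrite P0 mul0r.
have -> : gexp (fun i => \sum_(x <- xvars F N.+1) v i *: x ^+ i) n =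
    conv (fun i => pexp1 v i *: xvar F N ^+ i)
         (gexp (fun i => \sum_(x <- xvars F N) v i *: x ^+ i)) n.
  apply: (isexp_uniq char0 (gexpP char0 _) (isexpM (isexp_pexp1 v _) (gexpP char0 _))) => i.
  by rewrite big_cons.
rewrite /conv ssumE [X in _ = _ * X]big_ord_recr /=.
set g := gexp _ in IH *.
have gE k : g k = trunc N (pexp v k).
  apply: (isexp_uniq char0 (gexpP char0 _) (isexp_trunc N (gexpP char0 _))) => i.
  by rewrite truncZ trunc_psum // scaler_sumr.
have g0 k m' : ~~ letters_lt N m' -> g k m' = 0.
  by move=> /negbTE H; rewrite gE /trunc H.
have term (i : nat) : (pexp1 v i *: xvar F N ^+ i * g (n - i)%N) m =
    if i == m N then pexp1 v i * g (n - i)%N (msetB m (msetn i N)) else 0.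
  rewrite -scalerAl sscaleE xvarXM; case: (ltngtP i (m N)) => [im|_|_] //; last first.
    by rewrite mulr0.
  rewrite g0 ?mulr0 //; apply/negP => /letters_ltP/(_ N); rewrite ltnn => H.
  by have: false by apply: H; rewrite -mset_gt0 msetE2 msetnxx subn_gt0.
under eq_bigr do rewrite term.
rewrite -big_mkcond /=.
have sm : size (enum_mset m) = (m N + size (enum_mset (msetB m (msetn (m N) N))))%N.
  have {1}-> : m = msetD (msetn (m N) N) (msetB m (msetn (m N) N)).
    by rewrite msetBDKC //; apply/msubsetP => b; rewrite msetnE; case: eqP => [->|].
  set m' := msetB _ _.
  have := perm_size (perm_eq_seq_mset (nseq (m N) N ++ enum_mset m')).
  by rewrite seq_mset_cat seq_mset_nseq seq_mset_id size_cat size_nseq.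
set m' := msetB m (msetn (m N) N) in sm.
have m'N : letters_lt N m'.
  apply/letters_ltP => a; rewrite -mset_gt0 msetE2 msetnE.
  case: eqP => [->|/eqP aN]; first by rewrite subnn.
  rewrite subn0 mset_gt0 => am; have := letters_ltP _ _ mN a am.
  by rewrite ltnS leq_eqVlt (negbTE aN).
case: (leqP (m N) n) => [mn|nm]; last first.
  rewrite big1 => [|i /eqP E]; last by have := ltn_ord i; rewrite E ltnS leqNgt nm.
  by rewrite sm [X in X%:R](_ : _ = 0%N) ?mul0r //; apply/eqP; rewrite eqb0 gtn_eqF // (leq_trans nm) ?leq_addr.
rewrite (big_pred1 (Ordinal (mn : (m N < n.+1)%N))) //= -/m' IH // mulrCA.
congr (_ * _).
  by congr (_%:R); congr nat_of_bool; rewrite sm -[X in _ = (_ == X)](subnKC mn) eqn_add2l.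
rewrite mulrC; congr (_ * _); apply: eq_bigr => a _.
by rewrite /m' msetE2 msetnE ltn_eqF ?subn0.
Qed.

End Plethysm.

(** * Pieri rules for Schur polynomials *)

Section Shapes.
Variable D : nat.

Definition diagram := {ffun 'I_D.+1 -> 'I_D.+1}.

Definition rowlen (f : diagram) (i : nat) : nat :=
  if (insub i : option 'I_D.+1) is Some j then val (f j) else 0%N.

Lemma rowlenE (f : diagram) (i : 'I_D.+1) : rowlen f i = f i.
Proof. by rewrite /rowlen valK. Qed.

Lemma rowlen_out (f : diagram) i : (D < i)%N -> rowlen f i = 0%N.
Proof. by move=> Di; rewrite /rowlen insubF // ltnS leqNgt Di. Qed.

Implicit Types (la ta : nat -> nat).

Definition supp la := forall i, (D < i)%N -> la i = 0%N.
Definition dec la := forall i, (la i.+1 <= la i)%N.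
Definition decb la := [forall i : 'I_D.+1, (la i.+1 <= la i)%N].
Definition sz la : nat := (\sum_(i < D.+1) la i)%N.

Lemma decbP la : supp la -> reflect (dec la) (decb la).
Proof.
move=> sl; apply: (iffP forallP) => [H i|H i]; last exact: H.
case: (ltnP i D.+1) => iD; first exact: (H (Ordinal iD)).
by rewrite sl // ltnW.
Qed.

Lemma dec_le la i j : dec la -> (i <= j)%N -> (la j <= la i)%N.
Proof.
move=> dl /subnKC <-; elim: (j - i)%N => [|k IH]; rewrite ?addn0 // addnS.
exact: leq_trans (dl _) IH.
Qed.

(* la / nu is a horizontal strip, resp. a vertical strip *)
Definition hst la ta := [forall i : 'I_D.+1, (la i.+1 <= ta i <= la i)%N].
Definition vst la ta := [&& decb la, decb ta & [forall i : 'I_D.+1, (ta i <= la i <= (ta i).+1)%N]].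

Section Commutation.
Variables (A : comNzRingType) (x y : A).

Lemma sum_two n (P : pred nat) (G : nat -> A) a : (a.+1 < n)%N ->
  (forall b, P b -> b = a \/ b = a.+1) ->
  \sum_(b < n | P b) G b = (P a)%:R * G a + (P a.+1)%:R * G a.+1.
Proof.
move=> an Pa; rewrite big_mkcond /= (bigD1 (Ordinal (ltnW an))) //= (bigD1 (Ordinal an)) //=; last first.
  by rewrite -val_eqE /= gtn_eqF.
rewrite big1 ?addr0 => [|b /andP[b1 b2]].
  by case: (P a); case: (P a.+1); rewrite ?mul1r ?mul0r.
case: ifP => // /Pa; rewrite -!val_eqE /= in b1 b2.
by case=> E; rewrite E eqxx in b1 b2.
Qed.

(** One row of [strip_commute]: L and T are the lengths of this row in la and ta, L' is the length
    of the next row in la, and [p] is the bound set by the previous row of ta. Adding both strips or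
    removing both gives sums that differ by the two boundary factors. *)
Lemma row_identity n L L' T (p : pred nat) : (L' <= L)%N -> (L.+1 < n)%N -> p T ->
  (forall a b, (a <= b)%N -> p b -> p a) ->
  (\sum_(a < n | [&& (L <= a <= L.+1)%N, (T <= a)%N & p a]) y ^+ (a - L) * x ^+ (a - T)) *
     ((L' <= T)%:R + x * y * (L' < T)%:R) =
  (\sum_(b < n | (L' <= b <= L)%N && (b <= T <= b.+1)%N) x ^+ (L - b) * y ^+ (T - b)) *
     ((p L)%:R + x * y * (p L.+1)%:R).
Proof.
move=> LL Ln pT pS.
pose PA a := [&& (L <= a <= L.+1)%N, (T <= a)%N & p a].
pose PB b := (L' <= b <= L)%N && (b <= T <= b.+1)%N.
have [PA0|TL] := ltnP L.+1 T.
  rewrite !big1 ?mul0r // => b; first by case/andP=> /andP[_ H1] /andP[_ H2]; lia.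
  by case/andP=> /andP[_ H1] /andP[H2 _]; lia.
rewrite (@sum_two n PA (fun a => y ^+ (a - L) * x ^+ (a - T)) L Ln); last first.
  by move=> b /andP[/andP[? ?] _]; lia.
have PAL : PA L = (T <= L)%N && p L by rewrite /PA leqnn leqnSn.
have PAS : PA L.+1 = p L.+1 by rewrite /PA leqnn leqnSn TL.
rewrite PAL PAS subnn subSnn expr0 expr1 mul1r.
move: TL; rewrite leq_eqVlt => /orP[/eqP TE|TL].
  rewrite (@sum_two n PB (fun b => x ^+ (L - b) * y ^+ (T - b)) L Ln); last first.
    by move=> b /andP[/andP[_ ?] /andP[? ?]]; lia.
  have -> : PB L by rewrite /PB; lia.
  have -> : PB L.+1 = false by rewrite /PB; lia.
  have pL1 : p L.+1 by rewrite -TE.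
  rewrite pL1 (pS _ _ (leqnSn L) pL1) TE ltnn /= ltnS LL (leqW LL) !subnn subSnn.
  by rewrite expr0 expr1 /=; ring.
rewrite ltnS in TL; rewrite TL /=.
have -> : \sum_(b < n | PB b) x ^+ (L - b) * y ^+ (T - b) =
   x ^+ (L - T) * ((L' <= T)%:R + x * y * (L' < T)%:R).
  case E : T => [|t].
    rewrite (@sum_two n PB (fun b => x ^+ (L - b) * y ^+ (0 - b)) 0); last 2 first.
    - exact: leq_ltn_trans Ln.
    - by move=> b /andP[_ /andP[]]; rewrite E; lia.
    have -> : PB 0%N = (L' <= 0)%N by rewrite /PB; lia.
    have -> : PB 1%N = false by rewrite /PB; lia.
    by rewrite ltn0 /= subn0 subnn expr0; ring.
  rewrite (@sum_two n PB (fun b => x ^+ (L - b) * y ^+ (t.+1 - b)) t); last 2 first.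
  - by rewrite -E; apply: leq_ltn_trans TL _; apply: ltnW.
  - by move=> b /andP[_ /andP[]]; rewrite E; lia.
  have -> : PB t = (L' <= t)%N by rewrite /PB; lia.
  have -> : PB t.+1 = (L' <= t.+1)%N by rewrite /PB; lia.
  rewrite ltnS subSnn subnn expr0 expr1.
  have -> : (L - t = (L - t.+1).+1)%N by move: TL; rewrite E; lia.
  by rewrite exprS; ring.
rewrite (subSn TL) exprS; ring.
Qed.


Definition wt (z : A) la ta := \prod_(i < D.+1) z ^+ (la i - ta i).

Variables la ta : nat -> nat.
Hypotheses (sla : supp la) (sta : supp ta) (dla : dec la) (dta : dec ta).
Hypotheses (la0 : (la 0 < D)%N) (taD : ta D = 0%N).

Let condA i a := [&& (la i <= a <= (la i).+1)%N, (ta i <= a)%N &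
  if i is i'.+1 then (a <= ta i')%N else true].
Let condB i b := [&& (la i.+1 <= b <= la i)%N & (b <= ta i <= b.+1)%N].
Let prev i a := if i is i'.+1 then (a <= ta i')%N else true.
Let c i : A := (prev i (la i))%:R + x * y * (prev i (la i).+1)%:R.

Lemma sum_shape (cond : nat -> pred nat) (G : nat -> nat -> A) :
  \sum_(f : diagram | [forall i : 'I_D.+1, cond i (rowlen f i)]) \prod_(i < D.+1) G i (rowlen f i) =
  \prod_(i < D.+1) \sum_(a < D.+1 | cond i a) G i a.
Proof.
rewrite bigA_distr_big_dep /=; apply: eq_big => [f|f _].
  by apply/forallP/familyP => H i; have := H i; rewrite rowlenE.
by apply: eq_bigr => i _; rewrite rowlenE.
Qed.

Lemma hst_vst_up (f : diagram) :
  vst (rowlen f) la && hst (rowlen f) ta = [forall i : 'I_D.+1, condA i (rowlen f i)].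
Proof.
apply/andP/forallP => [[/and3P[_ _ /forallP V] /forallP H] i|H].
  rewrite /condA V; have /andP[_ ->] := H i; case: i => -[|i] //= iD.
  by have /andP[] := H (Ordinal (ltnW iD : (i < D.+1)%N)).
have h : hst (rowlen f) ta.
  apply/forallP => i; have /and3P[_ -> _] := H i; rewrite andbT.
  case: (ltnP i.+1 D.+1) => iD; last by rewrite rowlen_out.
  by have /and3P[_ _] := H (Ordinal iD).
split=> //; apply/and3P; split; last by apply/forallP => i; have /and3P[] := H i.
  by apply/forallP => i; have /forallP/(_ i)/andP[a b] := h; apply: leq_trans a b.
exact/decbP.
Qed.

Lemma hst_dec la' (f : diagram) : hst la' (rowlen f) -> decb (rowlen f).
Proof.
move=> /forallP H; apply/forallP => i.
case: (ltnP i.+1 D.+1) => iD; last by rewrite rowlen_out.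
have /andP[_ a] := H (Ordinal iD); have /andP[b _] := H i; exact: leq_trans a b.
Qed.

Lemma hst_vst_down (f : diagram) :
  hst la (rowlen f) && vst ta (rowlen f) = [forall i : 'I_D.+1, condB i (rowlen f i)].
Proof.
rewrite /vst; have -> /= : decb ta by apply/(decbP sta).
apply/and3P/forallP => [[/forallP V _ /forallP H] i|H]; first by rewrite /condB V H.
have h : hst la (rowlen f) by apply/forallP => i; have /andP[] := H i.
by split=> //; [apply: hst_dec h | apply/forallP => i; have /andP[] := H i].
Qed.

Let GA i a : A := y ^+ (a - la i) * x ^+ (a - ta i).
Let GB i b : A := x ^+ (la i - b) * y ^+ (ta i - b).

Lemma row_factor (i : 'I_D.+1) :
  (\sum_(a < D.+1 | condA i a) GA i a) * c i.+1 =
  (\sum_(b < D.+1 | condB i b) GB i b) * c i.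
Proof.
apply: row_identity => //.
- by rewrite ltnS; apply: leq_ltn_trans la0; apply: dec_le.
- by rewrite /prev; case: (nat_of_ord i) => //= j; apply: dta.
- by rewrite /prev; case: (nat_of_ord i) => //= j a b; apply: leq_trans.
Qed.

(** The skew dual Cauchy identity for one variable of each kind. For fixed la and ta the rows of the
    middle shape vary independently, so both sums are products over rows. In the ratios given by
    [row_factor] the factors [c] telescope: [c 0] is 1 + x y, and the last one is 1 because row D of
    ta is empty. The bound on [la 0] leaves room for one more cell. *)
Lemma strip_commute :
  \sum_(f : diagram | vst (rowlen f) la && hst (rowlen f) ta) wt y (rowlen f) la * wt x (rowlen f) ta =
  (1 + x * y) *
  \sum_(f : diagram | hst la (rowlen f) && vst ta (rowlen f)) wt x la (rowlen f) * wt y ta (rowlen f).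
Proof.
under eq_bigl do rewrite hst_vst_up.
under [X in _ = _ * X]eq_bigl do rewrite hst_vst_down.
under eq_bigr do rewrite -big_split /=.
under [X in _ = _ * X]eq_bigr do rewrite -big_split /=.
rewrite (sum_shape condA GA) (sum_shape condB GB).
have H n : (n <= D.+1)%N -> (\prod_(i < n) \sum_(a < D.+1 | condA i a) GA i a) * c n =
    c 0%N * \prod_(i < n) \sum_(b < D.+1 | condB i b) GB i b.
  elim: n => [|n IH] nD; first by rewrite !big_ord0 mulr1 mul1r.
  rewrite !big_ord_recr /= -mulrA (row_factor (Ordinal nD)).
  rewrite mulrCA IH ?(ltnW nD) // mulrCA; congr (_ * _); exact: mulrC.
have := H _ (leqnn D.+1).
by rewrite /c /= taD sla // ltnn mulr0 !addr0 !mulr1.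
Qed.

End Commutation.

Lemma supp_rowlen (f : diagram) : supp (rowlen f).
Proof. by move=> i; apply: rowlen_out. Qed.

Lemma sz_le la ta : (forall i : 'I_D.+1, (ta i <= la i)%N) -> (sz ta <= sz la)%N.
Proof. by move=> H; apply: leq_sum. Qed.

Lemma row_le_sz la i : supp la -> (la i <= sz la)%N.
Proof.
move=> sl; case: (ltnP D i) => Di; first by rewrite sl.
by rewrite /sz (bigD1 (Ordinal (Di : (i < D.+1)%N))) //= leq_addr.
Qed.

Lemma sz_small la : supp la -> dec la -> (sz la < D)%N -> la D = 0%N.
Proof.
move=> sl dl; apply: contraTeq; rewrite -lt0n -leqNgt => l0.
rewrite -[D in (D <= _)%N]muln1 -{1}[D]card_ord -sum_nat_const.
rewrite /sz big_ord_recr /= addnC; apply: leq_trans (leq_addl _ _).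
by apply: leq_sum => i _; apply: leq_trans l0 _; apply: dec_le => //; apply: ltnW.
Qed.

Lemma wtE (A : comNzRingType) (z : A) la ta : (forall i : 'I_D.+1, (ta i <= la i)%N) ->
  wt z la ta = z ^+ (sz la - sz ta).
Proof.
move=> H; rewrite /wt -(big_morph _ (exprD z) (expr0 z)) /sz; congr (_ ^+ _).
rewrite sumnB //.
Qed.

Definition strip (b : bool) la ta := if b then hst la ta else vst la ta.
Arguments strip : simpl never.

Lemma strip_le b la ta : strip b la ta -> forall i : 'I_D.+1, (ta i <= la i)%N.
Proof.
case: b => [/forallP H i|/and3P[_ _ /forallP H] i]; first by have /andP[] := H i.
by have /andP[] := H i.
Qed.

Lemma strip_dec b la (nu : diagram) : strip b la (rowlen nu) -> dec (rowlen nu).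
Proof.
move=> H; apply/decbP; first exact: supp_rowlen.
by move: H; case: b => [/hst_dec|/and3P[]].
Qed.

Lemma strip_dec1 b la ta : strip b la ta -> decb la.
Proof.
case: b => [/forallP H|/and3P[]] //; apply/forallP => i.
by have /andP[a b] := H i; apply: leq_trans a b.
Qed.

Lemma sz_inj_le la ta : supp la -> supp ta -> (forall i : 'I_D.+1, (ta i <= la i)%N) ->
  sz la = sz ta -> la = ta.
Proof.
move=> sl st H E; apply/funext => i.
case: (ltnP D i) => Di; first by rewrite sl // st.
move/eqP: E; rewrite eq_sym /sz (eq_leqif (leqif_sum (fun i _ => leqif_eq (H i)))).
by move/forallP/(_ (Ordinal (Di : (i < D.+1)%N)))/eqP => /= ->.
Qed.

Lemma strip_refl_sz b la ta : supp la -> supp ta -> strip b la ta -> sz la = sz ta -> la = ta.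
Proof. by move=> sl st /strip_le H; apply: sz_inj_le. Qed.

Lemma strip_commute_b b (A : comNzRingType) (x y : A) la ta :
  supp la -> supp ta -> dec la -> dec ta -> (sz la < D)%N -> (sz ta < D)%N ->
  \sum_(f : diagram | strip (~~ b) (rowlen f) la && strip b (rowlen f) ta)
     wt y (rowlen f) la * wt x (rowlen f) ta =
  (1 + x * y) *
  \sum_(f : diagram | strip b la (rowlen f) && strip (~~ b) ta (rowlen f))
     wt x la (rowlen f) * wt y ta (rowlen f).
Proof.
move=> sl st dl dt zl zt; have l0 := leq_ltn_trans (row_le_sz 0 sl) zl.
have t0 := leq_ltn_trans (row_le_sz 0 st) zt.
case: b; first by apply: strip_commute; rewrite ?sz_small.
under eq_bigl do rewrite andbC; under eq_bigr do rewrite mulrC.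
under [X in _ = _ * X]eq_bigl do rewrite andbC.
under [X in _ = _ * X]eq_bigr do rewrite mulrC.
rewrite [x * y]mulrC; apply: strip_commute; rewrite ?sz_small //.
Qed.

Section Pieri.
Variable A : comNzRingType.
Implicit Types (x : A) (xs : seq A).

(** The coefficient of y^r in [strip_commute_b], y being taken as a polynomial indeterminate. The
    two terms on the right come from the factor 1 + x y. *)
Lemma strip_commute_graded b x la ta r :
  supp la -> supp ta -> dec la -> dec ta -> (sz la < D)%N -> (sz ta < D)%N ->
  \sum_(f : diagram | [&& strip (~~ b) (rowlen f) la, strip b (rowlen f) ta & sz (rowlen f) == (sz la + r)%N])
     wt x (rowlen f) ta =
  \sum_(f : diagram | strip b la (rowlen f) && strip (~~ b) ta (rowlen f))
     wt x la (rowlen f) * ((sz ta == (sz (rowlen f) + r)%N)%:R + x * (sz ta + 1 == sz (rowlen f) + r)%N%:R).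
Proof.
move=> sl st dl dt zl zt.
have := strip_commute_b b x%:P ('X : {poly A}) sl st dl dt zl zt.
move/(congr1 (fun p : {poly A} => p`_r)).
have wtP (la' ta' : nat -> nat) : wt x%:P la' ta' = (wt x la' ta')%:P.
  by rewrite /wt rmorph_prod; apply: eq_bigr => i _; rewrite rmorphXn.
rewrite coef_sum mulrDl mul1r coefD -mulrA coefCM coefXM !coef_sum => E.
transitivity (\sum_(i : diagram | strip (~~ b) (rowlen i) la && strip b (rowlen i) ta)
    (wt 'X (rowlen i) la * wt x%:P (rowlen i) ta)`_r); last first.
  rewrite {}E.
  have -> : (if r == 0%N then 0 else \sum_(i : diagram | strip b la (rowlen i) && strip (~~ b) ta (rowlen i))
      (wt x%:P la (rowlen i) * wt 'X ta (rowlen i))`_r.-1) =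
    \sum_(i : diagram | strip b la (rowlen i) && strip (~~ b) ta (rowlen i))
      wt x la (rowlen i) * (sz ta + 1 == sz (rowlen i) + r)%N%:R.
    case: r => [|r] /=.
      rewrite big1 // => f /andP[_ /strip_le/sz_le fa].
      by rewrite addn0 gtn_eqF ?mulr0 // addn1 ltnS.
    apply: eq_bigr => f /andP[_ /strip_le fa].
    rewrite wtP coefCM (wtE 'X fa) coefXn; congr (_ * (nat_of_bool _)%:R).
    by rewrite addn1 addnS eqSS; have := sz_le fa; lia.
  rewrite mulr_sumr -big_split /=; apply: eq_bigr => f /andP[_ /strip_le fa].
  rewrite wtP coefCM (wtE 'X fa) coefXn mulrDr; congr (_ * (nat_of_bool _)%:R + _).
    by have := sz_le fa; lia.
  by rewrite mulrCA.
rewrite [RHS](bigID (fun f => sz (rowlen f) == (sz la + r)%N)) /= [X in _ = _ + X]big1 ?addr0.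
  clear E; apply: eq_big => [f|f /and3P[/strip_le fl _ /eqP E]]; first by rewrite andbA.
  by rewrite wtP coefMC (wtE 'X fl) coefXn E addnC addnK eqxx mul1r.
move=> f /andP[/andP[/strip_le fl _] /eqP E'].
rewrite wtP coefMC (wtE 'X fl) coefXn; case: eqP; last by rewrite mul0r.
by have := sz_le fl; lia.
Qed.

(* Branching by horizontal ([b = true]) or vertical ([b = false]) strips: the
   Schur polynomial of [la], resp. of the conjugate of [la] *)
Fixpoint spoly b xs la : A :=
  if xs is x :: xs' then
    \sum_(nu : diagram | strip b la (rowlen nu)) wt x la (rowlen nu) * spoly b xs' (rowlen nu)
  else [forall i : 'I_D.+1, la i == 0%N]%:R.

Lemma spoly0 b la : spoly b [::] la = [forall i : 'I_D.+1, la i == 0%N]%:R.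
Proof. by []. Qed.

Lemma sz_eq0 la : [forall i : 'I_D.+1, la i == 0%N] = (sz la == 0%N).
Proof. by rewrite /sz sum_nat_eq0. Qed.

Lemma strip_inter_dec b (f : diagram) la ta : supp la -> supp ta ->
  strip (~~ b) (rowlen f) la -> strip b (rowlen f) ta -> dec ta.
Proof.
move=> sl st; case: b => /= [/and3P[df _ _]|_ /and3P[_ dt _]]; last exact/(decbP st).
move=> /forallP H i; case: (ltnP D i) => Di; first by rewrite st // ltnW.
have /andP[_ a] := H (Ordinal (Di : (i < D.+1)%N)).
case: (ltnP D i.+1) => Di1; first by rewrite st.
have /andP[b _] := H (Ordinal (Di1 : (i.+1 < D.+1)%N)).
have /andP[c _] := H (Ordinal (Di : (i < D.+1)%N)).
have /andP[_ d] := H (Ordinal (Di1 : (i.+1 < D.+1)%N)).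
exact: leq_trans d c.
Qed.

(** For b = false this is the rule for conjugate shapes, hence strips of type [~~ b]. Induction on
    the variables: e_r of x :: xs is e_r + x e_(r-1) of xs, and these two terms match those of
    [strip_commute_graded]. *)
Theorem pieri b r xs la : supp la -> dec la -> (sz la + r < D)%N ->
  ecoef xs r * spoly b xs la =
  \sum_(ka : diagram | strip (~~ b) (rowlen ka) la && (sz (rowlen ka) == (sz la + r)%N))
     spoly b xs (rowlen ka).
Proof.
elim: xs r la => [|x xs IH] r la sl dl zl.
  rewrite /ecoef big_nil coef1 spoly0.
  pose f0 : diagram := [ffun=> ord0].
  have f00 i : rowlen f0 i = 0%N.
    case: (ltnP D i) => Di; first by rewrite rowlen_out.
    by have := rowlenE f0 (Ordinal (Di : (i < D.+1)%N)); rewrite ffunE.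
  have sf0 : sz (rowlen f0) = 0%N by rewrite /sz big1 // => i _; rewrite f00.
  rewrite big_mkcond (bigD1 f0) //= big1 ?addr0 => [|f ff0]; last first.
    case: ifP => // _; rewrite sz_eq0; case: eqP => // /eqP; rewrite -sz_eq0 => /forallP H.
    by case/eqP: ff0; apply/ffunP => i; apply/val_inj; rewrite ffunE /= -rowlenE; apply/eqP.
  rewrite !sz_eq0 sf0 eqxx; case: r zl => [|r] _; last first.
    by rewrite addnS andbF mul0r.
  rewrite addn0 mul1r [(0 == sz la)%N]eq_sym; case: eqP => [z|]; last by rewrite andbF.
  have -> : la = rowlen f0.
    apply/funext => i; rewrite f00; apply/eqP; rewrite -leqn0 -z; exact: row_le_sz.
  rewrite (_ : strip _ _ _) //; case: (b) => /=; last first.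
    by apply/forallP => i; rewrite !f00.
  by apply/and3P; split; apply/forallP => i; rewrite !f00.
transitivity (\sum_(nu : diagram | strip b la (rowlen nu)) \sum_(ta : diagram | strip (~~ b) (rowlen ta) (rowlen nu))
   wt x la (rowlen nu) * ((sz (rowlen ta) == sz (rowlen nu) + r)%N%:R +
      x * (sz (rowlen ta) + 1 == sz (rowlen nu) + r)%N%:R) * spoly b xs (rowlen ta)).
  rewrite /= mulr_sumr; apply: eq_bigr => nu snu.
  have dnu := strip_dec snu; have znu := sz_le (strip_le snu).
  have E k : (k <= r)%N -> ecoef xs k * spoly b xs (rowlen nu) =
     \sum_(ta : diagram | strip (~~ b) (rowlen ta) (rowlen nu))
       (sz (rowlen ta) == sz (rowlen nu) + k)%N%:R * spoly b xs (rowlen ta).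
    move=> kr; rewrite IH //; [| exact: supp_rowlen | lia].
    rewrite big_mkcondr; apply: eq_bigr => ta _.
    by case: (_ == _); rewrite ?mul1r ?mul0r.
  case: r zl E => [|r] zl E.
    rewrite ecoef_cons0 mulrCA E // mulr_sumr; apply: eq_bigr => ta sta.
    rewrite [(_ + 1 == _)%N]gtn_eqF ?mulr0 ?addr0 ?mulrA //.
    by have := sz_le (strip_le sta); lia.
  rewrite ecoef_consS mulrCA mulrDl E // -mulrA E // mulrDr !mulr_sumr -big_split /=.
  apply: eq_bigr => ta sta; rewrite addn1 addnS eqSS; ring.
rewrite /= (exchange_big_dep xpredT) //= [RHS](exchange_big_dep xpredT) //=.
apply: eq_bigr => ta _; rewrite -!mulr_suml; congr (_ * _).
(* Outside the hypotheses of the commutation, both sides vanish. *)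
case: (boolP (decb (rowlen ta) && (sz (rowlen ta) < D)%N)) => [/andP[dt zt]|H].
  rewrite -strip_commute_graded //; [|exact: supp_rowlen|exact/decbP/dt/supp_rowlen|lia].
  by apply: eq_bigl => f; rewrite andbAC -andbA.
rewrite !big1 //.
  move=> f /andP[/andP[s1 /eqP E] s2]; case/negP: H.
  rewrite (_ : decb _); last exact/(decbP (@supp_rowlen _))/(strip_inter_dec _ _ s1 s2)/supp_rowlen.
  by have := sz_le (strip_le s2); rewrite E; lia.
move=> f /andP[s1 s2]; have dt := strip_dec1 s2; rewrite dt /= in H.
have := sz_le (strip_le s1); move: H; rewrite -leqNgt => H H1.
rewrite [(_ == _)%N]gtn_eqF ?[(_ + 1 == _)%N]gtn_eqF ?mulr0 ?addr0 ?mulr0 //; lia.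
Qed.


End Pieri.
End Shapes.
Arguments strip : simpl never.

(** * Pieri rule for complete homogeneous functions *)

Section HPieri.
Variable D : nat.
Variable A : comNzRingType.
Implicit Types (la ka : nat -> nat) (xs : seq A).

Local Notation supp := (@supp D).
Local Notation sz := (@sz D).
Local Notation strip := (@strip D).

(** The sum factors over rows. In the first row where la and ka differ, either la is longer and no
    length is possible, or the lengths [ka i] and [(ka i).-1] are both possible and have opposite
    signs. *)
Lemma strip_pair_sum ka la : supp ka -> supp la -> dec ka -> dec la -> (sz la < sz ka <= D)%N ->
  \sum_(nu : diagram D | strip true (rowlen nu) la && strip false ka (rowlen nu))
     (-1) ^+ (sz ka - sz (rowlen nu)) = 0 :> A.
Proof.
move=> sk sl dk dl /andP[zz zD].
pose cond i a := [&& (la i <= a)%N, (if i is i'.+1 then (a <= la i')%N else true) & (a <= ka i <= a.+1)%N].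
have E (nu : diagram D) : strip true (rowlen nu) la && strip false ka (rowlen nu) =
    [forall i : 'I_D.+1, cond i (rowlen nu i)].
  apply/andP/forallP => [[/forallP H /and3P[_ _ /forallP V]] i|H].
    rewrite /cond V andbT; have /andP[_ ->] := H i; case: i => -[|i] //= iD.
    by have /andP[] := H (Ordinal (ltnW iD : (i < D.+1)%N)).
  have h : strip true (rowlen nu) la.
    apply/forallP => i; have /and3P[-> _ _] := H i; rewrite andbT.
    case: (ltnP i.+1 D.+1) => iD; last by rewrite rowlen_out.
    by have /and3P[_ ] := H (Ordinal iD).
  split=> //; apply/and3P; split; first exact/(decbP sk).
    by apply: strip_dec1 h.
  by apply/forallP => i; have /and3P[] := H i.
under eq_bigl do rewrite E.
transitivity (\sum_(nu : diagram D | [forall i : 'I_D.+1, cond i (rowlen nu i)])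
    \prod_(i < D.+1) (-1) ^+ (ka i - rowlen nu i)%N : A).
  apply: eq_bigr => nu; rewrite -E => /andP[_ /strip_le s].
  by rewrite -wtE.
rewrite (@sum_shape D A cond (fun i a => (-1) ^+ (ka i - a)%N)).
have [i di ei] : exists2 i, la i != ka i & forall j, (j < i)%N -> la j = ka j.
  have ex : exists i, la i != ka i.
    apply/not_existsP => H; move: zz; rewrite /sz.
    by under eq_bigr => i _ do rewrite (eqP (negPn (introN idP (H i)))); rewrite ltnn.
  exists (ex_minn ex); case: ex_minnP => // i _ H j ji.
  by apply/eqP; apply: contraTT ji => /H; rewrite -leqNgt.
have iD : (i < D.+1)%N.
  by rewrite ltnNge; apply: contra di => Di; rewrite sl // sk.
rewrite (bigD1 (Ordinal iD)) //= [X in X * _](_ : _ = 0) ?mul0r //.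
move: di; rewrite neq_ltn => /orP[lk|kl]; last first.
  by rewrite big1 // => a /and3P[/= H1 _ /andP[H2 _]]; lia.
have kb : (ka i < D.+1)%N by rewrite ltnS; apply: leq_trans zD; apply: row_le_sz.
have kE : ((ka i).-1.+1 = ka i)%N by lia.
rewrite (@sum_two A D.+1 (cond i) (fun a => (-1) ^+ (ka i - a)%N) (ka i).-1) ?kE //.
  have -> : cond i (ka i).-1.
    rewrite /cond; case: i ei iD lk kb kE => [|i] /= ei iD lk kb kE; first by lia.
    by rewrite (ei i (ltnSn i)); have := dk i; lia.
  have -> : cond i (ka i).
    rewrite /cond; case: i ei iD lk kb kE => [|i] /= ei iD lk kb kE; first by lia.
    by rewrite (ei i (ltnSn i)); have := dk i; lia.
  have -> : (ka i - (ka i).-1 = 1)%N by lia.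
  by rewrite subnn expr0 expr1 !mul1r addNr.
by move=> b /and3P[_ _]; lia.
Qed.

Definition hrel xs (hs : nat -> A) := forall r,
  \sum_(i < r.+1) (-1) ^+ i * ecoef xs i * hs (r - i)%N = (r == 0%N)%:R.

Definition mkdiag la : diagram D := [ffun i : 'I_D.+1 => inord (la i)].

Lemma mkdiagK la : supp la -> (forall i, (la i <= D)%N) -> rowlen (mkdiag la) = la.
Proof.
move=> sl lD; apply/funext => i; case: (ltnP D i) => Di; first by rewrite rowlen_out ?sl.
by have := rowlenE (mkdiag la) (Ordinal (Di : (i < D.+1)%N)); rewrite ffunE /= inordK // ltnS.
Qed.

Lemma rowlen_inj : injective (@rowlen D).
Proof. by move=> f g E; apply/ffunP => i; apply/val_inj; have := rowlenE f i; rewrite E rowlenE. Qed.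

Lemma strip_refl b la : dec la -> strip b la la.
Proof.
move=> dl; case: b; first by apply/forallP => i; rewrite leqnn dl.
by apply/and3P; split; apply/forallP => i; rewrite ?dl // leqnn leqnSn.
Qed.

Lemma sign_select r l n k : (l <= n)%N ->
  \sum_(i < r.+1) (if (n == l + (r - i))%N && (k == n + i.+1)%N then (-1) ^+ i.+1 else 0) =
  if (k == l + r.+1)%N && (n < k)%N then (-1) ^+ (k - n) else 0 :> A.
Proof.
move=> ln; case: ifP => [/andP[/eqP kE nk]|H]; last first.
  rewrite big1 // => i _; case: ifP => // /andP[/eqP E1 /eqP E2].
  by case/negP: H; apply/andP; have := ltn_ord i; split; [apply/eqP; lia | lia].
have ir : (l + r - n < r.+1)%N by lia.
rewrite (bigD1 (Ordinal ir)) //= [X in _ + X]big1 ?addr0 => [|i].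
  rewrite ifT; last by apply/andP; split; apply/eqP; lia.
  by congr (_ ^+ _); lia.
rewrite -val_eqE /= => /eqP ni; case: ifP => // /andP[/eqP E1 /eqP E2].
by case: ni; have := ltn_ord i; lia.
Qed.

(** [hrel] expresses h_r through smaller h and the e_i, to which induction and [pieri] apply. Each
    ka then appears with the alternating sum of [strip_pair_sum] deprived of the terms with nu of
    the size of ka, that is nu = ka, so it keeps the opposite of these terms. *)
Theorem h_pieri xs hs r la : hrel xs hs -> supp la -> dec la -> (sz la + r < D)%N ->
  hs r * spoly D true xs la =
  \sum_(ka : diagram D | strip true (rowlen ka) la && (sz (rowlen ka) == (sz la + r)%N))
     spoly D true xs (rowlen ka).
Proof.
move=> H sl dl; elim/ltn_ind: r => r IH zr.
case: r IH zr => [|r] IH zr.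
  have -> : hs 0%N = 1 by have := H 0%N; rewrite big_ord1 expr0 ecoef0 !mul1r.
  have laK : rowlen (mkdiag la) = la.
    apply: mkdiagK => // i; apply: leq_trans (ltnW zr).
    by rewrite addn0; apply: row_le_sz.
  rewrite mul1r (big_pred1 (mkdiag la)) ?laK // => f /=; rewrite addn0.
  apply/andP/eqP => [[s /eqP z]|->]; last by rewrite laK eqxx; split=> //; apply: strip_refl.
  by apply: rowlen_inj; rewrite laK (strip_refl_sz (@supp_rowlen _ _) sl s z).
have -> : hs r.+1 = - \sum_(i < r.+1) (-1) ^+ i.+1 * ecoef xs i.+1 * hs (r - i)%N.
  have := H r.+1; rewrite big_ord_recl expr0 mul1r subn0 ecoef0 mul1r /= mulr0n.
  by move/eqP; rewrite addr_eq0 => /eqP.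
rewrite mulNr mulr_suml -sumrN.
transitivity (\sum_(i < r.+1) \sum_(nu : diagram D | strip true (rowlen nu) la)
   \sum_(ka : diagram D | strip false (rowlen ka) (rowlen nu))
     (if (sz (rowlen nu) == sz la + (r - i))%N && (sz (rowlen ka) == sz (rowlen nu) + i.+1)%N
      then (-1) ^+ i.+1 else 0) * - spoly D true xs (rowlen ka)).
  apply: eq_bigr => i _; have ir := ltn_ord i.
  rewrite -!mulrA IH; [|lia|lia].
  rewrite [in LHS]big_mkcondr -!mulrN -sumrN !mulr_sumr; apply: eq_bigr => nu snu.
  have dnu := strip_dec1 snu; case: eqP => /= [zn|_]; last first.
    by rewrite oppr0 !mulr0 big1 // => ka _; rewrite mul0r.
  rewrite mulrN (@pieri D A true); [|exact: supp_rowlen|exact/(decbP (@supp_rowlen _ _))|lia].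
  rewrite /= big_mkcondr -sumrN !mulr_sumr /=; apply: eq_bigr => ka _.
  by case: ifP => _; rewrite ?mul0r // oppr0 mulr0.
rewrite exchange_big /=.
transitivity (\sum_(nu : diagram D | strip true (rowlen nu) la) \sum_(ka : diagram D | strip false (rowlen ka) (rowlen nu))
   (if (sz (rowlen ka) == sz la + r.+1)%N && (sz (rowlen nu) < sz (rowlen ka))%N
    then (-1) ^+ (sz (rowlen ka) - sz (rowlen nu)) else 0) * - spoly D true xs (rowlen ka)).
  apply: eq_bigr => nu /strip_le/sz_le znu; rewrite exchange_big; apply: eq_bigr => ka _.
  by rewrite -mulr_suml sign_select.
rewrite (exchange_big_dep xpredT) //= [RHS]big_mkcond; apply: eq_bigr => ka _.
rewrite -mulr_suml; case: eqP => [zk|_]; last by rewrite andbF big1 ?mul0r.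
rewrite andbT /= mulrN -mulNr.
have [dk|ndk] := boolP (decb D (rowlen ka)); last first.
  rewrite big1 ?oppr0 ?mul0r ?ifN //; first by apply: contra ndk => /strip_dec1.
  by move=> nu /andP[_ /strip_dec1 dk]; rewrite dk in ndk.
have {}dk : dec (rowlen ka) by apply/decbP: dk; apply: supp_rowlen.
have zlk : (sz la < sz (rowlen ka) <= D)%N by rewrite zk; lia.
have := strip_pair_sum (@supp_rowlen _ ka) sl dk dl zlk.
rewrite (bigID (fun nu : diagram D => (sz (rowlen nu) < sz (rowlen ka))%N)) /=.
rewrite -big_mkcondr => /eqP; rewrite addr_eq0 => /eqP ->; rewrite opprK.
transitivity ((strip true (rowlen ka) la)%:R * spoly D true xs (rowlen ka)); last first.
  by case: ifP => _; rewrite ?mul1r ?mul0r.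
congr (_ * _); case: (boolP (strip true (rowlen ka) la)) => s.
  rewrite (big_pred1 ka) ?subnn ?expr0 // => nu /=; rewrite -leqNgt.
  apply/andP/eqP => [[/andP[s1 s2] z]|->]; last by rewrite s leqnn strip_refl.
  apply: rowlen_inj; apply/esym; apply: (strip_refl_sz (@supp_rowlen _ _) (@supp_rowlen _ _) s2).
  by apply/eqP; rewrite eqn_leq z (sz_le (strip_le s2)).
rewrite big1 // => nu /andP[/andP[s1 s2] z]; case/negP: s.
rewrite (_ : rowlen ka = rowlen nu) //; apply: (strip_refl_sz (@supp_rowlen _ _) (@supp_rowlen _ _) s2).
by apply/eqP; rewrite eqn_leq leqNgt z (sz_le (strip_le s2)).
Qed.
End HPieri.

(** * Schur polynomials on products of h, and conjugate ones on products of e *)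

Section Expand.
Variables (D : nat) (F : fieldType) (A : comAlgType F).
Implicit Types (la : nat -> nat) (xs : seq A).

Local Notation supp := (@supp D).
Local Notation sz := (@sz D).
Local Notation strip := (@strip D).

(* Dominance of shapes is expressed through the sums of the excesses of the
   rows over c, for all c: unlike partial sums, these do not require sorting. *)
Definition excess c la : nat := (\sum_(i < D.+1) (la i - c))%N.
Definition pexcess c (nu : seq nat) : nat := (\sum_(i <- nu) (i - c))%N.

Lemma spoly_sz0 b xs la : supp la -> sz la = 0%N -> spoly D b xs la = 1.
Proof.
move=> sl z.
have -> : la = (fun=> 0%N).
  by apply/funext => i; apply/eqP; rewrite -leqn0 -z; apply: row_le_sz.
elim: xs => [|x xs IH]; first by rewrite /=; case: forallP => // -[].
rewrite /= (big_pred1 (mkdiag D (fun=> 0%N))) => [|nu].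
  rewrite mkdiagK // IH mulr1 /wt big1 // => i _; exact: expr0.
rewrite /pred1 /=; apply/idP/eqP => [/strip_le H|->]; last by rewrite mkdiagK //; apply: strip_refl.
apply: rowlen_inj; rewrite mkdiagK //; apply/funext => i.
case: (ltnP D i) => Di; first by rewrite rowlen_out.
by have := H (Ordinal (Di : (i < D.+1)%N)); rewrite leqn0 => /eqP.
Qed.

Lemma removed_row_strips la l (ka : diagram D) : supp la -> dec la ->
  (l <= D)%N -> (0 < la l)%N -> la l.+1 = 0%N ->
  strip true (rowlen ka) (fun i => if i == l then 0%N else la i) ->
  sz (rowlen ka) = sz la -> rowlen ka <> la ->
  [/\ (rowlen ka l < la l)%N, forall i, (l < i)%N -> rowlen ka i = 0%N &
      forall i, (i < l)%N -> (la i <= rowlen ka i)%N].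
Proof.
move=> sl dl lD l0 l1 /forallP S zz ne.
have up i : (l < i)%N -> rowlen ka i = 0%N.
  case: (ltnP D i) => Di li; first by rewrite rowlen_out.
  have iD : (i.-1 < D.+1)%N by lia.
  have /andP[+ _] := S (Ordinal iD); rewrite /= prednK; last by lia.
  case: eqP => [_|il]; first by rewrite leqn0 => /eqP.
  have -> : la i.-1 = 0%N.
    by apply/eqP; rewrite -leqn0 -l1; apply: dec_le => //; lia.
  by rewrite leqn0 => /eqP.
have lo i : (i < l)%N -> (la i <= rowlen ka i)%N.
  move=> il; have iD : (i < D.+1)%N by lia.
  by have /andP[_] := S (Ordinal iD); rewrite /= ltn_eqF.
split=> //; rewrite ltnNge; apply/negP => H; apply: ne.
apply: (@sz_inj_le D) => //; first exact: supp_rowlen.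
move=> i; case: (ltngtP i l) => [/lo //|li|-> //].
by rewrite (_ : la i = 0%N) //; apply/eqP; rewrite -leqn0 -l1; apply: dec_le.
Qed.

(** Cells move from the last row l to earlier ones. If row l is not longer than c, it contributes
    nothing and the earlier rows grow. Otherwise all rows up to l reach above c in la, and the
    excess of la is its size minus a constant, a lower bound for every shape of that size with these
    rows. *)
Lemma excess_removed_row la l (ka : diagram D) c : supp la -> dec la ->
  (l <= D)%N -> la l.+1 = 0%N -> sz (rowlen ka) = sz la ->
  (forall i, (l < i)%N -> rowlen ka i = 0%N) ->
  (forall i, (i < l)%N -> (la i <= rowlen ka i)%N) ->
  (excess c la <= excess c (rowlen ka))%N.
Proof.
move=> sl dl lD l1 zz up lo; have la0 i : (l < i)%N -> la i = 0%N.
  by move=> li; apply/eqP; rewrite -leqn0 -l1; apply: dec_le.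
case: (leqP (la l) c) => lc.
  apply: leq_sum => i _; case: (ltngtP i l) => [/lo il|/la0-> //|->].
    exact: leq_sub2r.
  by rewrite (eqP lc).
pose K := (\sum_(i < D.+1) (if (i <= l)%N then c else 0))%N.
have E1 : sz la = (excess c la + K)%N.
  rewrite /sz /excess /K -big_split /=; apply: eq_bigr => i _; case: (leqP i l) => il.
    by rewrite subnK // ltnW // (leq_trans lc) // dec_le.
  by rewrite la0.
have E2 : (sz (rowlen ka) <= excess c (rowlen ka) + K)%N.
  rewrite /sz /excess /K -big_split /=; apply: leq_sum => i _; case: (leqP i l) => il.
    by lia.
  by rewrite up.
by rewrite -(leq_add2r K) -E1 -zz.
Qed.

Lemma sum_flatten_expand (I : Type) (r : seq I) (f : I -> seq (F * seq nat)) (hs : nat -> A) :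
  \sum_(x <- flatten [seq [seq (- x.1, x.2) | x <- f i] | i <- r])
     x.1 *: \prod_(a <- x.2) hs a =
  - \sum_(i <- r) \sum_(x <- f i) x.1 *: \prod_(a <- x.2) hs a.
Proof.
rewrite big_flatten big_map -sumrN; apply: eq_bigr => i _.
by rewrite big_map -sumrN; apply: eq_bigr => x _; rewrite scaleNr.
Qed.

Lemma sum_cons_expand (l : seq (F * seq nat)) a (hs : nat -> A) :
  \sum_(x <- [seq (x.1, a :: x.2) | x <- l]) x.1 *: \prod_(b <- x.2) hs b =
  hs a * \sum_(x <- l) x.1 *: \prod_(b <- x.2) hs b.
Proof.
by rewrite big_map mulr_sumr; apply: eq_bigr => x _; rewrite /= big_cons scalerAr.
Qed.

Definition good_index la (nu : seq nat) :=
  [/\ 0%N \notin nu, sumn nu = sz la & forall c, (excess c la <= pexcess c nu)%N].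

(* That the same coefficients serve for the h_nu and for the e_nu is what gives
   access to omega. *)
Theorem spoly_expand la : supp la -> dec la -> (sz la < D)%N ->
  exists l : seq (F * seq nat), (forall x, x \in l -> good_index la x.2) /\
  forall xs hs, hrel xs hs ->
    spoly D true xs la = \sum_(x <- l) x.1 *: \prod_(a <- x.2) hs a /\
    spoly D false xs la = \sum_(x <- l) x.1 *: \prod_(a <- x.2) ecoef xs a.
Proof.
(* Lexicographic induction on the index and the length of the last nonempty row, encoded in base
   [D.+1]. *)
suff H N la' : supp la' -> dec la' -> (sz la' < D)%N ->
  (forall i, la' i != 0%N -> (i * D.+1 + la' i < N)%N) ->
  exists l : seq (F * seq nat), (forall x, x \in l -> good_index la' x.2) /\
  forall xs hs, hrel xs hs ->
    spoly D true xs la' = \sum_(x <- l) x.1 *: \prod_(a <- x.2) hs a /\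
    spoly D false xs la' = \sum_(x <- l) x.1 *: \prod_(a <- x.2) ecoef xs a.
  move=> sl dl zl; apply: (H (D.+1 * D.+1)%N) => // i li.
  have iD : (i <= D)%N by rewrite leqNgt; apply: contra li => /sl->.
  have := row_le_sz i sl; nia.
elim: N la' => [|N IH] {}la sl dl zl laN.
  exists [:: (1, [::])]; have z0 : sz la = 0%N.
    by rewrite /sz big1 // => i _; apply/eqP; apply: contraT => /laN.
  split=> [x|xs hs _].
    rewrite inE => /eqP->; split=> //= c; rewrite /pexcess big_nil leqn0 -leqn0 -z0.
    by apply: leq_sum => i _; apply: leq_subr.
  by rewrite !spoly_sz0 // !big_seq1 /= !big_nil scale1r.
have [z0|z0] := posnP (sz la).
  by apply: IH => // i; rewrite -lt0n => li; have := row_le_sz i sl; lia.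
have ex : exists i, la i != 0%N.
  apply/not_existsP => H; move: z0; rewrite /sz big1 // => i _.
  by apply/eqP; apply: contraT => /H.
have bound i : la i != 0%N -> (i <= D)%N.
  by move=> li; rewrite leqNgt; apply: contra li => /sl->.
case: (ex_maxnP ex bound) => l l0 lmax {ex}; have lD := bound _ l0.
have l1 : la l.+1 = 0%N by apply/eqP; apply: contraT => /lmax; rewrite ltnn.
(* The last row is removed. Multiplying by h or e of its length gives back la, together with shapes
   whose row l is shorter; these are subtracted by induction. *)
pose lm i := if i == l then 0%N else la i.
have lm_le i : (lm i <= la i)%N by rewrite /lm; case: eqP.
have slm : supp lm by move=> i /sl E; rewrite /lm E if_same.
have dlm : dec lm.
  move=> i; rewrite /lm; case: eqP => // _; case: eqP => [->|_]; first by rewrite l1.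
  exact: dl.
have szlm : sz la = (sz lm + la l)%N.
  rewrite /sz (bigD1 (Ordinal (lD : (l < D.+1)%N))) //= addnC; congr (_ + _)%N.
  rewrite [RHS](bigD1 (Ordinal (lD : (l < D.+1)%N))) //= {1}/lm eqxx add0n.
  by apply: eq_bigr => i; rewrite -val_eqE /= /lm => /negbTE ->.
have exlm c : excess c la = (excess c lm + (la l - c))%N.
  rewrite /excess (bigD1 (Ordinal (lD : (l < D.+1)%N))) //= addnC; congr (_ + _)%N.
  rewrite [RHS](bigD1 (Ordinal (lD : (l < D.+1)%N))) //= {1}/lm eqxx sub0n add0n.
  by apply: eq_bigr => i; rewrite -val_eqE /= /lm => /negbTE ->.
have lN := laN _ l0.
have [||L [Lgood Lsum]] := IH lm slm dlm; first by lia.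
  move=> i; rewrite /lm; case: (i =P l) => // il li; have il' : (i < l)%N by have := lmax _ li; lia.
  by have := row_le_sz i sl; have := leq_mul il' (leqnn D.+1); lia.
pose cond (ka : diagram D) := strip true (rowlen ka) lm && (sz (rowlen ka) == (sz lm + la l)%N).
pose P (ka : diagram D) (M : seq (F * seq nat)) :=
  cond ka && (ka != mkdiag D la) ->
  (forall x, x \in M -> good_index la x.2) /\
  forall xs hs, hrel xs hs ->
    spoly D true xs (rowlen ka) = \sum_(x <- M) x.1 *: \prod_(a <- x.2) hs a /\
    spoly D false xs (rowlen ka) = \sum_(x <- M) x.1 *: \prod_(a <- x.2) ecoef xs a.
have laK : rowlen (mkdiag D la) = la.
  by apply: mkdiagK => // i; apply: leq_trans (row_le_sz i sl) (ltnW zl).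
have [f fP] : exists f, forall ka : diagram D, P ka (f ka).
  suff /choice[f fP] : forall ka : diagram D, exists M, P ka M by exists f.
  move=> ka.
  have [/andP[/andP[s /eqP z] ne]|nc] := boolP (cond ka && (ka != mkdiag D la)); last first.
    by exists [::] => H; rewrite H in nc.
  rewrite -szlm in z; have [||k1 k2 k3] := removed_row_strips sl dl lD _ l1 s z.
  - by rewrite lt0n.
  - by move=> E; case/eqP: ne; apply: rowlen_inj; rewrite laK.
  have [||||M [Mgood Msum]] := IH (rowlen ka).
  - exact: supp_rowlen.
  - by apply/decbP/(strip_dec1 s)/supp_rowlen.
  - by rewrite z.
  - move=> i ki; case: (ltngtP i l) => [il|/k2 E|E].
    + by have := row_le_sz i (@supp_rowlen D ka); have := leq_mul il (leqnn D.+1); lia.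
    + by rewrite E in ki.
    + by rewrite E in ki *; lia.
  exists M => _; split=> // x /Mgood[x1 x2 x3]; split=> //; first by rewrite x2.
  by move=> c; apply: leq_trans (x3 c); apply: (@excess_removed_row _ l).
exists ([seq (x.1, la l :: x.2) | x <- L] ++
  flatten [seq [seq (- x.1, x.2) | x <- f ka] | ka <- enum [pred ka : diagram D | cond ka && (ka != mkdiag D la)]]).
split=> [x|xs hs H].
  rewrite mem_cat => /orP[/mapP[y /Lgood[y1 y2 y3] ->]|].
    split; first by rewrite inE negb_or eq_sym l0.
      by rewrite /= y2 szlm addnC.
    by move=> c; rewrite /pexcess big_cons exlm addnC leq_add2l; apply: y3.
  case/flattenP=> M /mapP[ka]; rewrite mem_enum inE => kac -> /mapP[y yf ->].
  by have [g _] := fP ka kac; have := g _ yf.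
have [E1 E2] := Lsum xs hs H.
have cla : cond (mkdiag D la).
  rewrite /cond laK szlm eqxx andbT; apply/forallP => i; rewrite lm_le andbT /lm.
  case: ((i : nat) =P l) => [->|il]; first by rewrite l1.
  exact: dl.
have zlm : (sz lm + la l < D)%N by rewrite -szlm.
rewrite !big_cat !sum_cons_expand !sum_flatten_expand -E1 -E2.
rewrite (h_pieri H slm dlm zlm) (@pieri D A false (la l) xs lm slm dlm zlm).
rewrite -/cond (bigD1 (mkdiag D la)) //= laK [in X in _ /\ X](bigD1 (mkdiag D la)) //= laK.
split.
  rewrite -addrA [X in _ + X](_ : _ = 0) ?addr0 //; apply/eqP; rewrite subr_eq0; apply/eqP.
  rewrite big_enum; apply: eq_big => // ka kac; have [_ g] := fP ka kac.
  by have [-> _] := g xs hs H.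
rewrite -addrA [X in _ + X](_ : _ = 0) ?addr0 //; apply/eqP; rewrite subr_eq0; apply/eqP.
rewrite big_enum; apply: eq_big => // ka kac; have [_ g] := fP ka kac.
by have [_ ->] := g xs hs H.
Qed.

End Expand.

(** * Schur polynomials and tableaux *)

Section Tableaux.
Variable D : nat.
Implicit Types (la : nat -> nat) (T : seq (seq nat)).

Definition colstrict T := forall i j, (j < size (nth [::] T i.+1))%N ->
  (nth 0 (nth [::] T i) j < nth 0 (nth [::] T i.+1) j)%N.

Definition tableau N l la T :=
  [/\ map size T = mkseq la l, all (sorted leq) T, colstrict T &
      all (all (fun a => a < N)%N) T].

Definition add_letter N l la (nu : nat -> nat) T :=
  mkseq (fun i => nth [::] T i ++ nseq (la i - nu i) N) l.

(** Follows the branching in [spoly]: the shape [nu] holds the letters other than the largest one.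
    Empty rows are kept, so that all lists have length l. *)
Fixpoint tableaux N l la : seq (seq (seq nat)) :=
  if N is N'.+1 then
    [seq add_letter N' l la (rowlen nu) T |
      nu <- enum [pred nu : diagram D | hst D la (rowlen nu)], T <- tableaux N' l (rowlen nu)]
  else if [forall i : 'I_D.+1, la i == 0%N] then [:: nseq l [::]] else [::].

Lemma sorted_split N (r : seq nat) : sorted leq r -> all (fun a => a < N.+1)%N r ->
  r = [seq a <- r | (a < N)%N] ++ nseq (size r - size [seq a <- r | (a < N)%N]) N.
Proof.
elim: r => //= x r IH sr /andP[xN rN]; have {}IH := IH (path_sorted sr) rN.
case: (ltnP x N) => [_|Nx] /=; first by rewrite subSS -IH.
have xE : x = N by apply/eqP; rewrite eqn_leq Nx andbT -ltnS.
have fE : [seq a <- r | (a < N)%N] = [::].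
  apply/eqP; rewrite -(negbK (_ == _)) -has_filter; apply/hasPn => a ar.
  by have := allP (order_path_min leq_trans sr) a ar; rewrite -leqNgt xE.
by rewrite fE /= xE; congr (_ :: _); rewrite {1}IH fE subn0.
Qed.

Lemma sorted_add (r : seq nat) N k : sorted leq r -> all (fun a => a < N)%N r ->
  sorted leq (r ++ nseq k N).
Proof.
rewrite !(sorted_pairwise leq_trans) pairwise_cat => -> /= rN; apply/andP; split.
  apply/allrelP => x y xr; rewrite mem_nseq => /andP[_ /eqP->].
  exact/ltnW/(allP rN).
by elim: k => //= k ->; rewrite andbT; apply/allP => y; rewrite mem_nseq => /andP[_ /eqP->].
Qed.

Lemma filter_add (r : seq nat) N k : all (fun a => a < N)%N r ->
  [seq a <- r ++ nseq k N | (a < N)%N] = r.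
Proof.
move=> rN; rewrite filter_cat (all_filterP rN) -[RHS]cats0; congr (_ ++ _).
by elim: k => //= k ->; rewrite ltnn.
Qed.

Lemma tableau_size N l la T : tableau N l la T -> size T = l.
Proof. by move=> [E _ _ _]; rewrite -(size_map size) E size_mkseq. Qed.

Lemma tableau_row N l la T i : (forall i, (l <= i)%N -> la i = 0%N) ->
  tableau N l la T -> size (nth [::] T i) = la i.
Proof.
move=> la0 tT; have sT := tableau_size tT; case: (ltnP i l) => il; last first.
  by rewrite nth_default ?sT // la0.
by case: tT => E _ _ _; rewrite -(nth_map _ 0%N size) ?sT // E nth_mkseq.
Qed.

Lemma tableau_letters N l la T i : tableau N l la T -> all (fun a => a < N)%N (nth [::] T i).
Proof.
move=> [_ _ _ /allP H]; case: (ltnP i (size T)) => iT; last by rewrite nth_default.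
by apply: H; apply: mem_nth.
Qed.

Lemma tableau_sorted N l la T i : tableau N l la T -> sorted leq (nth [::] T i).
Proof.
move=> [_ /allP H _ _]; case: (ltnP i (size T)) => iT; last by rewrite nth_default.
by apply: H; apply: mem_nth.
Qed.

(** Deleting the largest letter leaves a shape nu with [la i.+1 <= nu i]: a cell of row i + 1 below
    a largest letter would need a larger entry. Conversely, such a horizontal strip can be filled
    with the new letter without breaking a column. *)
Lemma mem_tableaux N l la T : supp D la -> dec la -> (forall i, (la i <= D)%N) ->
  (forall i, (l <= i)%N -> la i = 0%N) -> reflect (tableau N l la T) (T \in tableaux N l la).
Proof.
elim: N la T => [|N IH] la T sl dl lD l0 /=.
  have nil0 i : tableau 0 l la T -> nth [::] T i = [::].
    by move=> /(tableau_letters i); case: (nth _ _ _).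
  case: (boolP [forall i : 'I_D.+1, la i == 0%N]) => la0; last first.
    constructor=> tT; case/negP: la0; apply/forallP => i.
    by rewrite -(tableau_row i l0 tT) nil0.
  have {}la0 i : la i = 0%N.
    case: (ltnP D i) => Di; first exact: sl.
    exact/eqP/(forallP la0 (Ordinal (Di : (i < D.+1)%N))).
  rewrite inE; apply: (iffP eqP) => [->|tT]; last first.
    apply: (@eq_from_nth _ [::]); rewrite ?size_nseq ?(tableau_size tT) // => i il.
    by rewrite nil0 // nth_nseq if_same.
  split=> //; rewrite ?all_nseq ?orbT //; last by move=> i j; rewrite nth_nseq if_same.
  apply: (@eq_from_nth _ 0%N); rewrite size_map size_nseq ?size_mkseq // => i il.
  by rewrite map_nseq nth_nseq il nth_mkseq // la0.
have nu0 (nu : diagram D) : hst D la (rowlen nu) -> forall i, (l <= i)%N -> rowlen nu i = 0%N.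
  move=> s i /l0 E; case: (ltnP D i) => Di; first by rewrite rowlen_out.
  have := @strip_le D true _ _ s (Ordinal (Di : (i < D.+1)%N)).
  by rewrite /= E leqn0 => /eqP.
have nuD (nu : diagram D) i : (rowlen nu i <= D)%N.
  case: (ltnP D i) => Di; first by rewrite rowlen_out.
  by have := rowlenE nu (Ordinal (Di : (i < D.+1)%N)) => /= ->; rewrite -ltnS.
apply: (iffP allpairsPdep) => [[nu [T' [+ + ->]]]|tT].
  rewrite mem_enum inE => s.
  have dnu : dec (rowlen nu) by apply: (@strip_dec D true _ _ s).
  have nula i : (rowlen nu i <= la i)%N.
    case: (ltnP D i) => Di; first by rewrite rowlen_out.
    exact: (@strip_le D true _ _ s (Ordinal (Di : (i < D.+1)%N))).
  move=> /(IH _ _ (@supp_rowlen D nu) dnu (nuD nu) (nu0 nu s)) tT.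
  have sz' i := tableau_row i (nu0 nu s) tT.
  have let' i := tableau_letters i tT.
  have nthE i : nth [::] (add_letter N l la (rowlen nu) T') i =
     nth [::] T' i ++ nseq (la i - rowlen nu i) N.
    case: (ltnP i l) => il; first by rewrite nth_mkseq.
    rewrite nth_default ?size_mkseq // nth_default ?(tableau_size tT) //.
    by rewrite l0.
  split.
  - rewrite /add_letter -map_comp; apply/eq_in_map => i _ /=.
    by rewrite size_cat size_nseq sz' subnKC.
  - apply/(all_nthP [::]) => i _; rewrite nthE; apply: sorted_add (let' i).
    exact: (tableau_sorted i tT).
  - move=> i j; rewrite !nthE size_cat size_nseq sz' subnKC // => ji.
    have jn : (j < rowlen nu i)%N.
      apply: leq_trans ji _; case: (ltnP D i) => Di; first by rewrite sl // ltnW.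
      by have /forallP/(_ (Ordinal (Di : (i < D.+1)%N)))/andP[] := s.
    rewrite !nth_cat !sz' jn; case: (ltnP j (rowlen nu i.+1)) => jn1.
      by case: tT => _ _ cT _; apply: (cT i j); rewrite sz'.
    rewrite nth_nseq ifT; last by rewrite ltn_sub2r //; apply: leq_ltn_trans jn1 ji.
    by apply: (all_nthP 0%N (let' i)); rewrite sz'.
  - apply/(all_nthP [::]) => i _; rewrite nthE all_cat all_nseq ltnSn orbT andbT.
    by apply: sub_all (let' i) => a /ltnW.
pose nu i := size [seq a <- nth [::] T i | (a < N)%N].
have sT := tableau_size tT; have szT i := tableau_row i l0 tT.
have rsE i := sorted_split (tableau_sorted i tT) (tableau_letters i tT).
have nula i : (nu i <= la i)%N by rewrite -szT /nu size_filter count_size.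
have snu : supp D nu by move=> i /sl E; apply/eqP; rewrite -leqn0 -E.
have nuK : rowlen (mkdiag D nu) = nu.
  by apply: mkdiagK => // i; apply: leq_trans (nula i) (lD i).
have hnu i : (la i.+1 <= nu i)%N.
  rewrite leqNgt; apply/negP => H.
  have lt1 : (nth 0 (nth [::] T i) (nu i) < nth 0 (nth [::] T i.+1) (nu i))%N.
    by case: tT => _ _ cT _; apply: (cT i); rewrite szT.
  have E : nth 0%N (nth [::] T i) (nu i) = N.
    rewrite rsE nth_cat -/(nu i) ltnn subnn nth_nseq ifT // subn_gt0 szT.
    exact: leq_trans H (dl i).
  have : (nth 0 (nth [::] T i.+1) (nu i) < N.+1)%N.
    by apply: (all_nthP 0%N (tableau_letters i.+1 tT)); rewrite szT.
  by rewrite E in lt1; rewrite ltnS leqNgt lt1.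
have hst_nu : hst D la nu by apply/forallP => i; rewrite hnu nula.
have dnu : dec nu by move=> i; apply: leq_trans (nula _) (hnu i).
have nth' i : nth [::] [seq [seq a <- r | (a < N)%N] | r <- T] i = [seq a <- nth [::] T i | (a < N)%N].
  case: (ltnP i (size T)) => iT; first by rewrite (nth_map [::]).
  by rewrite !nth_default ?size_map.
exists (mkdiag D nu), [seq [seq a <- r | (a < N)%N] | r <- T]; split.
- by rewrite mem_enum inE nuK.
- apply/IH; rewrite nuK //.
  + by move=> i; apply: leq_trans (nula i) (lD i).
  + by move=> i /l0 E; apply/eqP; rewrite -leqn0 -E.
  split.
  + apply: (@eq_from_nth _ 0%N); rewrite !size_map ?size_iota ?sT // => i il.
    by rewrite (nth_map [::]) ?size_map ?sT // nth' nth_mkseq.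
  + by apply/(all_nthP [::]) => i _; rewrite nth'; apply/sorted_filter/(tableau_sorted i tT)/leq_trans.
  + move=> i j; rewrite !nth' -/(nu i.+1) => ji.
    have jT : (j < size (nth [::] T i.+1))%N by rewrite szT; apply: leq_trans ji (nula _).
    have nthf k : (j < nu k)%N ->
        nth 0%N [seq a <- nth [::] T k | (a < N)%N] j = nth 0%N (nth [::] T k) j.
      by move=> jk; rewrite [in RHS]rsE nth_cat -/(nu k) jk.
    rewrite !nthf //; last by apply: leq_trans ji (leq_trans (nula _) (hnu i)).
    by case: tT => _ _ cT _; apply: (cT i j).
  + by apply/(all_nthP [::]) => i _; rewrite nth'; apply: filter_all.
apply: (@eq_from_nth _ [::]); rewrite ?size_mkseq // => i; rewrite sT => il.
by rewrite nth_mkseq // nth' nuK {1}rsE szT.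
Qed.

Lemma tableaux_uniq N l la : supp D la -> dec la -> (forall i, (la i <= D)%N) ->
  (forall i, (l <= i)%N -> la i = 0%N) -> uniq (tableaux N l la).
Proof.
elim: N la => [|N IH] la sl dl lD l0 /=; first by case: ifP.
have nu0 (nu : diagram D) : hst D la (rowlen nu) -> forall i, (l <= i)%N -> rowlen nu i = 0%N.
  move=> s i /l0 E; case: (ltnP D i) => Di; first by rewrite rowlen_out.
  have := @strip_le D true _ _ s (Ordinal (Di : (i < D.+1)%N)).
  by rewrite /= E leqn0 => /eqP.
have nuD (nu : diagram D) i : (rowlen nu i <= D)%N.
  case: (ltnP D i) => Di; first by rewrite rowlen_out.
  by have := rowlenE nu (Ordinal (Di : (i < D.+1)%N)) => /= ->; rewrite -ltnS.
apply: allpairs_uniq_dep; first exact: enum_uniq.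
  move=> nu; rewrite mem_enum inE => s; apply: IH => //; try exact: supp_rowlen.
    exact: (@strip_dec D true _ _ s).
  exact: nu0.
move=> x y /allpairsPdep[nu [T [+ + ->]]]; rewrite mem_enum inE => s tT.
move=> /allpairsPdep[nu' [T' [+ + ->]]]; rewrite mem_enum inE => s' tT' /= E.
have dnu := @strip_dec D true _ _ s; have dnu' := @strip_dec D true _ _ s'.
move/(mem_tableaux _ _ (@supp_rowlen D _) dnu (nuD _) (nu0 _ s)): tT => tT.
move/(mem_tableaux _ _ (@supp_rowlen D _) dnu' (nuD _) (nu0 _ s')): tT' => tT'.
have TT : T = T'.
  apply: (@eq_from_nth _ [::]); rewrite ?(tableau_size tT) ?(tableau_size tT') // => i il.
  have := congr1 (fun U => [seq a <- nth [::] U i | (a < N)%N]) E.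
  by rewrite !nth_mkseq // !filter_add ?(tableau_letters _ tT) ?(tableau_letters _ tT').
have -> : nu = nu'.
  apply: rowlen_inj; apply/funext => i.
  by rewrite -(tableau_row i (nu0 _ s) tT) -(tableau_row i (nu0 _ s') tT') TT.
by rewrite TT.
Qed.

Lemma sum_tableaux (R : comNzRingType) N l la : supp D la -> dec la -> (forall i, (la i <= D)%N) ->
  (forall i, (l <= i)%N -> la i = 0%N) ->
  \sum_(T <- tableaux N l la) xmon R (flatten T) = spoly D true (xvars R N) la.
Proof.
elim: N la => [|N IH] la sl dl lD l0 /=.
  case: ifP => _; last by rewrite big_nil.
  rewrite big_seq1 sone_def; congr (xmon R _); by elim: (l).
have nu0 (nu : diagram D) : hst D la (rowlen nu) -> forall i, (l <= i)%N -> rowlen nu i = 0%N.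
  move=> s i /l0 E; case: (ltnP D i) => Di; first by rewrite rowlen_out.
  have := @strip_le D true _ _ s (Ordinal (Di : (i < D.+1)%N)).
  by rewrite /= E leqn0 => /eqP.
have nuD (nu : diagram D) i : (rowlen nu i <= D)%N.
  case: (ltnP D i) => Di; first by rewrite rowlen_out.
  by have := rowlenE nu (Ordinal (Di : (i < D.+1)%N)) => /= ->; rewrite -ltnS.
rewrite big_allpairs_dep /= big_enum; apply: eq_big => // nu.
rewrite inE => s.
have dnu := @strip_dec D true _ _ s.
rewrite -IH //; [|exact: supp_rowlen|exact: nu0].
rewrite mulr_sumr big_seq [RHS]big_seq; apply: eq_bigr => T.
move/(mem_tableaux _ _ (@supp_rowlen D _) dnu (nuD _) (nu0 _ s)) => tT.
have nula := @strip_le D true _ _ s.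
rewrite wtE // xvarX xmonM /xmon.
suff -> : seq_mset (flatten (add_letter N l la (rowlen nu) T)) =
  seq_mset (nseq (sz D la - sz D (rowlen nu)) N ++ flatten T) by [].
apply/msetP => a.
rewrite !mset_seqE count_cat !count_flatten !sumn_map count_nseq.
rewrite /add_letter /mkseq !big_map.
under eq_bigr do rewrite count_cat count_nseq.
rewrite big_split addnC /= -big_distrr /=. rewrite addnC [RHS]addnC; congr (_ * _ + _)%N.
  rewrite -{1}(subn0 l) -/(index_iota 0 l) big_mkord.
  have E k : (\sum_(i < l + k) (la i - rowlen nu i) = \sum_(i < l) (la i - rowlen nu i))%N.
    by rewrite big_split_ord /= [X in (_ + X)%N]big1 ?addn0 // => i _; rewrite l0 ?leq_addr.
  have E' k : (\sum_(i < D.+1 + k) (la i - rowlen nu i) = \sum_(i < D.+1) (la i - rowlen nu i))%N.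
    by rewrite big_split_ord /= [X in (_ + X)%N]big1 ?addn0 // => i _; rewrite sl ?leq_addr.
  rewrite -(E D.+1) addnC E' sumnB //.
have -> : T = [seq nth [::] T i | i <- iota 0 l].
  by rewrite -{1}(tableau_size tT) map_nth_iota0 // take_size.
rewrite big_map; apply: eq_big_seq => i; rewrite mem_iota => /andP[_ il].
by rewrite (nth_map 0%N) ?size_iota // nth_iota.
Qed.

Lemma part_dec (la : seq nat) : is_part la -> dec (nth 0%N la).
Proof.
move=> /andP[sla _] i; case: (ltnP i.+1 (size la)) => il; last by rewrite nth_default.
by have /(sortedP 0%N)/(_ i il) := sla.
Qed.

Lemma nth_le_sumn (la : seq nat) i : (nth 0%N la i <= sumn la)%N.
Proof. elim: la i => [|a la IH] [|i] //=; rewrite ?leq_addr // (leq_trans (IH i)) ?leq_addl //. Qed.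

Lemma size_le_sumn (la : seq nat) : 0%N \notin la -> (size la <= sumn la)%N.
Proof. by elim: la => //= a la IH; rewrite inE negb_or => /andP[a0 /IH]; lia. Qed.

Lemma part_supp (la : seq nat) : is_part la -> (sumn la <= D)%N -> supp D (nth 0%N la).
Proof.
move=> /andP[_ la0] sD i Di; rewrite nth_default //.
by apply: leq_trans (size_le_sumn la0) _; apply: leq_trans sD (ltnW Di).
Qed.

Lemma sz_part (la : seq nat) : is_part la -> (sumn la <= D)%N -> sz D (nth 0%N la) = sumn la.
Proof.
move=> pl sD; have sl : (size la <= D)%N.
  by case/andP: pl => _ /size_le_sumn sz; apply: leq_trans sz sD.
rewrite sumnE (big_nth 0%N) big_mkord /sz -(subnKC (leqW sl)) big_split_ord /=.
by rewrite [X in (_ + X)%N]big1 ?addn0 // => i _; rewrite nth_default ?leq_addr.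
Qed.

Lemma trunc_schur (F : fieldType) N (la : seq nat) : is_part la -> (sumn la <= D)%N ->
  trunc N (schur F la) = spoly D true (xvars F N) (nth 0%N la).
Proof.
move=> pl sD; have sl := part_supp pl sD; have dl := part_dec pl.
have bl i : (nth 0%N la i <= D)%N by apply: leq_trans (nth_le_sumn la i) sD.
have l0 i : (size la <= i)%N -> nth 0%N la i = 0%N by move=> H; rewrite nth_default.
rewrite -(sum_tableaux F N sl dl bl l0); apply/funext => m; rewrite ssumE.
have mem T := mem_tableaux N T sl dl bl l0.
rewrite /trunc; case: ifP => mN; last first.
  rewrite big1_seq // => T /= /mem[_ _ _ tT]; rewrite xmonE.
  case: eqP => // E; case/negP: mN; rewrite E letters_lt_seq.
  by apply/allP => a /flattenP[r rT ar]; apply: (allP (allP tT r rT)).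
rewrite /schur (fsbigE (tableaux N (size la) (nth 0%N la))) ?tableaux_uniq //.
- rewrite big_seq_cond [RHS]big_seq_cond; apply: eq_bigl => T; rewrite andbT.
  case: (boolP (T \in _)) => //= /mem[E s1 s2 _]; apply/asboolP.
  by split; rewrite // E mkseq_nth.
- by move=> T /= /mem[E s1 s2 _]; split; rewrite // E mkseq_nth.
- move=> T /= [E s1 s2] Tn; rewrite xmonE; case: eqP => // mE; case/negP: Tn.
  apply/mem; split; rewrite ?mkseq_nth //.
  move: mN; rewrite mE letters_lt_seq => /allP H; apply/allP => r rT; apply/allP => a ar.
  by apply: H; apply/flattenP; exists r.
Qed.
End Tableaux.

(** * Triangularity of Schur functions *)

Section Dominance.
Implicit Types (la mu nu : seq nat).

Lemma pexcess_cons c a la : pexcess c (a :: la) = ((a - c) + pexcess c la)%N.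
Proof. by rewrite /pexcess big_cons. Qed.

Lemma pexcess0 la : pexcess 0 la = sumn la.
Proof. by rewrite /pexcess sumnE; apply: eq_bigr => i _; rewrite subn0. Qed.

Lemma sumn_take_excess K c la : (sumn (take K la) <= pexcess c la + K * c)%N.
Proof.
elim: K la => [|K IH] [|a la]; rewrite ?take0 //= pexcess_cons mulSn.
by have := IH la; lia.
Qed.

(** The case of equality in [sumn_take_excess], K being the number of parts larger than c. Together
    they translate dominance of partial sums into inequalities between excesses. *)
Lemma sumn_take_excess_part c la : sorted geq la ->
  sumn (take (count (ltn c) la) la) = (pexcess c la + count (ltn c) la * c)%N.
Proof.
have tr : transitive geq by move=> x y z yx xz; apply: leq_trans yx.
elim: la => [|a la IH] sl //=; first by rewrite /pexcess big_nil.
have {}IH := IH (path_sorted sl); rewrite pexcess_cons.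
case: (ltnP c a) => ca /=; first by rewrite IH; lia.
have c0 : count (ltn c) la = 0%N.
  apply/eqP; rewrite -leqn0 leqNgt -has_count; apply/hasPn => x xl /=.
  by rewrite -leqNgt; apply: leq_trans ca; apply: (allP (order_path_min tr sl)).
by move: IH; rewrite c0 /= take0 /= !add0n; lia.
Qed.

Lemma excess_dominating mu la : sorted geq mu -> dominating mu la ->
  forall c, (pexcess c mu <= pexcess c la)%N.
Proof.
move=> smu [_ _ H] c; have := H (count (ltn c) mu).
rewrite sumn_take_excess_part // => /leq_trans/(_ (sumn_take_excess _ c _)).
by rewrite leq_add2r.
Qed.

Lemma pexcess_step c la : pexcess c la = (pexcess c.+1 la + count (ltn c) la)%N.
Proof. by elim: la => [|a la IH]; rewrite ?[pexcess _ [::]]big_nil //= !pexcess_cons IH /=; lia. Qed.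

Lemma pexcess_large c la : (sumn la <= c)%N -> pexcess c la = 0%N.
Proof.
move=> sc; rewrite /pexcess big_seq big1 // => a al; apply/eqP; rewrite subn_eq0.
apply: leq_trans sc; rewrite sumnE (big_rem a) //= leq_addr //.
Qed.

Lemma pexcess_inj la mu : is_part la -> is_part mu ->
  (forall c, pexcess c la = pexcess c mu) -> la = mu.
Proof.
move=> pl pm E; apply: part_perm_eq => //.
have C c : count (ltn c) la = count (ltn c) mu.
  by have := pexcess_step c la; rewrite E E pexcess_step; lia.
have /andP[_ l0] := pl; have /andP[_ m0] := pm.
have Ca c nu : 0%N \notin nu -> count_mem c nu =
    (if c is c'.+1 then count (ltn c') nu - count (ltn c) nu else 0)%N.
  case: c => [/count_memPn //|c _].
  have -> : count (ltn c) nu = (count (ltn c.+1) nu + count_mem c.+1 nu)%N.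
    by elim: nu => //= a nu ->; case: ltngtP; lia.
  by rewrite addKn.
by apply/allP => a _ /=; rewrite !Ca //; case: a => // a; rewrite !C.
Qed.

(** A number strictly monotone for dominance, as [triangular_indep] requires. *)
Definition pmeasure la : nat := (\sum_(c < sumn la) pexcess c la)%N.

Lemma pmeasure_lt la mu : is_part la -> is_part mu -> sumn la = sumn mu ->
  (forall c, (pexcess c mu <= pexcess c la)%N) -> la = mu \/ (pmeasure mu < pmeasure la)%N.
Proof.
move=> pl pm E H; have [all_eq|] := pselect (forall c, pexcess c la = pexcess c mu).
  by left; apply: pexcess_inj.
move=> /existsNP[c /eqP ne]; right; rewrite /pmeasure E.
have cs : (c < sumn mu)%N.
  by rewrite ltnNge; apply: contra ne => sc; rewrite !pexcess_large // E.
rewrite (bigD1 (Ordinal cs)) //= [X in (_ < X)%N](bigD1 (Ordinal cs)) //= -addSn.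
by apply: leq_add; [rewrite ltn_neqAle eq_sym ne H | apply: leq_sum => i _].
Qed.

Lemma conj_part_sorted mu : sorted geq (conj_part mu).
Proof.
apply/(sortedP 0%N) => i; rewrite size_map size_iota => ih.
rewrite !(nth_map 0%N) ?size_iota ?(ltnW ih) // !nth_iota ?(ltnW ih) // /=.
by apply: sub_count => a; apply: ltnW.
Qed.

(** Both sides count the cells of the diagram of mu in the rows after the first K, by columns and by
    rows. *)
Lemma pexcess_conj K mu : is_part mu -> pexcess K (conj_part mu) = sumn (drop K mu).
Proof.
move=> /andP[smu _].
have tr : transitive geq by move=> x y z yx xz; apply: leq_trans yx.
have cnt i : (count (ltn i) mu - K = count (ltn i) (drop K mu))%N.
  rewrite -{1}(cat_take_drop K mu) count_cat.
  have [c0|] := posnP (count (ltn i) (drop K mu)).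
    rewrite c0 addn0; apply/eqP; rewrite subn_eq0.
    by apply: leq_trans (count_size _ _) _; rewrite size_take_min geq_minl.
  rewrite -has_count => /hasP[x xd xi].
  have Kmu : (K < size mu)%N by rewrite ltnNge; apply/negP => /drop_oversize E; rewrite E in xd.
  suff -> : count (ltn i) (take K mu) = K by rewrite addKn.
  rewrite -[RHS](size_takel (ltnW Kmu)); apply/eqP; rewrite -all_count; apply/allP => y yt /=.
  move: smu; rewrite (sorted_pairwise tr) -{1}(cat_take_drop K mu) pairwise_cat.
  by case/andP=> /allrelP/(_ y x yt xd) /= xy _; apply: leq_trans xi xy.
rewrite /pexcess /conj_part big_map; under eq_bigr do rewrite cnt.
have le_head a : a \in drop K mu -> (a <= head 0 mu)%N.
  move=> /mem_drop; case: (mu) smu => //= b nu sb; rewrite inE => /orP[/eqP-> //|].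
  by apply: (allP (order_path_min tr sb)).
elim: (drop K mu) le_head => [|a nu IH] le_head /=; first by rewrite big1.
rewrite big_split /= IH; last by move=> b bn; apply: le_head; rewrite inE bn orbT.
congr (_ + _)%N; rewrite -{1}(subn0 (head 0%N mu)) -/(index_iota 0 _) big_mkord.
have ah : (a <= head 0 mu)%N by apply: le_head; rewrite inE eqxx.
rewrite -[RHS](minn_idPl ah).
elim: (head _ _) => [|h IHh]; first by rewrite big_ord0 minn0.
by rewrite big_ord_recr /= IHh; lia.
Qed.

End Dominance.

Section SchurCoefficients.
Variables (D : nat) (R : comNzRingType).
Implicit Types (la : nat -> nat) (m : monom).

Lemma xvarXM_neq0 N k (f : series R) m : (xvar R N ^+ k * f) m != 0 ->
  (k <= m N)%N /\ f (msetB m (msetn k N)) != 0.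
Proof. by rewrite xvarXM; case: ifP; rewrite ?eqxx. Qed.

Lemma spoly_coef_step b N la m : spoly D b (xvars R N.+1) la m != 0 ->
  exists nu : diagram D, [/\ strip D b la (rowlen nu), (sz D la - sz D (rowlen nu) <= m N)%N &
    spoly D b (xvars R N) (rowlen nu) (msetB m (msetn (sz D la - sz D (rowlen nu))%N N)) != 0].
Proof.
rewrite /= ssumE => H.
have [nu s nz] : exists2 nu : diagram D, strip D b la (rowlen nu) &
    (wt D (xvar R N) la (rowlen nu) * spoly D b (xvars R N) (rowlen nu)) m != 0.
  apply/exists_inP; apply: contraNT H => /exists_inPn H; rewrite big1 // => nu /H.
  by rewrite negbK => /eqP.
exists nu; rewrite wtE in nz; last exact: (strip_le s).
by have [] := xvarXM_neq0 nz.
Qed.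

Lemma spoly_coef_step_full b N la m (k := fun nu : diagram D => (sz D la - sz D (rowlen nu))%N) :
  spoly D b (xvars R N.+1) la m != 0 ->
  (forall nu m', spoly D b (xvars R N) nu m' != 0 -> letters_lt N m') ->
  exists nu : diagram D, [/\ strip D b la (rowlen nu), k nu = m N, letters_lt N.+1 m,
    spoly D b (xvars R N) (rowlen nu) (msetB m (msetn (k nu) N)) != 0 &
    forall i, (i < N)%N -> msetB m (msetn (k nu) N) i = m i].
Proof.
move=> /spoly_coef_step[nu [s km nz]] L; exists nu; have mN := letters_ltP _ _ (L _ _ nz).
have kE : k nu = m N.
  apply/eqP; rewrite eqn_leq km leqNgt /=; apply/negP => H.
  have := mN N; rewrite ltnn => F; have: false by apply: F; rewrite -mset_gt0 msetE2 msetnxx subn_gt0.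
  by [].
have other i : i != N -> msetB m (msetn (k nu) N) i = m i.
  by move=> iN; rewrite msetE2 msetnE (negbTE iN) subn0.
split=> // [|i iN]; last by rewrite other // ltn_eqF.
apply/letters_ltP => a; case: (eqVneq a N) => [->|aN]; first by [].
by rewrite -mset_gt0 -(other a aN) mset_gt0 => /mN/leqW.
Qed.

Lemma spoly_letters b N la m : spoly D b (xvars R N) la m != 0 -> letters_lt N m.
Proof.
elim: N la m => [|N IH] la m.
  rewrite /=; case: forallP => _; last by rewrite mulr0n szeroE eqxx.
  rewrite mulr1n sone_def xmonE; case: (m =P _) => [-> _|_]; last by rewrite eqxx.
  by rewrite letters_lt_seq.
by move=> /spoly_coef_step_full/(_ (fun nu m' => @IH nu m')) [nu []].
Qed.

(** N variables fill at most N rows. Each of these rows is bounded by its excess over c plus c,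
    which gives the last claim for K = N; for smaller K it comes from the subshape filled by the
    first variables. *)
Lemma spoly_coef_true N la m : spoly D true (xvars R N) la m != 0 ->
  [/\ (\sum_(i < N) m i = sz D la)%N, forall j, (N <= j <= D)%N -> la j = 0%N &
      forall K c, (K <= N)%N -> (\sum_(i < K) m i <= excess D c la + K * c)%N].
Proof.
elim: N la m => [|N IH] la m.
  rewrite /=; case: forallP => [z _|_]; last by rewrite mulr0n szeroE eqxx.
  have la0 j : (j <= D)%N -> la j = 0%N.
    by move=> jD; have /eqP := z (Ordinal (jD : (j < D.+1)%N)).
  split=> [|j /la0 //|[|K] c //]; last by rewrite big_ord0.
  by rewrite big_ord0 /sz big1 // => i _; apply: la0; rewrite -ltnS.
move=> /spoly_coef_step_full/(_ (@spoly_letters true N)) [nu [s kE mN nz other]].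
have [s1 s2 s3] := IH _ _ nz; have le := strip_le s; have sle := sz_le le.
have sm K : (K <= N)%N -> (\sum_(i < K) m i = \sum_(i < K)
    (msetB m (msetn (sz D la - sz D (rowlen nu))%N N)) i)%N.
  by move=> KN; apply: eq_bigr => i _; rewrite other // (leq_trans _ KN).
have tot : (\sum_(i < N.+1) m i = sz D la)%N.
  by rewrite big_ord_recr /= sm // s1 -kE subnKC.
have la0 j : (N < j <= D)%N -> la j = 0%N.
  case: j => // j /andP[Nj jD]; apply/eqP; rewrite -leqn0.
  have jD' : (j < D.+1)%N by lia.
  have /forallP/(_ (Ordinal jD'))/andP[/= H _] := s.
  by rewrite -(s2 j) //; apply/andP; split; lia.
split=> // K c; rewrite leq_eqVlt => /orP[/eqP->|]; last first.
  rewrite ltnS => KN; rewrite sm //; apply: leq_trans (s3 K c KN) _.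
  by rewrite leq_add2r; apply: leq_sum => i _; apply: leq_sub2r.
rewrite tot; have -> : (N.+1 * c = \sum_(i < N.+1) c)%N by rewrite sum_nat_const card_ord.
apply: (@leq_trans (excess D c la + \sum_(j < D.+1 | (j < N.+1)%N) c)%N).
  rewrite /sz /excess [X in (_ <= _ + X)%N]big_mkcond -big_split /=; apply: leq_sum => j _.
  case: ltnP => jN; first by lia.
  by rewrite la0 // jN -ltnS ltn_ord.
rewrite leq_add2l; case: (leqP N.+1 D.+1) => ND.
  by rewrite big_ord_narrow.
rewrite big_mkcond; apply: (@leq_trans (\sum_(i < D.+1) c)%N).
  by apply: leq_sum => i _; case: ifP.
by rewrite !sum_nat_const !card_ord leq_mul2r (ltnW ND) orbT.
Qed.

(** Each variable takes at most one cell of a row, so the first K variables cover at most K cells of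
    it and the others have to cover its excess over K. *)
Lemma spoly_coef_false N la m K : spoly D false (xvars R N) la m != 0 ->
  (\sum_(i < N) m i = sz D la)%N /\
  (excess D (minn K N) la <= \sum_(i < N | (K <= i)%N) m i)%N.
Proof.
elim: N la m => [|N IH] la m.
  rewrite /=; case: forallP => [z _|_]; last by rewrite mulr0n szeroE eqxx.
  by rewrite minn0 !big_ord0 /sz /excess !big1 // => i _; rewrite ?subn0; apply/eqP/z.
move=> /spoly_coef_step_full/(_ (@spoly_letters false N)) [nu [s kE mN nz other]].
have [s1 s2] := IH _ _ nz; have le := strip_le s; have sle := sz_le le.
split.
  rewrite big_ord_recr /= -kE -[RHS](subnKC sle) -s1; congr (_ + _)%N.
  by apply: eq_bigr => i _; rewrite other.
have -> : (\sum_(i < N.+1 | (K <= i)%N) m i = \sum_(i < N | (K <= i)%N) m i + (if (K <= N)%N then m N else 0))%N.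
  by rewrite big_mkcond big_ord_recr /= -big_mkcond.
have -> : (\sum_(i < N | (K <= i)%N) m i =
    \sum_(i < N | (K <= i)%N) (msetB m (msetn (sz D la - sz D (rowlen nu))%N N)) i)%N.
  by apply: eq_bigr => i _; rewrite other.
have /and3P[_ _ /forallP V] := s.
case: (leqP K N) => KN; last first.
  rewrite addn0; apply: leq_trans s2; rewrite (minn_idPr KN) (minn_idPr (ltnW KN)).
  by apply: leq_sum => i _; have /andP[_] := V i; lia.
rewrite (minn_idPl (leqW KN)); rewrite (minn_idPl KN) in s2.
rewrite -kE; apply: leq_trans (leq_add s2 (leqnn _)).
rewrite /sz -sumnB // /excess -big_split /=; apply: leq_sum => i _.
by have /andP[? _] := V i; lia.
Qed.

End SchurCoefficients.

Section SchurSeries.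
Variable F : fieldType.
Hypothesis char0 : forall n, n.+1%:R != 0 :> F.
Implicit Types (la mu ka : seq nat).

Lemma content_monomE ka i : content_monom ka i = nth 0%N ka i.
Proof. by rewrite mset_seqE count_content_word. Qed.

Lemma content_letters ka : 0%N \notin ka -> letters_lt (size ka) (content_monom ka).
Proof.
move=> k0; rewrite letters_lt_seq; apply/allP => a.
by rewrite -mem_undup (perm_mem (perm_undup_content k0)) mem_iota.
Qed.

Lemma sum_content ka K : (\sum_(i < K) content_monom ka i = sumn (take K ka))%N.
Proof.
under eq_bigr do rewrite content_monomE.
elim: ka K => [|a ka IH] [|K]; rewrite ?big_ord0 //=.
  by rewrite big1 // => i _; rewrite nth_nil.
by rewrite big_ord_recl /= IH.
Qed.

Lemma excess_part D c la : is_part la -> (sumn la <= D)%N ->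
  excess D c (nth 0%N la) = pexcess c la.
Proof.
move=> pl sD; have sl : (size la <= D)%N.
  by case/andP: pl => _ /size_le_sumn sz; apply: leq_trans sz sD.
rewrite /pexcess (big_nth 0%N) big_mkord /excess -(subnKC (leqW sl)) big_split_ord /=.
by rewrite [X in (_ + X)%N]big1 ?addn0 // => i _; rewrite nth_default ?leq_addr.
Qed.

Lemma schur_coef_dom la ka : is_part la -> is_part ka ->
  schur F la (content_monom ka) != 0 ->
  sumn la = sumn ka /\ forall c, (pexcess c ka <= pexcess c la)%N.
Proof.
move=> pl pk; have /andP[sk k0] := pk.
rewrite -(truncE _ (content_letters k0)) (trunc_schur F _ pl (leqnn _)) => H.
have [E _ K] := spoly_coef_true H.
rewrite sum_content take_size sz_part // in E; split=> // c.
have := K (count (ltn c) ka) c (count_size _ _).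
by rewrite sum_content sumn_take_excess_part // excess_part // leq_add2r.
Qed.

Lemma schur_content_neq0 la : is_part la -> schur F la (content_monom la) != 0.
Proof.
move=> pl; have /andP[sl l0] := pl; set D := sumn la.
have dl := part_dec pl; have spl := part_supp pl (leqnn D).
have bl i : (nth 0%N la i <= D)%N by apply: nth_le_sumn.
have z i : (size la <= i)%N -> nth 0%N la i = 0%N by move=> H; rewrite nth_default.
rewrite -(truncE _ (content_letters l0)) (trunc_schur F _ pl (leqnn _)).
rewrite -(sum_tableaux F (size la) spl dl bl z) ssumE.
under eq_bigr do rewrite xmonE.
rewrite -natr_sum natr_neq0 // .
pose T0 := mkseq (fun i => nseq (nth 0%N la i) i) (size la).
have nthT i : nth [::] T0 i = nseq (nth 0%N la i) i.
  case: (ltnP i (size la)) => il; first by rewrite nth_mkseq.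
  by rewrite nth_default ?size_mkseq // nth_default.
have T0in : T0 \in tableaux D (size la) (size la) (nth 0%N la).
  apply/(mem_tableaux _ _ spl dl bl z); split.
  - by rewrite -map_comp; apply/eq_map => i /=; rewrite size_nseq.
  - apply/(all_nthP [::]) => i _; rewrite nthT.
    by apply: (@sorted_add [::] i) => //.
  - move=> i j; rewrite !nthT size_nseq => jl; rewrite !nth_nseq jl.
    by rewrite (leq_trans jl (dl i)).
  - apply/allP => r /mapP[i]; rewrite mem_iota => /andP[_ il] ->.
    by rewrite all_nseq il orbT.
rewrite (bigD1_seq T0) ?tableaux_uniq //=.
rewrite (_ : _ == _) //; apply/eqP; congr seq_mset; rewrite /T0 /content_word.
suff H s (u : seq nat) : content_from s u =
    flatten [seq nseq (nth 0%N u i) (s + i)%N | i <- iota 0 (size u)].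
  by rewrite H.
elim: u s => //= a u IH s; rewrite addn0 IH; congr (_ ++ flatten _).
by rewrite -[1%N]addn0 iotaDl -map_comp; apply: eq_map => i /=; rewrite addSnnS.
Qed.

Lemma schur_indep (L : seq (seq nat)) (c : seq nat -> F) : uniq L -> all is_part L ->
  \sum_(la <- L) c la *: schur F la = 0 -> forall la, la \in L -> c la = 0.
Proof.
move=> uL /allP pL; apply: (triangular_indep (mu := pmeasure) (x := content_monom)) => //.
  by move=> la /pL; apply: schur_content_neq0.
move=> la ka /pL pl /pL pk /(schur_coef_dom pl pk)[E H].
exact: pmeasure_lt.
Qed.

Lemma row_part_is_part n : is_part (row_part n).
Proof. by case: n. Qed.

Lemma content_row n : content_monom (row_part n) = msetn n 0%N.
Proof.
rewrite -seq_mset_nseq /content_monom /content_word.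
by case: n => //= n; rewrite cats0.
Qed.

Lemma pexcess_le c la : (pexcess c la <= sumn la - c)%N /\ (pexcess c la <= sumn la)%N.
Proof.
elim: la => [|a la [IH1 IH2]]; first by rewrite /pexcess big_nil.
by rewrite pexcess_cons /=; lia.
Qed.

Lemma schur_row_coef la n : is_part la ->
  schur F la (msetn n 0%N) = (la == row_part n)%:R.
Proof.
move=> pl; case: eqP => [->|ne]; last first.
  apply/eqP; apply: contra_notT ne; rewrite -content_row.
  move=> /(schur_coef_dom pl (row_part_is_part n))[E H].
  apply: (pexcess_inj pl (row_part_is_part n)) => c; apply/eqP.
  rewrite eqn_leq H andbT; apply: leq_trans (pexcess_le c la).1 _; rewrite E.
  by case: n {H E} => [|n] //=; rewrite pexcess_cons addn0 leq_addr.
have pr := row_part_is_part n; have sr : sumn (row_part n) = n by case: (n) => //= k; rewrite addn0.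
have L1 : letters_lt 1 (msetn n 0%N).
  by rewrite -seq_mset_nseq letters_lt_seq all_nseq orbT.
rewrite -(truncE _ L1) (trunc_schur F 1 pr (leqnn _)) sr /=.
rewrite (bigD1 (mkdiag n (fun=> 0%N))) /=; last first.
  rewrite mkdiagK //; apply/forallP => i; rewrite leq0n andbT.
  have rp j : nth 0%N (row_part n) j.+1 = 0%N by case: (n) => //= k; rewrite nth_nil.
  by rewrite rp.
rewrite big1 ?addr0 => [|nu /andP[_ ne]]; last first.
  case: forallP => H; last by rewrite mulr0n mulr0.
  by case/eqP: ne; apply/rowlen_inj; rewrite mkdiagK //; apply/funext => i;
    case: (ltnP n i) => ni; [rewrite rowlen_out | apply/eqP/(H (Ordinal (ni : (i < n.+1)%N)))].
rewrite mkdiagK //; case: forallP => [_|[]//]; rewrite mulr1n mulr1 wtE //.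
rewrite (sz_part pr) ?sr // [sz _ _]big1 // subn0 xvarX xmonE seq_mset_nseq eqxx //.
Qed.

(** s_(n) is the only Schur function containing x_1^n, and it does so with coefficient 1. The
    expansion of s_(n) that witnesses [hall] is arbitrary, so [bE] identifies it through
    independence, on an index list enlarged by (n). *)
Lemma hall_row_coef f n (c : F) : hall f (schur F (row_part n)) c -> f (msetn n 0%N) = c.
Proof.
move=> [l [a [b [[ul pl] fE sE ->]]]]; rewrite fE lincombE ssumE.
have /allP pl' := pl; rewrite lincombE in sE.
have bE la : la \in l -> b la = (la == row_part n)%:R.
  pose l' := undup (row_part n :: l); pose b' la := (if la \in l then b la else 0) - (la == row_part n)%:R.
  have ul' : uniq l' by apply: undup_uniq.
  have pl2 : all is_part l'.
    by apply/allP => ka; rewrite mem_undup inE => /orP[/eqP->|/pl' //]; apply: row_part_is_part.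
  have S0 : \sum_(ka <- l') b' ka *: schur F ka = 0.
    under eq_bigr do rewrite scalerBl; rewrite sumrB; apply/eqP; rewrite subr_eq0; apply/eqP.
    rewrite [RHS](bigD1_seq (row_part n)) ?mem_undup ?mem_head //= eqxx scale1r.
    rewrite [X in _ + X]big1 ?addr0 => [|ka /negbTE->]; last by rewrite scale0r.
    rewrite sE; under eq_bigr => ka _ do rewrite (fun_if (fun z => z *: schur F ka)) scale0r.
    rewrite -big_mkcond -big_filter; apply: perm_big; apply: uniq_perm => //.
      exact: filter_uniq.
    by move=> ka; rewrite mem_filter mem_undup inE; case: (ka \in l); rewrite ?orbT.
  move=> lal; have := schur_indep ul' pl2 S0 (la := la).
  rewrite mem_undup inE lal orbT => /(_ isT); rewrite /b' lal => /eqP.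
  by rewrite subr_eq0 => /eqP.
rewrite big_seq [RHS]big_seq; apply: eq_bigr => la lal.
by rewrite sscaleE bE // schur_row_coef // pl'.
Qed.

Lemma trunc_hser_rel N : hrel (xvars F N) (fun n => trunc N (hser F n)).
Proof.
move=> r; have := congr1 (trunc N) (elem_hser char0 r).
rewrite trunc_sum => E.
transitivity (\sum_(i < r.+1) trunc N ((-1) ^+ i *: elem F i * hser F (r - i))).
  apply: eq_bigr => i _; rewrite truncM truncZ trunc_elem; congr (_ * _).
  by rewrite -(signr_odd _ i) mulr_sign -(signr_odd _ i) scaler_sign.
rewrite E; case: eqP => _; rewrite ?mulr1n ?mulr0n ?trunc1 ?trunc0 //.
Qed.

Definition hprod nu : series F := \prod_(i <- nu) hser F i.
Definition eprod nu : series F := \prod_(i <- nu) elem F i.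

(** [G] is omega s_la: the sign twist of the power sums exchanges the two expansions of
    [spoly_expand] because it sends h_r to e_r. *)
Theorem schur_expand la : is_part la ->
  exists (l : seq (F * seq nat)) (G : series F),
  [/\ forall x, x \in l -> [/\ 0%N \notin x.2, sumn x.2 = sumn la &
         forall c, (pexcess c la <= pexcess c x.2)%N],
      schur F la = \sum_(x <- l) x.1 *: hprod x.2,
      pleth (fun i => (-1) ^+ i.-1) (schur F la) G &
      forall N, trunc N G = spoly (sumn la).+1 false (xvars F N) (nth 0%N la)].
Proof.
move=> pl; have sD := leqnSn (sumn la).
have [|l [lgood lsum]] := @spoly_expand _ F (series F) _ (part_supp pl sD) (part_dec pl).
  by rewrite sz_part.
have sE : schur F la = \sum_(x <- l) x.1 *: hprod x.2.
  apply: trunc_inj => N; rewrite (trunc_schur F N pl sD).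
  have [-> _] := lsum _ _ (trunc_hser_rel N); rewrite trunc_sum.
  by apply: eq_bigr => x _; rewrite truncZ trunc_prod.
exists l, (\sum_(x <- l) x.1 *: eprod x.2); split=> //.
- move=> x /lgood[x1 x2 x3]; split=> //; first by rewrite x2 sz_part.
  by move=> c; rewrite -(excess_part c pl sD).
- rewrite sE; apply: pleth_sum => x _; apply: plethZ; apply: pleth_prod => i.
  rewrite (hser_pexp char0) (elem_pexp char0); apply: (pleth_pexp char0) => j.
  by rewrite mulr1.
- move=> N; have [_ ->] := lsum _ _ (trunc_hser_rel N); rewrite trunc_sum.
  by apply: eq_bigr => x _; rewrite truncZ trunc_prod; congr (_ *: _); apply: eq_bigr => i _; rewrite trunc_elem.
Qed.

(** A monomial x^rho of omega s_la has rho <= la', and la >= mu' means la' <= mu. To avoid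
    conjugating la, the cells of rho after its first K rows are compared with the excess of la over
    K, and this with the cells of mu after its first K rows, where K counts the parts of rho larger
    than c. *)
Lemma omega_schur_dom la mu rho (G : series F) : is_part la -> is_part mu -> is_part rho ->
  dominating (conj_part mu) la ->
  (forall N, trunc N G = spoly (sumn la).+1 false (xvars F N) (nth 0%N la)) ->
  G (content_monom rho) != 0 -> forall c, (pexcess c rho <= pexcess c mu)%N.
Proof.
move=> pl pm pr dom GE; have /andP[sr r0] := pr.
rewrite -(truncE _ (content_letters r0)) GE => nz c.
pose K := count (ltn c) rho.
have [E1 E2] := spoly_coef_false K nz.
have KN : (K <= size rho)%N by apply: count_size.
rewrite (minn_idPl KN) excess_part // in E2.
rewrite sum_content take_size sz_part // in E1.
have D1 : (pexcess K (conj_part mu) <= pexcess K la)%N.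
  exact: (excess_dominating (conj_part_sorted mu) dom).
have E3 : (\sum_(i < size rho | (K <= i)%N) content_monom rho i = sumn (drop K rho))%N.
  have T := sum_content rho (size rho).
  rewrite take_size (bigID (fun i : 'I_(size rho) => (i < K)%N)) (big_ord_narrow KN) /= in T.
  rewrite sum_content in T.
  have S1 : sumn rho = (sumn (take K rho) + sumn (drop K rho))%N by rewrite -sumn_cat cat_take_drop.
  rewrite S1 in T; apply: (@addnI (sumn (take K rho))); rewrite -T; congr (_ + _)%N.
  by apply: eq_bigl => i; rewrite leqNgt.
rewrite E3 in E2; rewrite pexcess_conj // in D1.
have slm : sumn la = sumn mu.
  by have [_ -> _] := dom; rewrite -pexcess0 pexcess_conj // drop0.
have T1 := sumn_take_excess_part c sr; have T2 := sumn_take_excess K c mu.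
have S1 : sumn rho = (sumn (take K rho) + sumn (drop K rho))%N by rewrite -sumn_cat cat_take_drop.
have S2 : sumn mu = (sumn (take K mu) + sumn (drop K mu))%N by rewrite -sumn_cat cat_take_drop.
by rewrite -/K in T1; lia.
Qed.

End SchurSeries.

(** * Regularity at t = 1 *)

Lemma at_t1_tofrac (a : {poly {poly rat}}) : at_t1 (tofrac a) (tofrac a.[1]).
Proof. by exists a, 1; rewrite hornerC oner_neq0 !tofrac1 !divr1. Qed.

Lemma at_t1_poly (a : {poly {poly rat}}) (g : Qq) : g = tofrac a.[1] -> at_t1 (tofrac a) g.
Proof. by move=> ->; apply: at_t1_tofrac. Qed.

Lemma at_t1_q : at_t1 q_Qqt q_Qq.
Proof. by apply: at_t1_poly; rewrite hornerC. Qed.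

Lemma at_t1_t : at_t1 t_Qqt 1.
Proof. by apply: at_t1_poly; rewrite hornerX tofrac1. Qed.

Lemma at_t1_0 : at_t1 0 0.
Proof. by rewrite -[in X in at_t1 X]tofrac0; apply: at_t1_poly; rewrite horner0 tofrac0. Qed.

Lemma at_t1_1 : at_t1 1 1.
Proof. by rewrite -[in X in at_t1 X]tofrac1; apply: at_t1_poly; rewrite hornerC tofrac1. Qed.

Lemma tofrac_value_neq0 (b : {poly {poly rat}}) :
  b.[1] != 0 -> tofrac b != 0 :> Qqt /\ tofrac b.[1] != 0 :> Qq.
Proof.
move=> b1; split; rewrite tofrac_eq0 //.
by apply: contraNneq b1 => ->; rewrite horner0.
Qed.

(** Stated for a ring morphism into a field, this and the next two lemmas serve both for fractions
    in t and for their values at t = 1. *)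
Lemma rmorph_addf_div (R : comNzRingType) (K : fieldType) (phi : {rmorphism R -> K}) a b c d :
  phi b != 0 -> phi d != 0 ->
  phi a / phi b + phi c / phi d = phi (a * d + c * b) / phi (b * d).
Proof. by move=> nb nd; rewrite addf_div // rmorphD !rmorphM. Qed.

Lemma rmorph_mulf_div (R : comNzRingType) (K : fieldType) (phi : {rmorphism R -> K}) a b c d :
  phi a / phi b * (phi c / phi d) = phi (a * c) / phi (b * d).
Proof. by rewrite mulf_div !rmorphM. Qed.

Lemma rmorph_eqf_div (R : comNzRingType) (K : fieldType) (phi : {rmorphism R -> K}) a b c d :
  phi b != 0 -> phi d != 0 ->
  (phi a / phi b == phi c / phi d) = (phi (a * d) == phi (c * b)).
Proof. by move=> nb nd; rewrite eqr_div // !rmorphM. Qed.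

Lemma at_t1_D f g f' g' : at_t1 f f' -> at_t1 g g' -> at_t1 (f + g) (f' + g').
Proof.
move=> [a [b [b1 -> ->]]] [c [d [d1 -> ->]]].
have [nb nb'] := tofrac_value_neq0 b1; have [nd nd'] := tofrac_value_neq0 d1.
exists (a * d + c * b), (b * d); split; last 2 first.
- exact: (rmorph_addf_div (phi := @tofrac {poly {poly rat}}) _ _ nb nd).
- by rewrite (rmorph_addf_div (phi := @tofrac {poly rat}) _ _ nb' nd') hornerD !hornerM.
by rewrite hornerM mulf_neq0.
Qed.

Lemma at_t1_M f g f' g' : at_t1 f f' -> at_t1 g g' -> at_t1 (f * g) (f' * g').
Proof.
move=> [a [b [b1 -> ->]]] [c [d [d1 -> ->]]].
exists (a * c), (b * d); split; last 2 first.
- exact: (rmorph_mulf_div (@tofrac {poly {poly rat}})).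
- by rewrite (rmorph_mulf_div (@tofrac {poly rat})) !hornerM.
by rewrite hornerM mulf_neq0.
Qed.

Lemma at_t1_V f f' : at_t1 f f' -> f' != 0 -> at_t1 f^-1 f'^-1.
Proof.
move=> [a [b [b1 -> ->]]] ne.
have a1 : a.[1] != 0 by apply: contraNneq ne => ->; rewrite tofrac0 mul0r.
by exists b, a; rewrite !invf_div.
Qed.

Lemma at_t1_N f f' : at_t1 f f' -> at_t1 (- f) (- f').
Proof.
move=> [a [b [b1 -> ->]]]; exists (- a), b; rewrite hornerN !tofracN !mulNr.
by split.
Qed.

Lemma at_t1_B f g f' g' : at_t1 f f' -> at_t1 g g' -> at_t1 (f - g) (f' - g').
Proof. by move=> h1 /at_t1_N; apply: at_t1_D. Qed.

Lemma at_t1_X f f' i : at_t1 f f' -> at_t1 (f ^+ i) (f' ^+ i).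
Proof.
move=> h; elim: i => [|i IH]; first by rewrite !expr0; apply: at_t1_1.
by rewrite !exprS; apply: at_t1_M.
Qed.

Lemma at_t1_sum I (r : seq I) (P : pred I) f f' :
  (forall i, P i -> at_t1 (f i) (f' i)) ->
  at_t1 (\sum_(i <- r | P i) f i) (\sum_(i <- r | P i) f' i).
Proof. by move=> h; apply: (big_ind2 at_t1) => //; [apply: at_t1_0|move=> *; apply: at_t1_D]. Qed.

Lemma at_t1_prod I (r : seq I) (P : pred I) f f' :
  (forall i, P i -> at_t1 (f i) (f' i)) ->
  at_t1 (\prod_(i <- r | P i) f i) (\prod_(i <- r | P i) f' i).
Proof. by move=> h; apply: (big_ind2 at_t1) => //; [apply: at_t1_1|move=> *; apply: at_t1_M]. Qed.

Lemma at_t1_nat i : at_t1 i%:R i%:R.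
Proof.
elim: i => [|i IH]; first exact: at_t1_0.
by rewrite -!natr1; apply: at_t1_D => //; apply: at_t1_1.
Qed.

Lemma at_t1_fun f g g' : at_t1 f g -> at_t1 f g' -> g = g'.
Proof.
move=> [a [b [b1 -> ->]]] [c [d [d1 e ->]]].
have [nb nb'] := tofrac_value_neq0 b1; have [nd nd'] := tofrac_value_neq0 d1.
move/eqP: e; rewrite (rmorph_eqf_div (phi := @tofrac {poly {poly rat}}) _ _ nb nd) tofrac_eq => /eqP e.
by apply/eqP; rewrite (rmorph_eqf_div (phi := @tofrac {poly rat}) _ _ nb' nd') -!hornerM e.
Qed.

Lemma Qq_char0 i : i.+1%:R != 0 :> Qq.
Proof.
by rewrite -(rmorph_nat (@tofrac {poly rat})) tofrac_eq0 -polyC_natr polyC_eq0 Num.Theory.pnatr_eq0.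
Qed.

Lemma Qqt_char0 i : i.+1%:R != 0 :> Qqt.
Proof.
by rewrite -(rmorph_nat (@tofrac {poly {poly rat}})) tofrac_eq0 -!polyC_natr !polyC_eq0 Num.Theory.pnatr_eq0.
Qed.

Lemma one_sub_Xn_neq0 (R : nzRingType) i : 1 - 'X ^+ i.+1 != 0 :> {poly R}.
Proof.
apply/eqP => /(congr1 (fun p : {poly R} => p`_0)) /eqP.
by rewrite coefB coef1 coefXn coef0 subr0 oner_eq0.
Qed.

Lemma Qq_q1 i : 1 - q_Qq ^+ i.+1 != 0.
Proof. by rewrite -tofracXn -tofrac1 -tofracB tofrac_eq0 one_sub_Xn_neq0. Qed.

Lemma Qqt_q1 i : 1 - q_Qqt ^+ i.+1 != 0.
Proof.
by rewrite -tofracXn -tofrac1 -tofracB tofrac_eq0 -polyC_exp -polyCB polyC_eq0 one_sub_Xn_neq0.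
Qed.

Lemma Qqt_t1 i : 1 - t_Qqt ^+ i.+1 != 0.
Proof. by rewrite -tofracXn -tofrac1 -tofracB tofrac_eq0 one_sub_Xn_neq0. Qed.

Lemma fraction_quotient (R : idomainType) (f : {fraction R}) :
  exists u v : R, v != 0 /\ f = tofrac u / tofrac v.
Proof.
elim/quotW: f => x; exists \n_x, \d_x; split; first exact: denom_ratioP.
apply: (canRL (mulfK _)); first by rewrite tofrac_eq0 denom_ratioP.
unlock tofrac; rewrite -[LHS]FracField.pi_mul; apply/eqmodP/eqP.
by rewrite /= /FracField.mulf !numden_Ratio ?mulf_neq0 ?denom_ratioP ?oner_neq0 // !mulr1 mulrC.
Qed.

Lemma common_denominator (T : eqType) (L : seq T) (A : T -> Qqt) :
  exists (d : {poly {poly rat}}) (a : T -> {poly {poly rat}}),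
    d != 0 /\ {in L, forall x, A x = tofrac (a x) / tofrac d}.
Proof.
elim: L => [|y L [d [a [d0 h]]]]; first by exists 1, (fun=> 0); rewrite oner_neq0.
have [u [v [v0 e]]] : exists u v : {poly {poly rat}}, v != 0 /\ A y = tofrac u / tofrac v.
  exact: fraction_quotient.
exists (d * v), (fun x => if x == y then u * d else a x * v).
split; first by rewrite mulf_neq0.
move=> x; rewrite inE; have [-> _|ne /= xL] := eqVneq x y.
  by rewrite e [d * v]mulrC !tofracM -mulf_div divff ?mulr1 ?tofrac_eq0.
by rewrite h // !tofracM -mulf_div divff ?mulr1 ?tofrac_eq0.
Qed.

(** As long as all values at 1 vanish, the whole family is divided by X - 1; the total size
    decreases. *)
Lemma divide_at1 (R : idomainType) (T : eqType) (L : seq T) (a : T -> {poly R}) :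
  has (fun x => a x != 0) L ->
  exists j (b : T -> {poly R}),
    {in L, forall x, a x = b x * ('X - 1%:P) ^+ j} /\ has (fun x => (b x).[1] != 0) L.
Proof.
have [d] := ubnP (\sum_(x <- L) size (a x)); elim: d a => // d IH a sd ha.
have [h|/hasPn h] := boolP (has (fun x => (a x).[1] != 0) L).
  by exists 0%N, a; split => // x _; rewrite expr0 mulr1.
have [c rc] : exists c : T -> {poly R}, forall x, x \in L -> a x = c x * ('X - 1%:P).
  suff /choice [c hc] : forall x, exists y, x \in L -> a x = y * ('X - 1%:P) by exists c.
  move=> x; have [xL|_] := boolP (x \in L); last by exists 0.
  have /factor_theorem [q ->] : root (a x) 1 by move: (h x xL); rewrite negbK.
  by exists q.
have sc x : x \in L -> a x != 0 -> size (a x) = (size (c x)).+1.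
  move=> xL ax0; have cx0 : c x != 0 by apply: contraNneq ax0 => c0; rewrite (rc x xL) c0 mul0r.
  by rewrite (rc x xL) (size_Mmonic cx0 (monicXsubC 1)) size_XsubC addn2.
have hc : has (fun x => c x != 0) L.
  have /hasP [x xL ax0] := ha; apply/hasP; exists x => //.
  by apply: contraNneq ax0 => c0; rewrite (rc x xL) c0 mul0r.
have [] := IH c _ hc.
  rewrite -ltnS; apply: leq_trans sd; rewrite ltnS; have /hasP [x xL ax0] := ha.
  rewrite (perm_big _ (perm_to_rem xL)) [in X in (_ <= X)%N](perm_big _ (perm_to_rem xL)) /=.
  rewrite !big_cons sc // addSn ltnS leq_add2l !big_seq; apply: leq_sum => y /mem_rem yL.
  have [a0|ay] := eqVneq (a y) 0; last by rewrite (sc y).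
  suff -> : c y = 0 by rewrite size_poly0.
  by apply/eqP; move: (rc y yL); rewrite a0 => /esym /eqP; rewrite mulf_eq0 polyXsubC_eq0 orbF.
move=> j [b [e hb]]; exists j.+1, b; split => // x xL.
by rewrite rc // e // exprSr mulrA.
Qed.

(** Nothing is known yet about the order of the coefficients of H_mu at t = 1. Up to a common scalar
    they become polynomials in t, and at least one of them survives there. *)
Lemma regular_multiple (T : eqType) (L : seq T) (A : T -> Qqt) :
  has (fun x => A x != 0) L ->
  exists (s : Qqt) (b : T -> {poly {poly rat}}),
    [/\ s != 0, {in L, forall x, A x = s * tofrac (b x)} & has (fun x => (b x).[1] != 0) L].
Proof.
have [d [a [d0 e]]] := common_denominator L A => hA.
have [|j [b [eb hb]]] := @divide_at1 _ _ L a.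
  have /hasP [x xL Ax] := hA; apply/hasP; exists x => //.
  by apply: contraNneq Ax => a0; rewrite e // a0 tofrac0 mul0r.
exists (tofrac (('X - 1%:P) ^+ j) / tofrac d), b; split => //.
  by rewrite mulf_neq0 ?invr_eq0 ?tofrac_eq0 ?expf_neq0 ?polyXsubC_eq0.
by move=> x xL; rewrite (e x xL) (eb x xL) tofracM -mulrA mulrC.
Qed.

(** * The second triangularity at t = 1 *)

(** Every monomial has exactly one sorted word, so each series lifts to words and products can be
    treated by [wsum_blk]. *)
Lemma wsum_sorted (R : comNzRingType) (G : series R) :
  wsum (fun u => (sorted leq u)%:R * G (seq_mset u)) = G.
Proof.
apply/funext => m; rewrite /wsum.
pose u := sort leq (enum_mset m).
have mu : m = seq_mset u by rewrite (eq_seq_msetP _ _ (permEl (perm_sort _ _))) seq_mset_id.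
have um : u \in words m by rewrite mem_words; apply/eqP.
rewrite (bigD1_seq u) ?words_uniq //= -mu sort_sorted ?mul1r; last exact: leq_total.
rewrite big1_seq ?addr0 // => v /andP[vu]; rewrite mem_words => /eqP mv.
case: (boolP (sorted leq v)) => [sv|]; last by rewrite mul0r.
case/eqP: vu; apply: (sorted_eq leq_trans anti_leq) => //.
  exact/sort_sorted/leq_total.
by apply/eq_seq_msetP; rewrite -mv.
Qed.

Section SortedBlocks.
Variable R : comNzRingType.
Implicit Type f : nat -> R.

Definition sorted_block f r (u : seq nat) : R :=
  (sorted leq u && (size u == r))%:R * \prod_(a <- undup u) f (count_mem a u).

Lemma sorted_block0 f r u : size u != r -> sorted_block f r u = 0.
Proof. by rewrite /sorted_block => /negbTE->; rewrite andbF mul0r. Qed.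

(** In [sorted_block] each distinct letter of a block contributes one value of f. This number is
    therefore the power of 1 - t carried by the word. *)
Fixpoint block_letters (T : eqType) (rs : seq nat) (u : seq T) : nat :=
  if rs is r :: rs' then size (undup (take r u)) + block_letters rs' (drop r u) else 0.

Lemma blk_sorted_scale s f rs u :
  blk (sorted_block (fun i => s * f i)) rs u =
  s ^+ block_letters rs u * blk (sorted_block f) rs u.
Proof.
elim: rs u => [|r rs IH] u /=; first by rewrite expr0 mul1r.
rewrite IH exprD /sorted_block big_split /= big_const_seq count_predT iter_mulr_1.
move: (_ && _)%:R (_ ^+ _) (_ ^+ _) (\prod_(_ <- _) _) (blk _ _ _) => b x y P B; ring.
Qed.

Lemma block_letters_ge_undup (rs u : seq nat) f : blk (sorted_block f) rs u != 0 ->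
  (size (undup u) <= block_letters rs u)%N.
Proof.
elim: rs u => [|r rs IH] u /=; first by case: u => //=; rewrite eqxx.
move=> h; have /IH : blk (sorted_block f) rs (drop r u) != 0.
  by apply: contraNneq h => ->; rewrite mulr0.
move=> h'; apply: leq_trans (leq_add (leqnn _) h'); rewrite -size_cat.
apply: uniq_leq_size; first exact: undup_uniq.
by move=> x; rewrite mem_cat !mem_undup -mem_cat cat_take_drop.
Qed.

(** Each block contains at least one letter. In the case of equality all blocks are constant: these
    are the words that occur in a product of power sums. *)
Lemma block_letters_const (rs u : seq nat) f : 0%N \notin rs -> blk (sorted_block f) rs u != 0 ->
  (size rs <= block_letters rs u)%N /\
  (block_letters rs u = size rs ->
   blk (const_word R) rs u != 0 /\ blk (sorted_block f) rs u = \prod_(r <- rs) f r).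
Proof.
elim: rs u => [|r rs IH] u /=; first by rewrite big_nil; case: u => //=; rewrite eqxx.
rewrite inE negb_or => /andP[r0 rs0] h.
have /(IH _ rs0) [h1 h2] : blk (sorted_block f) rs (drop r u) != 0.
  by apply: contraNneq h => ->; rewrite mulr0.
have hs : sorted_block f r (take r u) != 0.
  by apply: contraNneq h => ->; rewrite mul0r.
have /andP[so /eqP st] : sorted leq (take r u) && (size (take r u) == r).
  by apply: contraNT hs; rewrite /sorted_block => /negbTE ->; rewrite mul0r.
have u1 : (0 < size (undup (take r u)))%N.
  case: (take r u) st r0 => [<-|x v _ _] //.
  by have := mem_undup (x :: v) x; rewrite inE eqxx; case: (undup _).
split=> [|E]; first by rewrite -add1n leq_add.
have [E1 /h2 [c e]] : size (undup (take r u)) = 1%N /\ block_letters rs (drop r u) = size rs.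
  by move: h1 u1 E; move: (block_letters _ _) (size (undup _)) => x y; lia.
have [a au] : exists a, undup (take r u) = [:: a].
  by case: (undup _) E1 => [|a []] // _; exists a.
have cu : take r u = nseq (size (take r u)) a.
  by apply/all_pred1P/allP => x; rewrite -mem_undup au inE.
rewrite st in cu.
have ct : const_word R r (take r u) = 1.
  rewrite /const_word st eqxx cu; case: (r) => [|i] /=; first by rewrite mulr1n.
  by rewrite all_pred1_nseq mulr1n.
rewrite ct mul1r big_cons e; split=> //; congr (_ * _).
by rewrite /sorted_block so st eqxx au big_seq1 mul1r cu count_nseq /= eqxx mul1n.
Qed.

Lemma blk_sorted_const (rs u : seq nat) f : 0%N \notin rs -> blk (const_word R) rs u != 0 ->
  block_letters rs u = size rs /\ blk (sorted_block f) rs u = \prod_(r <- rs) f r.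
Proof.
elim: rs u => [|r rs IH] u /=; first by rewrite big_nil; case: u => //=; rewrite eqxx.
rewrite inE negb_or => /andP[r0 rs0] h.
have /(IH _ rs0) [-> ->] : blk (const_word R) rs (drop r u) != 0.
  by apply: contraNneq h => ->; rewrite mulr0.
have : const_word R r (take r u) != 0 by apply: contraNneq h => ->; rewrite mul0r.
rewrite /const_word; case: (boolP (_ && _)) => [/andP[/eqP st ct] _|]; last by rewrite mulr0n eqxx.
have [a cu] : exists a, take r u = nseq r a.
  case: (take r u) st ct => [|a v] /=; first by exists 0%N; rewrite -st.
  by move=> <- /all_pred1P e; exists a; rewrite /= -e.
have au : undup (nseq r a) = [:: a].
  case: (r) r0 => //= i _; elim: i => //= i ->; by rewrite inE eqxx.
rewrite big_cons cu /sorted_block au size_nseq eqxx big_seq1 count_nseq /= eqxx mul1n andbT.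
split=> //; congr (_ * _); rewrite (_ : sorted _ _ = true) ?mul1r //.
by case: (r) => //= i; elim: i => //= i ->; rewrite leqnn.
Qed.

End SortedBlocks.

Section PlethysmAtOne.

(* pexp ypow n is the image by omega of h_n[x (1 - t) / (1 - q)]. *)
Definition ypow i : Qqt := (-1) ^+ i.-1 * ((1 - t_Qqt ^+ i) / (1 - q_Qqt ^+ i)).
Definition ycoef : nat -> Qqt := pexp1 ypow.
Definition ycoef' i : Qqt := (1 - t_Qqt)^-1 * ycoef i.
Definition ycoef_at1 i : Qq := (-1) ^+ i.-1 / (1 - q_Qq ^+ i).

Lemma one_sub_t_neq0 : 1 - t_Qqt != 0.
Proof. by have := Qqt_t1 0; rewrite expr1. Qed.

Lemma ycoefE i : ycoef i = (1 - t_Qqt) * ycoef' i.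
Proof. by rewrite /ycoef' mulVKf ?one_sub_t_neq0. Qed.

Lemma ycoef0 : ycoef 0 = 1.
Proof. by have [] := gexpP Qqt_char0 (A := Qqt^o) ypow. Qed.

Lemma ycoef_rec j : j.+1%:R * ycoef j.+1 = \sum_(i < j.+1) ypow i.+1 * ycoef (j - i)%N.
Proof. by have [_ /(_ j)] := gexpP Qqt_char0 (A := Qqt^o) ypow. Qed.

(** In the recursion for [ycoef' j.+1], the factor 1 - t^(i+1) divided by 1 - t is a sum of i + 1
    powers of t. At t = 1 the earlier values [ycoef (j - i)] vanish unless i = j, so one term
    remains, where j + 1 cancels. *)
Lemma at_t1_ycoef j : at_t1 (ycoef j) (j == 0%N)%:R /\ at_t1 (ycoef' j.+1) (ycoef_at1 j.+1).
Proof.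
have [d] := ubnP j; elim: d j => // d IH j jd.
have E : ycoef' j.+1 = j.+1%:R^-1 * \sum_(i < j.+1)
    (((-1) ^+ i * \sum_(l < i.+1) t_Qqt ^+ l) / (1 - q_Qqt ^+ i.+1)) * ycoef (j - i)%N.
  rewrite /ycoef' (canRL (mulKf (Qqt_char0 j)) (ycoef_rec j)) mulrCA; congr (_ * _).
  rewrite mulr_sumr; apply: eq_bigr => i _; rewrite mulrA; congr (_ * _).
  rewrite /ypow /= -[X in X - _ ^+ _](expr1n _ i.+1) subrXX !mulrA; congr (_ / _).
  rewrite [(1 - _)^-1 * _]mulrC -!mulrA; congr (_ * _); rewrite mulKf ?one_sub_t_neq0 //.
  by apply: eq_bigr => l _; rewrite expr1n mul1r.
have Y i : (i <= j)%N -> at_t1 (ycoef i) (i == 0%N)%:R.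
  case: i => [|i] ij; first by rewrite ycoef0; apply: at_t1_1.
  rewrite ycoefE /= mulr0n -(mul0r (ycoef_at1 i.+1)); apply: at_t1_M; last by have [] := IH i (leq_trans ij jd).
  by rewrite -(subrr 1); apply: at_t1_B; [apply: at_t1_1|apply: at_t1_t].
split; first exact: Y.
rewrite E; have -> : ycoef_at1 j.+1 = j.+1%:R^-1 * \sum_(i < j.+1)
    (((-1) ^+ i * \sum_(l < i.+1) 1 ^+ l) / (1 - q_Qq ^+ i.+1)) * (j - i == 0)%N%:R.
  rewrite big_ord_recr /= subnn eqxx mulr1 big1 ?add0r; last first.
    by case=> i ij _ /=; rewrite subn_eq0 leqNgt ij mulr0.
  under eq_bigr do rewrite expr1n.
  rewrite sumr_const card_ord /ycoef_at1 /= [_ * j.+1%:R]mulrC -!mulrA mulKf ?Qq_char0 //.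
apply: at_t1_M; first by apply: at_t1_V; [apply: at_t1_nat|apply: Qq_char0].
apply: at_t1_sum => i _; apply: at_t1_M; last by apply: Y; lia.
apply: at_t1_M.
  apply: at_t1_M; first by apply/at_t1_X/at_t1_N/at_t1_1.
  by apply: at_t1_sum => l _; apply/at_t1_X/at_t1_t.
apply: at_t1_V; last exact: Qq_q1.
by apply: at_t1_B; [apply: at_t1_1|apply/at_t1_X/at_t1_q].
Qed.

Lemma ycoef_at1_neq0 j : ycoef_at1 j.+1 != 0.
Proof. by rewrite mulf_neq0 ?expf_neq0 ?oppr_eq0 ?oner_eq0 ?invr_eq0 ?Qq_q1. Qed.

Lemma pexp_ypow r : pexp ypow r = wsum (sorted_block ycoef r).
Proof.
rewrite -[LHS]wsum_sorted; apply: eq_wsum => u; rewrite /sorted_block -mulnb natrM -mulrA.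
congr (_ * _); have [N mN] := ex_letters_lt (seq_mset u).
rewrite (pexp_coef Qqt_char0 _ _ mN).
have -> : size (enum_mset (seq_mset u)) = size u by apply/perm_size/perm_eq_seq_mset.
congr (_ * _); rewrite -(big_mkord xpredT (fun a => pexp1 ypow (seq_mset u a))).
rewrite (bigID (mem u)) /= [X in _ * X]big1 ?mulr1; last first.
  by move=> a au; rewrite mset_seqE -/(ycoef _) (count_memPn au) ycoef0.
rewrite -big_filter; under eq_bigr do rewrite mset_seqE.
apply: perm_big; apply: uniq_perm; rewrite ?filter_uniq ?iota_uniq ?undup_uniq // => a.
rewrite mem_filter mem_undup mem_index_iota /=; case: (boolP (a \in u)) => // au /=.
by move: mN; rewrite letters_lt_seq => /allP /(_ a au).
Qed.

Lemma at_t1_blk (T : Type) (a : nat -> seq T -> Qqt) (a' : nat -> seq T -> Qq) rs u :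
  (forall r v, r \in rs -> at_t1 (a r v) (a' r v)) -> at_t1 (blk a rs u) (blk a' rs u).
Proof.
elim: rs u => [|r rs IH] u h /=; first exact: at_t1_nat.
apply: at_t1_M; first by apply: h; rewrite inE eqxx.
by apply: IH => r' v r'rs; apply: h; rewrite inE r'rs orbT.
Qed.

(** A word of content rho has as many distinct letters as rho has parts, which gives the power of 1
    - t. At t = 1 only the words attaining this minimum of [block_letters] survive. They have at
    least one letter per block, so nu is not longer than rho, and equal lengths force constant
    blocks, hence nu = rho. In that case the value is a nonzero multiple of the coefficient of x^nu
    in p_nu. *)
Lemma yprod_at_t1 nu rho : is_part nu -> is_part rho ->
  exists Y Y1, [/\ (\prod_(r <- nu) pexp ypow r) (content_monom rho) = (1 - t_Qqt) ^+ size rho * Y,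
    at_t1 Y Y1, (Y1 != 0 -> nu = rho \/ (size nu < size rho)%N) & (nu = rho -> Y1 != 0)].
Proof.
move=> pnu prho; have [_ nu0] := andP pnu; have [_ rho0] := andP prho.
have sz u : u \in words (content_monom rho) -> size (undup u) = size rho.
  rewrite mem_words => /eqP /eq_seq_msetP pu.
  have -> : size (undup u) = size (undup (content_word rho)).
    apply/perm_size/uniq_perm; rewrite ?undup_uniq // => x; rewrite !mem_undup.
    by rewrite (perm_mem pu).
  by rewrite (perm_size (perm_undup_content rho0)) size_iota.
pose Y := \sum_(u <- words (content_monom rho))
  (1 - t_Qqt) ^+ (block_letters nu u - size rho) * blk (sorted_block ycoef') nu u.
pose Y1 := \sum_(u <- words (content_monom rho))
  (block_letters nu u - size rho == 0)%N%:R * blk (sorted_block ycoef_at1) nu u.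
have nz (R : comNzRingType) (f : nat -> R) u : u \in words (content_monom rho) ->
  blk (sorted_block f) nu u != 0 -> (size rho <= block_letters nu u)%N.
  by move=> /sz <-; apply: block_letters_ge_undup.
exists Y, Y1; split.
- under eq_bigr do rewrite pexp_ypow.
  rewrite -wsum_blk; last by move=> *; apply: sorted_block0.
  rewrite /wsum mulr_sumr big_seq [RHS]big_seq; apply: eq_bigr => u uw.
  under eq_blk => r v.
    rewrite (_ : sorted_block _ _ _ = sorted_block (fun i => (1 - t_Qqt) * ycoef' i) r v); last first.
      by congr (_ * _); apply: eq_bigr => a _; rewrite ycoefE.
    over.
  rewrite blk_sorted_scale; have [->|h] := eqVneq (blk (sorted_block ycoef') nu u) 0; first by rewrite !mulr0.
  by rewrite mulrA -exprD subnKC //; apply: nz uw h.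
- rewrite /Y big_seq [X in at_t1 _ X]big_seq; apply: at_t1_sum => u _; apply: at_t1_M.
    case: (_ - _)%N => [|i]; first by rewrite expr0; apply: at_t1_1.
    rewrite exprS /= mulr0n -(mul0r ((1 - 1) ^+ i)).
    have h : at_t1 (1 - t_Qqt) (1 - 1) by apply: at_t1_B; [apply: at_t1_1|apply: at_t1_t].
    by apply: at_t1_M; [rewrite -(subrr 1)|apply: at_t1_X].
  apply: at_t1_blk => r v _; apply: at_t1_M; first exact: at_t1_nat.
  rewrite big_seq [X in at_t1 _ X]big_seq; apply: at_t1_prod => a; rewrite mem_undup => av.
  have : (0 < count_mem a v)%N by rewrite -has_count has_pred1.
  by case: (count_mem a v) => // i _; have [] := at_t1_ycoef i.
- move=> Y1n; have /hasP [u /= uw h] : has (fun u => (block_letters nu u - size rho == 0)%N%:R *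
      blk (sorted_block ycoef_at1) nu u != 0) (words (content_monom rho)).
    by apply: contraNT Y1n => /hasPn h; rewrite /Y1 big1_seq // => u /= /h; rewrite negbK => /eqP.
  have hb : blk (sorted_block ycoef_at1) nu u != 0 by apply: contraNneq h => ->; rewrite mulr0.
  have D : (block_letters nu u <= size rho)%N.
    by rewrite -subn_eq0; move: h; case: (_ - _)%N => //= i; rewrite mulr0n mul0r eqxx.
  have [h1 h2] := block_letters_const nu0 hb.
  move: (leq_trans h1 D); rewrite leq_eqVlt => /orP [/eqP E|]; last by right.
  have [|c _] := h2; first by apply/eqP; rewrite eqn_leq h1 E D.
  move: uw; rewrite mem_words => /eqP /eq_seq_msetP pu; rewrite perm_sym in pu.
  by case: (const_content pnu prho pu c) => [->|]; [left|rewrite E ltnn].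
move=> E; suff -> : Y1 = \prod_(r <- nu) ycoef_at1 r * psums Qq nu (content_monom nu).
  rewrite mulf_neq0 ?(psums_content_neq0 Qq_char0) // prodf_seq_neq0.
  by apply/allP => -[|r] rnu /=; [rewrite rnu in nu0|apply: ycoef_at1_neq0].
rewrite psumsE // /wsum mulr_sumr /Y1 -E big_seq [RHS]big_seq; apply: eq_bigr => u uw.
rewrite -E in sz nz; have [hc|hc] := eqVneq (blk (const_word Qq) nu u) 0; last first.
  have [-> ->] := blk_sorted_const ycoef_at1 nu0 hc.
  by rewrite subnn eqxx mul1r blk_const_bool hc mulr1.
rewrite hc mulr0; have [->|h] := eqVneq (blk (sorted_block ycoef_at1) nu u) 0; first by rewrite mulr0.
have [h1 h2] := block_letters_const nu0 h.
have [D|] := eqVneq (block_letters nu u - size nu)%N 0%N; last by rewrite mulr0n mul0r.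
have [|c _] := h2; first by apply/eqP; rewrite eqn_leq h1 -subn_eq0 D eqxx.
by rewrite hc eqxx in c.
Qed.

End PlethysmAtOne.

(** * Macdonald polynomials at t = 1 *)

Definition parts n : seq (seq nat) :=
  [seq la <- undup (flatten [seq [seq map val (tval f) | f : s.-tuple 'I_n.+1] | s <- iota 0 n.+1])
     | is_part la && (sumn la == n)].

Lemma parts_uniq n : uniq (parts n).
Proof. by rewrite filter_uniq ?undup_uniq. Qed.

Lemma mem_parts n la : (la \in parts n) = is_part la && (sumn la == n).
Proof.
rewrite mem_filter andb_idr // => /andP[pla /eqP sla]; rewrite mem_undup.
apply/flattenP; exists [seq map val (tval f) | f : (size la).-tuple 'I_n.+1].
  apply/mapP; exists (size la) => //; rewrite mem_iota add0n ltnS -sla.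
  by apply: size_le_sumn; case/andP: pla.
apply/mapP; exists [tuple inord (nth 0%N la i) | i < size la]; first by rewrite mem_enum.
apply: (@eq_from_nth _ 0%N); first by rewrite size_map size_tuple.
move=> i il; rewrite (nth_map ord0) ?size_tuple // -(tnth_nth _ _ (Ordinal il)) tnth_mktuple /=.
by rewrite inordK // ltnS -sla nth_le_sumn.
Qed.

Lemma size_pexcess (la : seq nat) : 0%N \notin la -> sumn la = (pexcess 1 la + size la)%N.
Proof.
move=> la0; rewrite -pexcess0 pexcess_step; congr (_ + _)%N.
by apply/eqP; rewrite -all_count; apply/allP => -[|x] // /(negP la0).
Qed.

Lemma pexcess1_size (nu mu : seq nat) : is_part nu -> is_part mu -> sumn nu = sumn mu ->
  (pexcess 1 mu <= pexcess 1 nu)%N -> (size nu <= size mu)%N.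
Proof.
move=> /andP[_ /size_pexcess nu0] /andP[_ /size_pexcess mu0].
by rewrite nu0 mu0; lia.
Qed.

Section Expansion.
Variables (F : fieldType) (q : F).
Hypothesis char0 : forall n, n.+1%:R != 0 :> F.
Hypothesis q1 : forall i, 1 - q ^+ i.+1 != 0.

Definition Wprod nu : series F := \prod_(r <- nu) Wser q r.
Definition wprod nu : series F := \prod_(r <- nu) wser q r.
Definition Qprod nu : F := \prod_(r <- nu) qfact q r.

Lemma Qprod_neq0 nu : Qprod nu != 0.
Proof. by rewrite prodf_seq_neq0; apply/allP => i _; apply: qfact_neq0. Qed.

Lemma WprodE nu : Wprod nu = Qprod nu *: wprod nu.
Proof.
rewrite /Wprod /Qprod /wprod; elim: nu => [|r nu IH]; first by rewrite !big_nil scale1r.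
rewrite !big_cons IH; have -> : Wser q r = qfact q r *: wser q r.
  by rewrite /wser scalerA mulfV ?scale1r ?qfact_neq0.
by rewrite -scalerAl -scalerAr scalerA.
Qed.

Lemma perm_Wprod la ka : perm_eq la ka -> Wprod la = Wprod ka.
Proof. exact: perm_big. Qed.

Lemma perm_hprod la ka : perm_eq la ka -> hprod F la = hprod F ka.
Proof. exact: perm_big. Qed.

(** The only word is constant and has no ascent. *)
Lemma Wprod_row nu : Wprod nu (msetn (sumn nu) 0%N) = 1.
Proof.
rewrite /Wprod /Wser -wsum_blk; last by move=> *; apply: wblock0.
have wE : words (msetn (sumn nu) 0%N) = [:: nseq (sumn nu) 0%N].
  apply: perm_small_eq => //; apply: uniq_perm; rewrite ?words_uniq // => u.
  rewrite mem_words inE -seq_mset_nseq; apply/eqP/eqP => [/eq_seq_msetP|-> //].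
  move=> pu; have /all_pred1P := etrans (esym (perm_all _ pu)) (all_pred1_nseq 0%N (sumn nu)).
  by rewrite -(perm_size pu) size_nseq.
rewrite /wsum wE big_seq1 {wE}; elim: nu => [|r nu IH] //=.
rewrite nseqD take_size_cat ?size_nseq // drop_size_cat ?size_nseq // IH mulr1.
rewrite /wblock size_nseq eqxx mul1r (_ : fstat _ _ = 0%N) //.
by elim: r => //= -[|r] //= ->; rewrite muln0.
Qed.

Lemma schur_span_hprod mu (g : series F) : is_part mu -> schur_span (dominating mu) g ->
  exists d : seq nat -> F,
    (forall nu, d nu != 0 -> forall c, (pexcess c mu <= pexcess c nu)%N) /\
    g = \sum_(nu <- parts (sumn mu)) d nu *: hprod F nu.
Proof.
move=> pmu [l [c [lmu ->]]]; have [smu _] := andP pmu.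
pose sp (g : series F) := exists d : seq nat -> F,
    (forall nu, d nu != 0 -> forall c, (pexcess c mu <= pexcess c nu)%N) /\
    g = \sum_(nu <- parts (sumn mu)) d nu *: hprod F nu.
rewrite -/(sp _).
have sp0 : sp 0 by exists (fun=> 0); split => [nu|]; rewrite ?eqxx // big1 // => i; rewrite scale0r.
have spD f1 f2 : sp f1 -> sp f2 -> sp (f1 + f2).
  move=> [d1 [h1 ->]] [d2 [h2 ->]]; exists (fun nu => d1 nu + d2 nu); split => [nu h|].
    have [d0|/h1 //] := eqVneq (d1 nu) 0; apply: h2.
    by apply: contraNneq h => ->; rewrite d0 addr0.
  by rewrite -big_split /=; apply: eq_bigr => nu _; rewrite scalerDl.
have spZ a f1 : sp f1 -> sp (a *: f1).
  move=> [d1 [h1 ->]]; exists (fun nu => a * d1 nu); split => [nu h|].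
    by apply: h1; apply: contraNneq h => ->; rewrite mulr0.
  by rewrite scaler_sumr; apply: eq_bigr => nu _; rewrite scalerA.
rewrite lincombE big_seq; apply: big_ind => // la /lmu dla; refine (spZ _ _ _).
have [pla sla _] := dla.
have [l' [G [hl -> _ _]]] := schur_expand char0 pla.
rewrite big_seq; apply: big_ind => // x xl; refine (spZ _ _ _).
have [x0 sx xc] := hl _ xl.
have pX : sort geq x.2 \in parts (sumn mu).
  by rewrite mem_parts sort_geq_part //= -sla -sx (perm_sumn (permEl (perm_sort _ _))).
have px : perm_eq (sort geq x.2) x.2 by rewrite perm_sort.
exists (fun nu => (nu == sort geq x.2)%:R); split.
  move=> nu; have [-> _ i|] := eqVneq nu (sort geq x.2); last by rewrite mulr0n eqxx.
  rewrite [X in (_ <= X)%N](perm_big _ px); apply: leq_trans (xc i).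
  exact: excess_dominating.
rewrite (bigD1_seq _ pX) ?parts_uniq //= eqxx scale1r (perm_hprod px) big1 ?addr0 //.
by move=> nu /negbTE ->; rewrite scale0r.
Qed.

Lemma pleth_wprod nu : pleth (fun i => 1 - q ^+ i) (wprod nu) (hprod F nu).
Proof.
apply: pleth_prod => r; rewrite (wser_pexp char0 _ q1) (hser_pexp char0).
by apply: (pleth_pexp char0) => i; rewrite mulfV.
Qed.

(** The substitution x(1 - q) is injective and sends h_r[x / (1 - q)] to h_r, so an expansion of g
    on the h_nu lifts to f with the same coefficients. *)
Lemma plethysm_span_wprod mu (f g : series F) : is_part mu ->
  plethysm_1sub q f g -> schur_span (dominating mu) g ->
  exists d : seq nat -> F,
    (forall nu, d nu != 0 -> forall c, (pexcess c mu <= pexcess c nu)%N) /\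
    f = \sum_(nu <- parts (sumn mu)) d nu *: wprod nu.
Proof.
move=> pmu /plethysm_pleth pfg /(schur_span_hprod pmu) [d [hd gE]]; exists d; split=> //.
rewrite gE in pfg; apply: (pleth_inj char0 _ pfg); first by case=> // i _; apply: q1.
by apply: pleth_sum => nu _; apply/plethZ/pleth_wprod.
Qed.

End Expansion.

Lemma omega_span_coef (F : fieldType) (char0 : forall n, n.+1%:R != 0 :> F) mu rho (g G : series F) :
  is_part mu -> is_part rho -> schur_span (dominating (conj_part mu)) g ->
  pleth (fun i => (-1) ^+ i.-1) g G -> G (content_monom rho) != 0 ->
  forall c, (pexcess c rho <= pexcess c mu)%N.
Proof.
move=> pmu prho [l [c [ldom ->]]] pG G0.
have [Gla GlaP] : exists Gla : seq nat -> series F, forall la, la \in l ->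
    pleth (fun i => (-1) ^+ i.-1) (schur F la) (Gla la) /\
    (Gla la (content_monom rho) != 0 -> forall c, (pexcess c rho <= pexcess c mu)%N).
  suff /choice [Gla h] : forall la, exists G, la \in l ->
    pleth (fun i => (-1) ^+ i.-1) (schur F la) G /\
    (G (content_monom rho) != 0 -> forall c, (pexcess c rho <= pexcess c mu)%N) by exists Gla.
  move=> la; have [lal|] := boolP (la \in l); last by exists 0.
  have dla := ldom _ lal; have [pla _ _] := dla.
  have [_ [G' [_ _ pG' tG']]] := schur_expand char0 pla.
  exists G' => _; split=> // G'0; exact: omega_schur_dom dla tG' G'0.
have pG' : pleth (fun i => (-1) ^+ i.-1) (lincomb l c (schur F)) (\sum_(la <- l) c la *: Gla la).
  by rewrite lincombE; apply: pleth_sum => la /GlaP [h _]; apply: plethZ.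
have /hasP [la lal h] : has (fun la => Gla la (content_monom rho) != 0) l.
  apply: contraNT G0 => /hasPn h; rewrite (pleth_uniq char0 pG pG') ssumE big_seq big1 //.
  by move=> la /h; rewrite negbK sscaleE => /eqP ->; rewrite mulr0.
by have [_ ] := GlaP _ lal; apply.
Qed.

Lemma sum_scaled_eq0 (F : fieldType) (T : eqType) (P : seq T) (s x : F) (b y d z : T -> F) :
  s != 0 -> x != 0 -> {in P, forall i, d i = s * b i} -> {in P, forall i, z i = x * y i} ->
  \sum_(i <- P) d i * z i = 0 -> \sum_(i <- P) b i * y i = 0.
Proof.
move=> s0 x0 dE zE E; apply: (mulfI (mulf_neq0 s0 x0)).
rewrite mulr0 -[RHS]E mulr_sumr big_seq [RHS]big_seq; apply: eq_bigr => i iP.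
by rewrite dE // zE //; ring.
Qed.

Section MacdonaldAtOne.
Variable H : seq nat -> series Qqt.
Hypothesis macH : modified_macdonald H.

Lemma at_t1_qfact r : at_t1 (qfact q_Qqt r) (qfact q_Qq r).
Proof.
apply: at_t1_prod => i _; apply: at_t1_B; [exact: at_t1_1|exact/at_t1_X/at_t1_q].
Qed.

Lemma at_t1_Qprod nu : at_t1 (Qprod q_Qqt nu) (Qprod q_Qq nu).
Proof. by apply: at_t1_prod => i _; apply: at_t1_qfact. Qed.

(** Substituting x(1 - t) and applying omega acts on each product of the expansion separately, while
    the second triangularity excludes x^rho from the total. *)
Lemma macdonald_relation mu (d : seq nat -> Qqt) rho : is_part mu -> is_part rho ->
  H mu = \sum_(nu <- parts (sumn mu)) d nu *: wprod q_Qqt nu ->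
  ~ (forall c, (pexcess c rho <= pexcess c mu)%N) ->
  \sum_(nu <- parts (sumn mu)) d nu * (\prod_(r <- nu) pexp ypow r) (content_monom rho) = 0.
Proof.
move=> pmu prho HE nd; have [_ _ [g pl sp] _] := macH pmu.
have {}pl := plethysm_pleth pl.
pose v i : Qqt := (1 - t_Qqt ^+ i) / (1 - q_Qqt ^+ i).
have pl' : pleth (fun i => 1 - t_Qqt ^+ i) (H mu)
    (\sum_(nu <- parts (sumn mu)) d nu *: \prod_(r <- nu) pexp v r).
  rewrite HE; apply: pleth_sum => nu _; apply: plethZ; apply: pleth_prod => r.
  by rewrite (wser_pexp Qqt_char0 _ Qqt_q1); apply: (pleth_pexp Qqt_char0).
rewrite (pleth_uniq Qqt_char0 pl pl') in sp.
have plG : pleth (fun i => (-1) ^+ i.-1)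
    (\sum_(nu <- parts (sumn mu)) d nu *: \prod_(r <- nu) pexp v r)
    (\sum_(nu <- parts (sumn mu)) d nu *: \prod_(r <- nu) pexp ypow r).
  apply: pleth_sum => nu _; apply: plethZ; apply: pleth_prod => r.
  exact: (pleth_pexp Qqt_char0).
apply: contra_notP nd => /eqP ne; apply: (omega_span_coef Qqt_char0 pmu prho sp plG).
by rewrite ssumE; under eq_bigr do rewrite sscaleE.
Qed.

Lemma macdonald_at_t1 mu : is_part mu ->
  exists A : seq nat -> Qqt,
    H mu = \sum_(nu <- parts (sumn mu)) A nu *: Wprod q_Qqt nu /\
    forall nu, nu \in parts (sumn mu) -> at_t1 (A nu) (nu == mu)%:R.
Proof.
move=> pmu; have [_ [g1 pl1 sp1] _ hl] := macH pmu.
have [d [dom HE]] := plethysm_span_wprod Qqt_char0 Qqt_q1 pmu pl1 sp1.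
set P := parts (sumn mu) in HE *.
have muP : mu \in P by rewrite mem_parts pmu eqxx.
pose A nu := d nu / Qprod q_Qqt nu.
have HA : H mu = \sum_(nu <- P) A nu *: Wprod q_Qqt nu.
  rewrite HE; apply: eq_bigr => nu _; rewrite (WprodE Qqt_q1) scalerA divfK //.
  exact: Qprod_neq0 Qqt_q1 _.
(* The pairing with s_(n) is the coefficient of x_1^n, which is 1 in each product. *)
have sA : \sum_(nu <- P) A nu = 1.
  have := hall_row_coef Qqt_char0 hl; rewrite HA ssumE => <-.
  rewrite big_seq [RHS]big_seq; apply: eq_bigr => nu; rewrite mem_parts => /andP[_ /eqP <-].
  by rewrite sscaleE Wprod_row mulr1.
have hasd : has (fun nu => d nu != 0) P.
  apply/negPn/negP => /hasPn h; have /eqP := oner_neq0 Qqt; apply.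
  rewrite -sA big_seq; apply: big1 => nu /h; rewrite negbK => /eqP d0.
  by rewrite /A d0; apply: mul0r.
have [s [b [s0 dE hasb]]] := regular_multiple hasd.
have rel rho : rho \in P -> ~ (forall c, (pexcess c rho <= pexcess c mu)%N) ->
    exists Y : seq nat -> Qq,
     [/\ forall nu, nu \in P -> Y nu != 0 -> nu = rho \/ (size nu < size rho)%N, Y rho != 0 &
      \sum_(nu <- P) tofrac (b nu).[1] * Y nu = 0].
  move=> rhoP nd; have /andP [prho _] : is_part rho && (sumn rho == sumn mu) by rewrite -mem_parts.
  have := macdonald_relation pmu prho HE nd; rewrite -/P.
  have /choice [Y hY] : forall nu, exists y : Qqt * Qq, nu \in P ->
    [/\ (\prod_(r <- nu) pexp ypow r) (content_monom rho) = (1 - t_Qqt) ^+ size rho * y.1,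
     at_t1 y.1 y.2, (y.2 != 0 -> nu = rho \/ (size nu < size rho)%N) & (nu = rho -> y.2 != 0)].
    move=> nu; have [nuP|] := boolP (nu \in P); last by exists (0, 0).
    have /andP [pnu _] : is_part nu && (sumn nu == sumn mu) by rewrite -mem_parts.
    by have [y [y1 h]] := yprod_at_t1 pnu prho; exists (y, y1).
  move=> E; exists (fun nu => (Y nu).2); split.
  - by move=> nu /hY [].
  - by have [_ _ _ ->] := hY _ rhoP.
  (* The relation divided by s and by (1 - t)^(size rho) is an equality between regular functions;
     the claim is its value at t = 1. *)
  apply: at_t1_fun at_t1_0; rewrite (_ : 0 = \sum_(nu <- P) tofrac (b nu) * (Y nu).1).
    rewrite big_seq [X in at_t1 _ X]big_seq; apply: at_t1_sum => nu /hY [_ h _ _].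
    by apply: at_t1_M => //; apply: at_t1_tofrac.
  apply/esym; apply: (sum_scaled_eq0 s0 _ dE _ E); last first.
    by move=> nu /hY [h _ _ _]; exact: h.
  by apply: expf_neq0; apply: one_sub_t_neq0.
have bdom nu : nu \in P -> (b nu).[1] != 0 -> forall c, (pexcess c mu <= pexcess c nu)%N.
  move=> nuP b1; apply: dom; rewrite (dE _ nuP).
  by have [h _] := tofrac_value_neq0 b1; exact: mulf_neq0 s0 h.
(* A partition of least length in the support at t = 1 has to be mu, and the
   support consists of partitions dominating mu, which are not longer than mu. *)
have supp_min nu : nu \in P -> (b nu).[1] != 0 ->
    (forall ka, ka \in P -> (b ka).[1] != 0 -> (size nu <= size ka)%N) -> nu = mu.
  move=> nuP b1 nmin; apply: contrapT => ne.
  have /andP [pnu _] : is_part nu && (sumn nu == sumn mu) by rewrite -mem_parts.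
  have [|Y [Y0 Yn E]] := rel nu nuP.
    move=> h; apply: ne; apply: pexcess_inj => // c; apply/eqP; rewrite eqn_leq h.
    exact: bdom.
  move/eqP: E; rewrite (bigD1_seq nu) ?parts_uniq //= big_seq_cond big1 ?addr0.
    by rewrite mulf_eq0 (negbTE Yn) orbF tofrac_eq0 (negbTE b1).
  move=> ka /andP[kaP kn]; have [->|bk] := eqVneq (b ka).[1] 0; first by rewrite tofrac0 mul0r.
  have [->|/(Y0 _ kaP) [E|]] := eqVneq (Y ka) 0; first by rewrite mulr0.
    by rewrite E eqxx in kn.
  by rewrite ltnNge nmin.
(* All elements of the support are at most as long as mu, while a shortest one is mu itself; hence
   all have its length, all are shortest, and all are mu. *)
have [bmu b0] : (b mu).[1] != 0 /\ forall nu, nu \in P -> nu != mu -> (b nu).[1] = 0.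
  pose S := [seq nu <- P | (b nu).[1] != 0].
  have SP nu : (nu \in S) = ((b nu).[1] != 0) && (nu \in P) by rewrite mem_filter.
  have muS_small nu : nu \in S -> (size nu <= size mu)%N.
    rewrite SP => /andP [b1 nuP]; have /andP [pnu /eqP sn] : is_part nu && (sumn nu == sumn mu).
      by rewrite -mem_parts.
    exact: pexcess1_size pnu pmu sn (bdom nu nuP b1 1%N).
  have [nu nuS nmin] : exists2 nu, nu \in S & forall ka, ka \in S -> (size nu <= size ka)%N.
    have : exists i, has (fun nu => size nu == i) S.
      have /hasP [nu nuP b1] := hasb; exists (size nu); apply/hasP; exists nu => //.
      by rewrite SP b1.
    move=> ex; have [i /hasP [nu nuS /eqP si] imin] := ex_minnP ex.
    exists nu => // ka kaS; rewrite si; apply: imin; apply/hasP; by exists ka.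
  have eqmu ka : ka \in S -> size ka = size nu -> ka = mu.
    move=> kaS E; move: (kaS); rewrite SP => /andP[b1 kaP]; apply: supp_min => // ka' kaP' b1'.
    by rewrite E; apply: nmin; rewrite SP b1'.
  have muE := eqmu _ nuS erefl; rewrite muE in nuS nmin eqmu.
  split=> [|ka kaP kn]; first by move: nuS; rewrite SP => /andP[].
  apply: contraNeq kn => b1; have kaS : ka \in S by rewrite SP b1.
  by rewrite (eqmu ka kaS) //; apply/eqP; rewrite eqn_leq muS_small // nmin.
have bat1 nu : nu \in P -> at_t1 (tofrac (b nu) / Qprod q_Qqt nu)
    ((nu == mu)%:R * (tofrac (b mu).[1] / Qprod q_Qq mu)).
  move=> nuP; have -> : (nu == mu)%:R * (tofrac (b mu).[1] / Qprod q_Qq mu) =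
      tofrac (b nu).[1] / Qprod q_Qq nu.
    have [->|ne] := eqVneq nu mu; first by rewrite mul1r.
    by rewrite (b0 _ nuP ne) tofrac0 !mul0r.
  apply: at_t1_M; first exact: at_t1_tofrac.
  by apply: at_t1_V; [apply: at_t1_Qprod|apply: Qprod_neq0 Qq_q1 _].
set z := tofrac (b mu).[1] / Qprod q_Qq mu in bat1.
have z0 : z != 0.
  by apply: mulf_neq0; rewrite ?tofrac_eq0 // invr_eq0; apply: Qprod_neq0 Qq_q1 _.
(* The normalization says s = 1 / Z, and Z takes the nonzero value z at t = 1, so s is regular as
   well. *)
pose Z := \sum_(nu <- P) tofrac (b nu) / Qprod q_Qqt nu.
have atZ : at_t1 Z z.
  have -> : z = \sum_(nu <- P) (nu == mu)%:R * z.
    rewrite (bigD1_seq mu) ?parts_uniq //= eqxx mul1r big1 ?addr0 // => nu /negbTE ->.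
    by rewrite mul0r.
  by rewrite /Z big_seq [X in at_t1 _ X]big_seq; apply: at_t1_sum.
have sZ : s * Z = 1.
  rewrite -sA /Z mulr_sumr big_seq [RHS]big_seq; apply: eq_bigr => nu nuP.
  by rewrite /A dE // mulrA.
exists A; split=> // nu nuP.
have -> : A nu = tofrac (b nu) / Qprod q_Qqt nu * Z^-1.
  by rewrite -(mulr1_eq sZ) invrK /A (dE _ nuP) mulrC -[RHS]mulrA [RHS]mulrC mulrA [_ * s]mulrC.
have -> : (nu == mu)%:R = (nu == mu)%:R * z * z^-1 by rewrite mulfK.
by apply: at_t1_M; [apply: bat1|apply: at_t1_V].
Qed.

End MacdonaldAtOne.

Lemma elem_Wprod (F : fieldType) (q : F) (q1 : forall i, 1 - q ^+ i.+1 != 0) n : (0 < n)%N ->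
  elem F n = \sum_(al <- comps n) kcoef q al *: Wprod q al.
Proof.
move=> n0; rewrite elemE.
rewrite (_ : incr_word F n = fun u => \sum_(al <- comps n) kcoef q al * blk (wblock q ltb_asc) al u).
  rewrite wsum_sum; apply: eq_bigr => al _; rewrite wsumZ wsum_blk // => *; exact: wblock0.
apply/funext => u; rewrite /incr_word; have [su|su] /= := eqVneq (size u) n.
  by rewrite -(ech_incr q) -su (ech_expansion q1) // su.
rewrite big_seq big1 // => al /comps_recP [] // _ sal _.
by rewrite blk_size ?mulr0 ?sal // => *; apply: wblock0.
Qed.

Lemma symfun_lincomb (F : fieldType) (c : F) (f g : series F) :
  symfun f -> symfun g -> symfun (c *: f + g).
Proof.
move=> [[d hd] sf] [[d' hd'] sg]; split.
  exists (maxn d d') => m; rewrite gtn_max => /andP[h h'].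
  by rewrite saddE sscaleE hd // hd' // mulr0 addr0.
by move=> s m bs; rewrite !saddE !sscaleE sf // sg.
Qed.

Lemma symfun0 (F : fieldType) : symfun (0 : series F).
Proof. by split; [exists 0%N|]. Qed.

(** * The iterated operator on e_n at t = 1 *)

Section NablaAtOne.
Variables (k : nat) (H : seq nat -> series Qqt) (nabla : series Qqt -> tseries k.+1 Qqt).
Hypothesis macH : modified_macdonald H.
Hypothesis nablaH : is_nabla_iter H nabla.

Lemma nabla_lincomb (L : seq (seq nat)) (c : seq nat -> Qqt) m : all is_part L ->
  nabla (\sum_(la <- L) c la *: H la) m = \sum_(la <- L) c la * \prod_j H la (m j).
Proof.
have [nlin nmac] := nablaH.
have nlin' a f g m' : symfun f -> symfun g -> nabla (a *: f + g) m' = a * nabla f m' + nabla g m'.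
  move=> sf sg; have E : a *: f + g = (fun m => a * f m + g m).
    by apply/funext => x; rewrite saddE sscaleE.
  by rewrite E (nlin a f g sf sg).
suff h : all is_part L -> symfun (\sum_(la <- L) c la *: H la) /\
    nabla (\sum_(la <- L) c la *: H la) m = \sum_(la <- L) c la * \prod_j H la (m j) by move=> /h [].
elim: L => [_|la L IH /= /andP[pla /IH [sL nL]]].
  split; first by rewrite big_nil; apply: symfun0.
  (* Linearity with a = -1 and f = g = 0 gives nabla 0 = - nabla 0 + nabla 0 = 0. *)
  rewrite !big_nil; have := nlin' (-1) 0 0 m (symfun0 _) (symfun0 _).
  by rewrite scaler0 addr0 mulN1r addNr.
have [sla _ _ _] := macH pla.
rewrite !big_cons; split; first exact: symfun_lincomb.
by rewrite nlin' // nL nmac.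
Qed.

Lemma at_t1_det n (A : 'M[Qqt]_n) (A' : 'M[Qq]_n) : (forall i j, at_t1 (A i j) (A' i j)) ->
  at_t1 (\det A) (\det A').
Proof.
move=> h; apply: at_t1_sum => s _; apply: at_t1_M; first exact/at_t1_X/at_t1_N/at_t1_1.
by apply: at_t1_prod => i _.
Qed.

(** By Cramer's formula: the determinant is 1 at t = 1, so dividing by it preserves regularity, and
    the adjugate specializes to that of the identity. *)
Lemma at_t1_invmx n (A : 'M[Qqt]_n) : (forall i j, at_t1 (A i j) (i == j)%:R) ->
  A \in unitmx /\ forall i j, at_t1 (invmx A i j) (i == j)%:R.
Proof.
move=> h; have h1 i j : at_t1 (A i j) ((1%:M : 'M[Qq]_n) i j) by rewrite mxE.
have hd : at_t1 (\det A) 1 by rewrite -(det1 Qq n); apply: at_t1_det.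
have uA : A \in unitmx.
  rewrite unitmxE unitfE; apply/eqP => d0; rewrite d0 in hd.
  by have /eqP := at_t1_fun at_t1_0 hd; rewrite eq_sym oner_eq0.
split=> // i j; rewrite /invmx uA mxE.
have -> : (i == j)%:R = 1^-1 * \adj (1%:M : 'M[Qq]_n) i j.
  by have := mul1mx (\adj (1%:M : 'M[Qq]_n)); rewrite mul_mx_adj det1 => <-; rewrite mxE invr1 mul1r.
apply: at_t1_M; first by apply: at_t1_V => //; apply: oner_neq0.
rewrite !mxE; apply: at_t1_M; first exact/at_t1_X/at_t1_N/at_t1_1.
by apply: at_t1_det => i' j'; rewrite !mxE /=; have := h1 (lift j i') (lift i j'); rewrite !mxE.
Qed.

Lemma at_t1_Wprod nu m : at_t1 (Wprod q_Qqt nu m) (Wprod q_Qq nu m).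
Proof.
rewrite /Wprod /Wser -!wsum_blk; try by move=> *; apply: wblock0.
apply: at_t1_sum => u _; apply: at_t1_blk => r v _; apply: at_t1_M; first exact: at_t1_nat.
exact/at_t1_X/at_t1_q.
Qed.

Lemma at_t1_kcoef al : at_t1 (kcoef q_Qqt al) (kcoef q_Qq al).
Proof.
have hk a : at_t1 (kfac q_Qqt a) (kfac q_Qq a).
  apply: at_t1_M; first exact/at_t1_X/at_t1_N/at_t1_1.
  by apply: at_t1_V; [apply: at_t1_qfact|apply: qfact_neq0 Qq_q1 _].
case: al => [|a al] /=; first exact: at_t1_1.
apply: at_t1_M; last by apply: at_t1_prod => b _; apply: at_t1_N.
apply: at_t1_M => //; apply: at_t1_B; [exact/at_t1_X/at_t1_q|exact: at_t1_1].
Qed.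

Lemma macdonald_at_t1_value n mu m : mu \in parts n -> at_t1 (H mu m) (Wprod q_Qq mu m).
Proof.
rewrite mem_parts => /andP [pmu /eqP smu]; have [A [-> hA]] := macdonald_at_t1 macH pmu.
have muP : mu \in parts (sumn mu) by rewrite mem_parts pmu eqxx.
rewrite ssumE; have -> : Wprod q_Qq mu m = \sum_(nu <- parts (sumn mu)) (nu == mu)%:R * Wprod q_Qq nu m.
  rewrite (bigD1_seq mu) ?parts_uniq //= eqxx mul1r big1 ?addr0 // => nu /negbTE ->.
  by rewrite mul0r.
rewrite big_seq [X in at_t1 _ X]big_seq; apply: at_t1_sum => nu nuP.
by rewrite sscaleE; apply: at_t1_M; [apply: hA|apply: at_t1_Wprod].
Qed.

(** Inverts the transition matrix of [macdonald_at_t1], which is the identity at t = 1. *)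
Lemma Wprod_macdonald n : exists B : seq nat -> seq nat -> Qqt,
  forall nu, nu \in parts n ->
    Wprod q_Qqt nu = \sum_(mu <- parts n) B nu mu *: H mu /\
    forall mu, mu \in parts n -> at_t1 (B nu mu) (nu == mu)%:R.
Proof.
have /choice [A hA] : forall mu, exists A : seq nat -> Qqt, mu \in parts n ->
  H mu = \sum_(nu <- parts n) A nu *: Wprod q_Qqt nu /\
    forall nu, nu \in parts n -> at_t1 (A nu) (nu == mu)%:R.
  move=> mu; have [|] := boolP (mu \in parts n); last by exists (fun=> 0).
  rewrite mem_parts => /andP[pmu /eqP smu]; have := macdonald_at_t1 macH pmu; rewrite smu.
  by case=> A hA; exists A.
set P := parts n in hA *; pose K := size P.
pose p (i : 'I_K) := nth [::] P i.
have pP i : p i \in P by rewrite mem_nth.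
pose M : 'M[Qqt]_K := \matrix_(i, j) A (p i) (p j).
have [|uM hB] := @at_t1_invmx _ M.
  move=> i j; rewrite mxE; have [_ h] := hA _ (pP i); have := h _ (pP j).
  by rewrite nth_uniq ?parts_uniq // eq_sym.
have bigP (V : nmodType) (f : seq nat -> V) : \sum_(nu <- P) f nu = \sum_(i < K) f (p i).
  by rewrite (big_nth [::]) big_mkord.
pose B nu mu := \sum_(i < K | p i == nu) \sum_(j < K | p j == mu) invmx M i j.
have BE i j : B (p i) (p j) = invmx M i j.
  have e i' : (fun j => p j == p i') =1 pred1 i'.
    by move=> j'; rewrite nth_uniq ?parts_uniq.
  by rewrite /B (eq_bigl _ _ (e i)) big_pred1_eq (eq_bigl _ _ (e j)) big_pred1_eq.
exists B => nu nuP; have iP : (index nu P < K)%N by rewrite index_mem.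
have -> : nu = p (Ordinal iP) by rewrite /p /= nth_index.
move: (Ordinal iP) => {nuP iP} i; split; last first.
  move=> mu muP; have jP : (index mu P < K)%N by rewrite index_mem.
  have -> : mu = p (Ordinal jP) by rewrite /p /= nth_index.
  by rewrite BE nth_uniq ?parts_uniq.
rewrite bigP; under eq_bigr => j _.
  have [-> _] := hA _ (pP j); rewrite bigP BE scaler_sumr.
  under eq_bigr do rewrite scalerA.
  over.
rewrite exchange_big /= (bigD1 i) //= -scaler_suml.
have E l : \sum_(j < K) invmx M i j * A (p j) (p l) = (i == l)%:R.
  have := congr1 (fun X : 'M_K => X i l) (mulVmx uM); rewrite !mxE => <-.
  by apply: eq_bigr => j _; rewrite mxE.
rewrite E eqxx scale1r big1 ?addr0 // => l li; rewrite -scaler_suml E eq_sym.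
by rewrite (negbTE li) scale0r.
Qed.

(** The operator is linear over Q(q,t) and known on the H_mu only, so e_n is first written on these.
    Its coefficients are regular and tend to those on the products of the W_r, grouped by sorted
    composition; hence at t = 1 each product is in effect mapped to its own tensor power. *)
Lemma nabla_elem_at_t1 n m : (0 < n)%N ->
  at_t1 (nabla (elem Qqt n) m)
    (\sum_(al <- comps n) kcoef q_Qq al * \prod_j Wprod q_Qq al (m j)).
Proof.
move=> n0; have [B hB] := Wprod_macdonald n.
have srt al : al \in comps n -> sort geq al \in parts n /\ perm_eq (sort geq al) al.
  move=> /comps_recP [] // _ sal al0; rewrite mem_parts sort_geq_part //= perm_sort.
  by rewrite (perm_sumn (permEl (perm_sort _ _))) sal eqxx.
pose c mu := \sum_(al <- comps n) kcoef q_Qqt al * B (sort geq al) mu.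
have eE : elem Qqt n = \sum_(mu <- parts n) c mu *: H mu.
  rewrite (elem_Wprod Qqt_q1 n0) /c.
  under [RHS]eq_bigr do rewrite scaler_suml.
  rewrite exchange_big /= big_seq [RHS]big_seq; apply: eq_bigr => al /srt [alP pal].
  have [WE _] := hB _ alP; rewrite -(perm_Wprod _ pal) WE scaler_sumr.
  by apply: eq_bigr => mu _; rewrite scalerA.
rewrite eE nabla_lincomb; last by apply/allP => la; rewrite mem_parts => /andP[].
have -> : \sum_(al <- comps n) kcoef q_Qq al * \prod_j Wprod q_Qq al (m j) =
  \sum_(mu <- parts n) (\sum_(al <- comps n) kcoef q_Qq al * (sort geq al == mu)%:R) *
     \prod_j Wprod q_Qq mu (m j).
  under [RHS]eq_bigr do rewrite mulr_suml.
  rewrite exchange_big /= big_seq [RHS]big_seq; apply: eq_bigr => al /srt [alP pal].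
  rewrite (bigD1_seq _ alP) ?parts_uniq //= eqxx mulr1 (perm_Wprod _ pal) [X in _ + X]big1 ?addr0 //.
  by move=> mu; rewrite eq_sym => /negbTE ->; rewrite mulr0 mul0r.
rewrite big_seq [X in at_t1 _ X]big_seq; apply: at_t1_sum => mu muP; apply: at_t1_M.
  rewrite /c big_seq [X in at_t1 _ X]big_seq; apply: at_t1_sum => al /srt [alP _].
  by apply: at_t1_M; [apply: at_t1_kcoef|have [_] := hB _ alP; apply].
by apply: at_t1_prod => j _; apply: macdonald_at_t1_value muP.
Qed.

End NablaAtOne.

(** * Dyck paths *)

Section Paths.
Variable k : nat.

(* The words leading from a vertex (x, y) with k y - x = g to the end (k n, n),
   n = y + N, weakly above the diagonal; s is the value of k y - x at the next
   north step. *)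
Fixpoint dyck_from (N g : nat) : seq (seq bool) :=
  if N is N'.+1 then
    [seq nseq (g - s) false ++ true :: p | s <- iota 0 g.+1, p <- dyck_from N' (s + k)]
  else [:: nseq g false].

Lemma dyck_fromS N g : dyck_from N.+1 g =
  [seq nseq (g - s) false ++ true :: p | s <- iota 0 g.+1, p <- dyck_from N (s + k)].
Proof. by []. Qed.

Lemma dyck_from_uniq N g : uniq (dyck_from N g).
Proof.
elim: N g => [|N IH] g //=; apply: (allpairs_uniq_dep (s := iota 0 g.+1)) => //.
  exact: (iota_uniq 0 g.+1).
move=> _ _ /allpairsPdep [s [p [sg _ ->]]] /allpairsPdep [s' [p' [sg' _ ->]]] /= E.
have idx d (v : seq bool) : index true (nseq d false ++ true :: v) = d.
  by elim: d => //= d ->.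
have Es : s = s'.
  have := congr1 (index true) E; rewrite !idx.
  by move: sg sg'; rewrite !mem_iota; lia.
by subst s'; move/eqP: E; rewrite eqseq_cat // => /andP[_ /eqP [->]].
Qed.

Definition above g (p : seq bool) := forall i,
  (count negb (take i p) <= k * count id (take i p) + g)%N.

Lemma above_cons g d p : (d <= g)%N -> above (g - d + k) p ->
  above g (nseq d false ++ true :: p).
Proof.
move=> dg ap i; rewrite take_cat size_nseq; case: ltnP => id.
  by rewrite take_nseq ?(ltnW id) // !count_nseq /=; lia.
case: (i - d)%N => [|j]; rewrite /= ?cats0 ?count_cat !count_nseq /=; first lia.
by have := ap j; lia.
Qed.

Lemma above_consP g d p : above g (nseq d false ++ true :: p) ->
  (d <= g)%N /\ above (g - d + k) p.
Proof.
move=> h; have dg : (d <= g)%N.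
  by have := h d; rewrite take_size_cat ?size_nseq // !count_nseq /=; lia.
split=> // i; have := h (d + i.+1)%N.
by rewrite takeD take_size_cat ?size_nseq // drop_size_cat ?size_nseq // !count_cat !count_nseq /=; lia.
Qed.

Lemma mem_dyck_from N g p : p \in dyck_from N g <->
  [/\ count id p = N, count negb p = (k * N + g)%N & above g p].
Proof.
elim: N g p => [|N IH] g p.
  rewrite inE muln0; split=> [/eqP ->|[c1 c2 _]].
    rewrite !count_nseq /= mul1n; split=> // i.
    by have := count_size negb (take i (nseq g false)); rewrite size_take size_nseq; case: ltnP; lia.
  have /all_pred1P -> : all (pred1 false) p.
    by apply/allP => -[] // /count_memPn; rewrite (eq_count (a2 := id)) ?c1 //; case.
  by rewrite -[size p](count_predC id) c1 add0n (eq_count (a2 := negb)) ?c2 ?eqxx.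
split=> [/allpairsPdep [s [p' [+ /IH [c1 c2 ap] ->]]]|[c1 c2 ap]].
  rewrite mem_iota => sg; rewrite !count_cat !count_nseq /= c1 c2.
  split; [lia | lia | apply: above_cons; first lia].
  by rewrite (_ : g - (g - s) = s)%N //; lia.
have tp : true \in p by rewrite -has_pred1 has_count (eq_count (a2 := id)) ?c1 //; case.
have [d [p' pE]] : exists d p', p = nseq d false ++ true :: p'.
  exists (index true p), (drop (index true p).+1 p).
  rewrite -{1}[p](cat_take_drop (index true p)) (drop_nth false) ?index_mem // nth_index //.
  congr (_ ++ _); apply: (@eq_from_nth _ false).
    by rewrite size_nseq size_take index_mem tp.
  move=> i; rewrite size_take index_mem tp => ii; rewrite nth_take // nth_nseq ii.
  by apply: negbTE; have := before_find false ii; case: nth.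
move: ap c1 c2; rewrite pE => /above_consP [dg ap]; rewrite !count_cat !count_nseq /= => c1 c2.
apply/(@allpairsPdep _ _ _ (fun s v => nseq (g - s) false ++ true :: v) (iota 0 g.+1)
  (fun s => dyck_from N (s + k))); exists (g - d)%N, p'; split.
- by rewrite mem_iota; lia.
- by apply/IH; split=> //; lia.
- by rewrite (_ : g - (g - d) = d)%N //; lia.
Qed.

Lemma mem_dyck n p : p \in dyck_from n 0 <-> dyck k n p.
Proof.
rewrite mem_dyck_from addn0; split=> -[c1 c2 h]; split=> // i; first by have := h i; rewrite addn0.
by rewrite addn0.
Qed.

Lemma north_cols_false d x p : north_cols x (nseq d false ++ p) = north_cols (x + d) p.
Proof. by elim: d x => [|d IH] x /=; rewrite ?addn0 // IH addnS. Qed.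

Lemma size_north_cols x p : size (north_cols x p) = count id p.
Proof. by elim: p x => [|[] p IH] x //=; rewrite IH. Qed.

(* c is the abscissa of the north step number y, cs are the next ones *)
Fixpoint wide_steps (a : nat -> nat) y c cs : bool :=
  if cs is c' :: cs' then (k < c' - c + a y)%N && wide_steps a y.+1 c' cs' else true.

Fixpoint col_area y cs : nat :=
  if cs is c :: cs' then (k * y - c + col_area y.+1 cs')%N else 0.

Variables (F : fieldType) (q : F).

(** An entry s of the chain is k y - x at the north step y, which is the area of that row. The next
    entry is s' = s + k - (c' - c), so s' < s + a reads k < c' - c + a. The letters are the
    positions of the rows, and [asc] on consecutive positions is [a]. *)
Lemma echain_dyck (a : nat -> nat) (asc : nat -> nat -> nat) N y s c : (c + s = k * y)%N ->
  (forall i, asc i i.+1 = a i) -> (forall i, (a i <= k.+1)%N) ->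
  echain q asc s y (iota y.+1 N) =
  \sum_(p <- dyck_from N (s + k))
     (wide_steps a y c (north_cols c p))%:R * q ^+ (s + col_area y.+1 (north_cols c p)).
Proof.
move=> + ascE ak; elim: N y s c => [|N IH] y s c E.
  rewrite big_seq1 -[nseq _ _]cats0 north_cols_false /= addn0 mulr1n mul1r //.
rewrite [LHS]/= ascE dyck_fromS big_allpairs_dep -[iota 0 _ in RHS]/(index_iota 0 (s + k).+1) big_mkord.
(* Since a <= k + 1, every entry allowed by the chain is reached by some number of east steps. *)
have le : (s + a y <= (s + k).+1)%N by have := ak y; lia.
rewrite (big_ord_widen _ (fun s' => echain q asc s' y.+1 (iota y.+2 N)) le) big_mkcond mulr_sumr.
apply: eq_bigr => -[s' /= ss'] _.
have E' : (c + (s + k - s') + s' = k * y.+1)%N by lia.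
rewrite (IH _ _ _ E').
have wE : (k < c + (s + k - s') - c + a y)%N = (s' < s + a y)%N by lia.
have aE : (k * y.+1 - (c + (s + k - s')) = s')%N by lia.
case: ifP => h.
  rewrite mulr_sumr; apply: eq_bigr => p _.
  by rewrite north_cols_false /= wE h aE /= mulrCA -exprD.
by rewrite mulr0 big1 // => p _; rewrite north_cols_false /= wE h mul0r.
Qed.

Lemma ech_dyck (a : nat -> nat) (asc : nat -> nat -> nat) n : (0 < n)%N ->
  (forall i, asc i i.+1 = a i) -> (forall i, (a i <= k.+1)%N) ->
  ech q asc 0 (iota 0 n) =
  \sum_(p <- dyck_from n 0)
     (wide_steps a 0 0 (behead (north_cols 0 p)))%:R * q ^+ col_area 0 (north_cols 0 p).
Proof.
case: n => // n _ ascE ak.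
rewrite [LHS]/= (@echain_dyck a asc n 0 0 0) ?muln0 // dyck_fromS big_allpairs_dep big_seq1.
by rewrite subnn; apply: eq_bigr => p _; rewrite /= muln0.
Qed.

End Paths.

(** * Labelled paths *)

Section LabelledPaths.
Variables (k n r : nat).
Implicit Types (p : seq bool).

Definition labels N := {ffun 'I_r -> n.-tuple 'I_N}.
Definition label_mx N (f : labels N) : 'M[nat]_(n, r) := \matrix_(i, j) val (tnth (f j) i).

Lemma word_label_mx N (f : labels N) j : word (label_mx f) j = map val (f j).
Proof.
transitivity (map (val \o tnth (f j)) (enum 'I_n)); last by rewrite map_comp map_tnth_enum.
by apply: eq_map => i; rewrite mxE.
Qed.

Lemma label_mx_inj N : injective (@label_mx N).
Proof.
move=> f g E; apply/ffunP => j; apply: eq_from_tnth => i; apply: val_inj.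
by have := congr1 (fun M : 'M_(n, r) => M i j) E; rewrite !mxE.
Qed.

Lemma col_areaE y cs : col_area k y cs = (\sum_(i < size cs) (k * (y + i) - nth 0 cs i))%N.
Proof.
elim: cs y => [|c cs IH] y /=; first by rewrite big_ord0.
by rewrite big_ord_recl addn0 IH; congr (_ + _)%N; apply: eq_bigr => i _; rewrite /= addSnnS.
Qed.

Lemma area_cols p : dyck k n p -> area k n p = col_area k 0 (north_cols 0 p).
Proof.
case=> c1 _ _; rewrite col_areaE size_north_cols c1 /area -sum1_card.
rewrite big_mkcond -(pair_bigA _ (fun (a : 'I_(k * n)) (i : 'I_n) =>
  if (col p i <= a < k * i)%N then 1%N else 0%N)) exchange_big /=.
apply: eq_bigr => i _; rewrite -big_mkcond /=.
rewrite add0n -/(col p i) -(big_mkord (fun a => (col p i <= a < k * i)%N) (fun=> 1%N)).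
have le : (k * i <= k * n)%N by rewrite leq_mul2l ltnW ?orbT.
rewrite -big_filter (_ : [seq _ <- _ | _] = iota (col p i) (k * i - col p i)).
  by rewrite big_const_seq count_predT size_iota iter_addn_0 mul1n.
apply: (sorted_eq leq_trans anti_leq).
- by rewrite sorted_filter ?iota_sorted //; apply: leq_trans.
- exact: iota_sorted.
apply: uniq_perm; rewrite ?filter_uniq ?iota_uniq // => a.
by rewrite mem_filter !mem_iota; lia.
Qed.

(** The set of labelled paths is infinite, but only labels below N contribute to the coefficient of
    [m]. The sum over paths is separated from the sum over labels. *)
Lemma area_sum_finite r' N (A : set (labeled_path n r)) (G : labeled_path n r -> tseries r' Qq) m :
  (forall L, A L -> dyck k n L.1) ->
  (forall L, A L -> G L m != 0 -> forall i j, (L.2 i j < N)%N) ->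
  area_sum k A G m =
  \sum_(p <- dyck_from k n 0) q_Qq ^+ col_area k 0 (north_cols 0 p) *
     \sum_(f : labels N) `[< A (p, label_mx f) >]%:R * G (p, label_mx f) m.
Proof.
move=> Ad GN; rewrite /area_sum.
pose s := [seq L <- [seq (p, label_mx f) | p <- dyck_from k n 0, f <- enum {: labels N}] | `[< A L >]].
rewrite (fsbigE s).
- rewrite /s big_filter_cond big_mkcond big_allpairs_dep /=.
  rewrite big_seq [RHS]big_seq; apply: eq_bigr => p pd.
  rewrite big_enum /= mulr_sumr; apply: eq_bigr => f _ /=.
  case: asboolP => [Af|nA] /=; last by rewrite mul0r mulr0.
  by rewrite mem_set // mul1r area_cols //; apply/mem_dyck.
- rewrite filter_uniq //; apply: allpairs_uniq; rewrite ?dyck_from_uniq ?enum_uniq //.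
  by move=> [p f] [p' f'] _ _ /= [-> /label_mx_inj ->].
- by move=> L /=; rewrite mem_filter => /andP[/asboolP].
move=> -[p w] AL /=; rewrite mem_filter => /negP h; apply/eqP/negPn/negP; rewrite mulf_eq0 negb_or.
move=> /andP[_ Gn]; apply: h; apply/andP; split; first exact/asboolP.
apply/allpairsP; have wN := GN _ AL Gn.
pose f : labels N := [ffun j => [tuple Ordinal (wN i j) | i < n]].
exists (p, f); rewrite mem_enum; split=> //=; first by apply/mem_dyck/(Ad _ AL).
by congr (_, _); apply/matrixP => i j; rewrite mxE ffunE tnth_mktuple.
Qed.

Definition wdes (v : 'I_r -> seq nat) i : nat :=
  #|[pred j | (nth 0 (v j) i.+1 <= nth 0 (v j) i)%N]|.

Lemma wdes_le v i : (wdes v i <= r)%N.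
Proof. by rewrite -[X in (_ <= X)%N]card_ord max_card. Qed.

Lemma wdes_asc v i :
  (\sum_j ltb_asc (nth 0 (v j) i) (nth 0 (v j) i.+1) = r - wdes v i)%N.
Proof.
have c := cardC [pred j | (nth 0 (v j) i.+1 <= nth 0 (v j) i)%N].
rewrite card_ord -/(wdes v i) in c.
suff -> : (\sum_j ltb_asc (nth 0 (v j) i) (nth 0 (v j) i.+1) =
  #|[predC [pred j | (nth 0 (v j) i.+1 <= nth 0 (v j) i)%N]]|)%N.
  by rewrite -[X in (X - _)%N]c addKn.
rewrite -sum1_card [RHS]big_mkcond /=.
by apply: eq_bigr => j _; rewrite /ltb_asc inE /= ltnNge inE; case: (_ <= _)%N.
Qed.

Lemma nth_word (w : 'M[nat]_(n, r)) j (i : 'I_n) : nth 0%N (word w j) i = w i j.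
Proof. by rewrite /word (nth_map i) ?size_enum_ord // nth_ord_enum. Qed.

Lemma nweakdes_wdes (w : 'M[nat]_(n, r)) (i i' : 'I_n) : i' = i.+1 :> nat ->
  nweakdes w i i' = wdes (word w) i.
Proof.
by move=> E; apply: eq_card => j; rewrite !inE -E !nth_word.
Qed.

Lemma LD_wdes p w : LD k n r (p, w) <-> dyck k n p /\
  forall i, (i.+1 < n)%N -> (wdes (word w) i <= col p i.+1 - col p i)%N.
Proof.
split=> -[d h]; split=> //.
  move=> i i1; have := h (Ordinal (ltnW i1)) (Ordinal i1) erefl.
  by rewrite nweakdes_wdes.
by move=> i i' E; rewrite (nweakdes_wdes w E) E; apply: h; rewrite -E.
Qed.

Lemma wide_stepsP a y c cs : reflect
  (forall i, (i < size cs)%N -> (k < nth 0 cs i - nth 0 (c :: cs) i + a (y + i)%N)%N)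
  (wide_steps k a y c cs).
Proof.
elim: cs y c => [|c' cs IH] y c /=; first by apply: (iffP idP).
apply: (iffP andP) => [[h /IH h'] [|i] ic /=|h].
- by rewrite addn0.
- by have := h' i ic; rewrite addSnnS.
split; first by have := h 0%N isT; rewrite addn0.
by apply/IH => i ic; have := h i.+1 ic; rewrite /= addSnnS.
Qed.

(** With k + 1 columns, a row step with d weak descents has k + 1 - d strict ascents, and k < c' - c
    + (k + 1 - d) is the defining condition d <= c' - c. *)
Lemma LD_wide_steps p w : r = k.+1 -> (0 < n)%N -> dyck k n p ->
  LD k n r (p, w) <-> wide_steps k (fun i => r - wdes (word w) i)%N 0 0 (behead (north_cols 0 p)).
Proof.
move=> rk n0 d; rewrite LD_wdes /col; have [c1 c2 h] := d.
have sc := size_north_cols 0 p; rewrite c1 in sc.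
have c0 : nth 0%N (north_cols 0 p) 0 = 0%N.
  case: p {d c1 c2 sc} h => [|[] p] //= /(_ 1%N) /=; rewrite take0 /=; lia.
case: (north_cols 0 p) sc c0 => [|c cs] /= sc; first by rewrite -sc in n0.
move=> ->; split=> [[_ h'] |/wide_stepsP h'].
  apply/wide_stepsP => i ic; have := h' i; rewrite add0n => /(_ ltac:(lia)).
  by have := wdes_le (word w) i; rewrite /=; lia.
split=> // i ic; have := h' i ltac:(lia); rewrite add0n.
by have := wdes_le (word w) i; rewrite /=; lia.
Qed.

End LabelledPaths.

Lemma fstat_sum (T I : Type) (js : seq I) (asc : I -> T -> T -> nat) u :
  (\sum_(j <- js) fstat (asc j) u)%N = fstat (fun x y => \sum_(j <- js) asc j x y)%N u.
Proof.
elim: u => [|x u IH] /=; first by rewrite big1.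
rewrite big_split IH; congr (_ + _)%N.
by case: u {IH} => [|y u]; [rewrite big1|rewrite big_distrr].
Qed.

Lemma fstat_map (S T : Type) (g : S -> T) (asc : T -> T -> nat) u :
  fstat asc (map g u) = fstat (fun x y => asc (g x) (g y)) u.
Proof. by elim: u => //= x [|y u] //= ->; rewrite size_map. Qed.

Lemma prod_blk_wblock (F : fieldType) (q : F) (T : Type) r (asc : 'I_r.+1 -> T -> T -> nat) al u :
  \prod_j blk (wblock q (asc j)) al u =
  blk (wblock q (fun x y => \sum_j asc j x y)%N) al u.
Proof.
elim: al u => [|a al IH] u /=; first by rewrite prodr_const card_ord; case: nilp; rewrite ?mulr1n ?mulr0n ?expr1n ?expr0n.
rewrite big_split /= IH; congr (_ * _); rewrite /wblock big_split /= prodr_const card_ord.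
congr (_ * _); first by case: (_ == _); rewrite ?mulr1n ?mulr0n ?expr1n ?expr0n.
by rewrite -fstat_sum expr_sum.
Qed.

(** * The sum over paths with k + 1 columns of labels *)

Section FirstFormula.
Variables (k n : nat).
Hypothesis n0 : (0 < n)%N.

Lemma XmonE (R : comNzRingType) r (p : seq bool) (w : 'M[nat]_(n, r)) (m : 'I_r -> monom) :
  Xmon R (p, w) m = \prod_j (m j == seq_mset (word w j))%:R.
Proof. by []. Qed.

Lemma Xmon_bound (R : comNzRingType) r (L : labeled_path n r) (m : 'I_r -> monom) N :
  (forall j, letters_lt N (m j)) -> Xmon R L m != 0 -> forall i j, (L.2 i j < N)%N.
Proof.
case: L => p w mN; rewrite XmonE => h i j /=.
have /eqP e : m j == seq_mset (word w j).
  by apply: contraNT h => ne; rewrite (bigD1 j) //= (negbTE ne) mul0r.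
have := mN j; rewrite e letters_lt_seq => /allP; apply.
by rewrite -nth_word mem_nth // size_map size_enum_ord.
Qed.

Lemma ex_common_letters r (m : 'I_r -> monom) : exists N, forall j, letters_lt N (m j).
Proof.
have /choice [N hN] : forall j, exists N, letters_lt N (m j) by move=> j; apply: ex_letters_lt.
exists (\max_j N j)%N => j; apply: (letters_ltW _ (hN j)); exact: (leq_bigmax (F := N)).
Qed.

(** For fixed labels, the sum over the paths is [ech] of the word of positions, its statistic being
    the number of columns that ascend. [ech_expansion] replaces it by products of blocks, which
    factor over the columns, and each column is then summed on its own. *)
Lemma area_sum_Wprod (m : 'I_k.+1 -> monom) :
  area_sum k (LD k n k.+1) (fun L => Xmon Qq L) m =
  \sum_(al <- comps n) kcoef q_Qq al * \prod_j Wprod q_Qq al (m j).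
Proof.
have [N mN] := ex_common_letters m.
rewrite (@area_sum_finite _ _ _ _ N); first last.
- by move=> L _; apply: Xmon_bound.
- by move=> L [].
pose v (f : labels n k.+1 N) j := map val (f j) : seq nat.
pose asc (f : labels n k.+1 N) x y := (\sum_j ltb_asc (nth 0 (v f j) x) (nth 0 (v f j) y))%N.
pose M (f : labels n k.+1 N) : Qq := \prod_j (m j == seq_mset (v f j))%:R.
transitivity (\sum_(f : labels n k.+1 N) M f * ech q_Qq (asc f) 0 (iota 0 n)).
  under eq_bigr do rewrite mulr_sumr.
  rewrite exchange_big /=; apply: eq_bigr => f _.
  rewrite (@ech_dyck k _ _ (fun i => k.+1 - wdes (v f) i)%N) //; last first.
  - by move=> i; rewrite leq_subr.
  - by move=> i; apply: wdes_asc.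
  rewrite mulr_sumr big_seq [RHS]big_seq; apply: eq_bigr => p /mem_dyck pd.
  have E : word (label_mx f) = v f by apply/funext => j; apply: word_label_mx.
  have := LD_wide_steps (label_mx f) erefl n0 pd; rewrite XmonE E -/(M f) => h.
  have -> : `[< LD k n k.+1 (p, label_mx f) >] =
      wide_steps k (fun i => k.+1 - wdes (v f) i)%N 0 0 (behead (north_cols 0 p)).
    by apply/asboolP/idP => /h.
  move: (M f) (q_Qq ^+ _) => x y; case: wide_steps; rewrite ?mulr1n ?mulr0n; ring.
under eq_bigr => f _.
  rewrite ech_expansion ?size_iota //; last exact: Qq_q1.
  rewrite mulr_sumr; over.
rewrite exchange_big /= big_seq [RHS]big_seq; apply: eq_bigr => al /comps_recP [] // _ sal _.
have WE j : Wprod q_Qq al (m j) = \sum_(x : n.-tuple 'I_N)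
    (m j == seq_mset (map val x))%:R * blk (wblock q_Qq ltb_asc) al (map val x).
  rewrite /Wprod /Wser -wsum_blk; last by move=> *; apply: wblock0.
  apply: wsum_tuple; last by apply/letters_ltP.
  by move=> u su; apply: blk_size; rewrite ?sal // => *; apply: wblock0.
under [in RHS]eq_bigr do rewrite WE.
rewrite bigA_distr_bigA /= mulr_sumr; apply: eq_bigr => f _.
rewrite big_split /= mulrCA; congr (_ * (_ * _)).
rewrite -prod_blk_wblock; apply: eq_bigr => j _.
have -> : map val (f j) = map (nth 0%N (v f j)) (iota 0 n).
  by rewrite -[LHS](mkseq_nth 0%N) size_map size_tuple.
rewrite blk_map; apply: eq_blk => r u.
by rewrite /wblock size_map fstat_map.
Qed.

End FirstFormula.

Lemma sumn_pairmap_sub s (cs : seq nat) n : path leq s (rcons cs n) ->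
  sumn (pairmap (fun a b => (b - a)%N) s (rcons cs n)) = (n - s)%N.
Proof.
elim: cs s => [|c cs IH] s /=; first by rewrite addn0.
move=> /andP[sc p]; rewrite IH //.
have : (c <= n)%N by move: (order_path_min leq_trans p) => /allP /(_ n); apply; rewrite mem_rcons inE eqxx.
lia.
Qed.

(** The cuts are absolute positions while [u] starts at s: its letters i and i + 1 are separated
    when s + i + 1 is a cut, and otherwise they have to increase. *)
Lemma blk_incr_cuts (R : comNzRingType) (s : nat) (cs : seq nat) n (u : seq nat) :
  path ltn s (rcons cs n) -> size u = (n - s)%N ->
  blk (incr_word R) (pairmap (fun a b => (b - a)%N) s (rcons cs n)) u =
  (all (fun i => ((s + i.+1)%N \in cs) || (nth 0 u i < nth 0 u i.+1)%N) (iota 0 (size u).-1))%:R.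
Proof.
elim: cs s u => [|c cs IH] s u /=.
  rewrite andbT => sn su; rewrite -su take_size drop_size mulr1 /incr_word eqxx /=.
  congr (nat_of_bool _)%:R; apply/(sortedP 0%N)/allP => [h i|h i iu].
    by rewrite mem_iota => iu; apply: h; lia.
  by apply: h; rewrite mem_iota; lia.
move=> /andP[sc p] su.
have cn : (c < n)%N.
  by move: (order_path_min ltn_trans p) => /allP /(_ n); apply; rewrite mem_rcons inE eqxx.
have cs_c x : x \in cs -> (c < x)%N.
  by move=> xcs; move: (order_path_min ltn_trans p) => /allP /(_ x); apply; rewrite mem_rcons inE xcs orbT.
rewrite IH // ?size_drop; last lia.
rewrite /incr_word size_take -natrM mulnb; congr (nat_of_bool _)%:R.
have -> : (c - s < size u)%N by lia.
rewrite eqxx; apply/andP/allP => [[/(sortedP 0%N) h1 /allP h2] i|h].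
  rewrite mem_iota inE => iu; case: (ltngtP (s + i.+1) c) => [l|l|->]; last by [].
    have /(_ ltac:(rewrite size_take; case: ifP; lia)) := h1 i.
    by rewrite /ltn /= !nth_take; [move=> ->; rewrite orbT|lia|lia].
  have := h2 (i - (c - s))%N; rewrite mem_iota !nth_drop.
  rewrite (_ : c - s + (i - (c - s)) = i)%N; last lia.
  rewrite (_ : c - s + (i - (c - s)).+1 = i.+1)%N; last lia.
  by rewrite (_ : c + (i - (c - s)).+1 = s + i.+1)%N; [apply; lia|lia].
split; [apply/(sortedP 0%N) => i|apply/allP => i].
  rewrite size_take => ic; have ic' : (i.+1 < c - s)%N by move: ic; case: ifP; lia.
  rewrite !nth_take //; last lia.
  have /(_ _)/orP [] := h i; first by rewrite mem_iota; lia.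
    rewrite inE => /orP [/eqP|/cs_c]; lia.
  by [].
rewrite mem_iota !nth_drop => iu; have := h (c - s + i)%N.
rewrite mem_iota inE (_ : s + (c - s + i).+1 = c + i.+1)%N; last lia.
rewrite -addnS => /(_ ltac:(lia)); case/orP => [/orP [/eqP|->] |->]; rewrite ?orbT //; lia.
Qed.

Lemma path_filter_iota (Q : pred nat) n : (0 < n)%N -> ~~ Q 0%N ->
  path ltn 0 (rcons [seq i <- iota 0 n | Q i] n).
Proof.
case: n => // n _ /negbTE Q0; have s : sorted ltn (iota 0 n.+2) by apply: iota_ltn_sorted.
apply: (@subseq_sorted _ ltn ltn_trans (0%N :: rcons _ n.+1) _ _ s).
rewrite -[n.+2]addn1 iotaD /= Q0 add0n.
by rewrite -cats1 cat_subseq // filter_subseq.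
Qed.

(** * Summation over the first column *)

Section SecondFormula.
Variables (k n : nat).
Hypothesis n0 : (0 < n)%N.

Lemma eta_sumsE r p (w : 'M[nat]_(n, r)) : eta_sums (p, w) =
  [seq i <- iota 0 n | (0 < i)%N && (wdes (word w) i.-1 < col p i - col p i.-1)%N].
Proof.
rewrite /eta_sums -val_enum_ord filter_map; congr (map _ _); apply: eq_filter => i' /=.
apply/existsP/andP => [[i /andP[/eqP E h]]|[i0 h]].
  by move: h; rewrite (nweakdes_wdes w E) E.
have lt : (i'.-1 < n)%N by have := ltn_ord i'; lia.
exists (Ordinal lt); have E : i' = (Ordinal lt).+1 :> nat by rewrite /= prednK.
by apply/andP; split; [apply/eqP|rewrite /= (nweakdes_wdes w E)].
Qed.

Lemma mem_eta_sums r p (w : 'M[nat]_(n, r)) i : (i.+1 < n)%N ->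
  (i.+1 \in eta_sums (p, w)) = (wdes (word w) i < col p i.+1 - col p i)%N.
Proof. by move=> i1; rewrite eta_sumsE mem_filter mem_iota /= add0n i1 andbT. Qed.

Lemma eta_sums_path r p (w : 'M[nat]_(n, r)) : path ltn 0 (rcons (eta_sums (p, w)) n).
Proof.
by rewrite eta_sumsE; apply: path_filter_iota.
Qed.

Lemma sumn_eta r p (w : 'M[nat]_(n, r)) : sumn (eta (p, w)) = n.
Proof.
rewrite /eta sumn_pairmap_sub ?subn0 //; apply: sub_path (eta_sums_path p w).
by move=> x y /ltnW.
Qed.

Lemma elems_eta (R : comNzRingType) r p (w : 'M[nat]_(n, r)) N m : letters_lt N m ->
  elems R (eta (p, w)) m = \sum_(x : n.-tuple 'I_N) (m == seq_mset (map val x))%:R *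
    (all (fun i => (wdes (word w) i < col p i.+1 - col p i)%N ||
                   (nth 0 (map val x) i < nth 0 (map val x) i.+1)%N) (iota 0 n.-1))%:R.
Proof.
move=> /letters_ltP mN; rewrite elemsE (@wsum_tuple _ n N) //; last first.
  by move=> u su; apply: blk_size; rewrite ?sumn_eta // => *; apply: incr_word0.
apply: eq_bigr => x _; congr (_ * _).
rewrite blk_incr_cuts ?eta_sums_path ?size_map ?size_tuple ?subn0 //.
congr (nat_of_bool _)%:R; apply: eq_in_all => i; rewrite mem_iota => iin.
by rewrite add0n mem_eta_sums //; lia.
Qed.

Definition labels_cons N (xf : n.-tuple 'I_N * labels n k N) : labels n k.+1 N :=
  [ffun j => oapp xf.2 xf.1 (unlift ord0 j)].

Lemma labels_cons_bij N : bijective (@labels_cons N).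
Proof.
exists (fun g : labels n k.+1 N => (g ord0, [ffun j => g (lift ord0 j)] : labels n k N)).
  move=> [x f]; congr (_, _); first by rewrite ffunE unlift_none.
  by apply/ffunP => j; rewrite !ffunE liftK.
move=> g; apply/ffunP => j; rewrite ffunE; case: unliftP => [i ->|->] //=.
by rewrite ffunE.
Qed.

Lemma wdes_cons (v : 'I_k.+1 -> seq nat) i :
  wdes v i = ((nth 0 (v ord0) i.+1 <= nth 0 (v ord0) i)%N + wdes (fun j => v (lift ord0 j)) i)%N.
Proof.
rewrite /wdes -!sum1_card !big_mkcond big_ord_recl inE /=.
by congr (_ + _)%N; rewrite [RHS]big_mkcond.
Qed.

Lemma area_sum_elems :
  area_sum k (LD k n k.+1) (fun L => Xmon Qq L) =
  area_sum k (LD k n k) (fun L => tcons (elems Qq (eta L)) (Xmon Qq L)).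
Proof.
apply/funext => m; have [N mN] := ex_common_letters m.
rewrite (@area_sum_finite _ _ _ _ N); first last.
- by move=> L _; apply: Xmon_bound.
- by move=> L [].
rewrite (@area_sum_finite _ _ _ _ N); first last.
- move=> L _ h; apply: (@Xmon_bound n Qq k L _ N (fun j => mN (lift ord0 j))).
  by apply: contraNneq h => e; rewrite /tcons e mulr0.
- by move=> L [].
rewrite big_seq [RHS]big_seq; apply: eq_bigr => p /mem_dyck pd; congr (_ * _).
rewrite (reindex (@labels_cons N)) /=; last exact/onW_bij/labels_cons_bij.
rewrite -(pair_bigA _ (fun x f => `[< LD k n k.+1 (p, label_mx (labels_cons (x, f))) >]%:R *
   Xmon Qq (p, label_mx (labels_cons (x, f))) m)) exchange_big /=.
apply: eq_bigr => f _; rewrite /tcons (elems_eta _ _ _ (mN ord0)) mulr_suml mulr_sumr.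
apply: eq_bigr => x _.
have E0 : word (label_mx (labels_cons (x, f))) ord0 = map val x.
  by rewrite word_label_mx ffunE unlift_none.
have El j : word (label_mx (labels_cons (x, f))) (lift ord0 j) = word (label_mx f) j.
  by rewrite !word_label_mx ffunE liftK.
have -> : Xmon Qq (p, label_mx (labels_cons (x, f))) m = (m ord0 == seq_mset (map val x))%:R *
    Xmon Qq (p, label_mx f) (fun j => m (lift ord0 j)).
  rewrite XmonE XmonE big_ord_recl; apply: (f_equal2 *%R); first by rewrite E0.
  by apply: eq_bigr => j _; rewrite El.
set A := `[< _ >]; set B := `[< _ >]; set C := all _ _.
(* A weak descent of the first column adds one to the count of the others, so it fits exactly where
   their inequality is strict; this is where [eta] cuts. *)
have -> : A = B && C.
  have lE i : wdes (word (label_mx (labels_cons (x, f)))) i =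
      ((nth 0 (map val x) i.+1 <= nth 0 (map val x) i)%N + wdes (word (label_mx f)) i)%N.
    by rewrite wdes_cons E0; congr (_ + wdes _ _)%N; apply/funext.
  apply/asboolP/andP => [/LD_wdes [_ h]|[/asboolP /LD_wdes [_ h1] /allP h2]].
    split; [apply/asboolP/LD_wdes; split=> // i i1|apply/allP => i].
      by have := h i i1; rewrite lE; lia.
    by rewrite mem_iota => i1; have := h i ltac:(lia); rewrite lE; lia.
  apply/LD_wdes; split=> // i i1; rewrite lE.
  by have := h1 i i1; have := h2 i; rewrite mem_iota => /(_ ltac:(lia)); lia.
by rewrite -mulnb natrM; move: (B%:R) (C%:R) (_ == _)%:R (Xmon _ _ _) => a b c d; ring.
Qed.

End SecondFormula.

(** * Lattice words *)

Section LatticeWords.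
Implicit Types (c : nat -> nat) (u v : seq nat).

Definition add_word c v : nat -> nat := fun a => (c a + count_mem a v)%N.

(* v stays a lattice word when read after a word with c a letters a *)
Fixpoint lattice_from c v : bool :=
  if v is a :: v' then ((a == 0%N) || (c a < c a.-1)%N) && lattice_from (add_word c [:: a]) v'
  else true.

Lemma add_word0 c : add_word c [::] = c.
Proof. by apply/funext => a; rewrite /add_word addn0. Qed.

Lemma add_word_cat c u v : add_word c (u ++ v) = add_word (add_word c u) v.
Proof. by apply/funext => a; rewrite /add_word count_cat addnA. Qed.

Lemma lattice_from_cat c u v :
  lattice_from c (u ++ v) = lattice_from c u && lattice_from (add_word c u) v.
Proof.
elim: u c => [|a u IH] c /=; first by rewrite add_word0.
by rewrite IH -andbA -add_word_cat.
Qed.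

Lemma add_letter_dec c a : dec c -> (a == 0%N) || (c a < c a.-1)%N -> dec (add_word c [:: a]).
Proof.
move=> dc ha i; rewrite /add_word /= !addn0; have := dc i.
case: (a =P i.+1) ha => [->|_] /=; first by case: (i.+1 =P i) => /=; lia.
by case: (a =P i) => /=; lia.
Qed.

Lemma lattice_from_dec c v : dec c -> lattice_from c v -> dec (add_word c v).
Proof.
elim: v c => [|a v IH] c dc /=; first by rewrite add_word0.
move=> /andP[ha /IH h]; rewrite -cat1s add_word_cat; apply: h; exact: add_letter_dec.
Qed.

Lemma lattice_from_incr c u : dec c -> sorted ltn u -> dec (add_word c u) -> lattice_from c u.
Proof.
elim: u c => [|a u IH] c dc //= pu du.
have au x : x \in u -> (a < x)%N by move: (order_path_min ltn_trans pu) => /allP; apply.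
have ha : (a == 0%N) || (c a < c a.-1)%N.
  case: a {pu} au du => [|a] //= au /(_ a); rewrite /add_word /= !eqxx.
  rewrite (count_memPn _); last by apply/negP => /au; lia.
  by rewrite (count_memPn _); [lia|apply/negP => /au; lia].
rewrite ha; apply: IH; rewrite ?(path_sorted pu) //; first exact: add_letter_dec.
by rewrite -add_word_cat.
Qed.

Lemma lattice_wordP c v : dec c ->
  (forall i, dec (add_word c (take i v))) <-> lattice_from c v.
Proof.
elim: v c => [|a v IH] c dc /=; first by split=> // _ i; rewrite add_word0.
split=> [h|/andP[ha hv] [|i]]; last first.
- have dca := add_letter_dec dc ha.
  by have /(_ i) := (IH _ dca).2 hv; rewrite -add_word_cat.
- by rewrite take0 add_word0.
have ha : (a == 0%N) || (c a < c a.-1)%N.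
  case: a h => [|a] //= /(_ 1%N a); rewrite /= take0 /add_word /= !eqxx.
  by case: eqP => //; lia.
rewrite ha; apply/IH; first exact: add_letter_dec.
by move=> i; have := h i.+1; rewrite /= -cat1s add_word_cat.
Qed.

Lemma lattice_from0 v : lattice_word v <-> lattice_from (fun=> 0%N) v.
Proof.
rewrite -lattice_wordP; last by [].
by split=> h i a; have := h i a; rewrite /add_word !add0n.
Qed.

End LatticeWords.

Section Words.
Variable K : nat.

Fixpoint all_words r : seq (seq nat) :=
  if r is r'.+1 then [seq a :: v | a <- iota 0 K, v <- all_words r'] else [:: [::]].

Lemma all_words_uniq r : uniq (all_words r).
Proof.
elim: r => //= r IH; apply: allpairs_uniq; rewrite ?iota_uniq //.
by move=> [a u] [b v] _ _ /= [-> ->].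
Qed.

Lemma mem_all_words r v : (v \in all_words r) = (size v == r) && all (fun a => a < K)%N v.
Proof.
elim: r v => [|r IH] v /=; first by case: v.
case: v => [|a v] /=; first by apply/allpairsP => -[[b w] [_ _]].
rewrite eqSS; apply/allpairsP/and3P => [[[b w] [/= bK wr [-> ->]]]|[sv aK vK]].
  by move: bK wr; rewrite mem_iota IH add0n leq0n /= => bK /andP[? ?].
by exists (a, v); rewrite mem_iota IH aK sv.
Qed.

Lemma big_all_wordsD (V : nmodType) r s (G : seq nat -> V) :
  \sum_(u <- all_words (r + s)) G u =
  \sum_(u <- all_words r) \sum_(v <- all_words s) G (u ++ v).
Proof.
elim: r G => [|r IH] G; first by rewrite big_seq1.
rewrite addSn /= !big_allpairs_dep /=; apply: eq_bigr => a _.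
by rewrite (IH (fun v => G (a :: v))).
Qed.

Lemma big_tuple_words (V : nmodType) n (G : seq nat -> V) :
  \sum_(x : n.-tuple 'I_K) G (map val x) = \sum_(u <- all_words n) G u.
Proof.
rewrite -(big_map (fun x : n.-tuple 'I_K => map val x) xpredT G); apply: perm_big.
apply: uniq_perm; rewrite ?all_words_uniq //.
  by rewrite map_inj_uniq ?index_enum_uniq // => x y /(inj_map val_inj) /val_inj.
move=> u; rewrite mem_all_words; apply/mapP/andP => [[x _ ->]|[/eqP su uK]].
  by rewrite size_map size_tuple; split=> //; apply/allP => _ /mapP [y _ ->] /=.
have [v vE] : exists v : seq 'I_K, map val v = u.
  elim: u {su} uK => [|a u IH] /=; first by exists [::].
  by move=> /andP[aK /IH[v <-]]; exists (Ordinal aK :: v).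
have sv : size v == n by rewrite -su -vE size_map.
by exists (Tuple sv) => //; rewrite mem_index_enum.
Qed.

End Words.

Section Pieri.
Variables (D : nat) (A : comNzRingType) (xs : seq A).
Implicit Types (c : nat -> nat) (u v : seq nat).

Lemma supp_add_word c u : supp D c -> all (fun a => a < D.+1)%N u -> supp D (add_word c u).
Proof.
move=> sc /allP uD i Di; rewrite /add_word sc // (count_memPn _) //.
by apply/negP => /uD; rewrite ltnS leqNgt Di.
Qed.

Lemma sz_add_word c u : all (fun a => a < D.+1)%N u -> sz D (add_word c u) = (sz D c + size u)%N.
Proof.
move=> /allP uD; rewrite /sz /add_word big_split; congr (_ + _)%N => /=.
elim: u uD => [|a u IH] uD /=; first by rewrite big1.
rewrite big_split /= IH => [|x xu]; last by apply: uD; rewrite inE xu orbT.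
have aD : (a < D.+1)%N by apply: uD; rewrite inE eqxx.
rewrite (bigD1 (Ordinal aD)) //= eqxx big1 ?add1n // => i ia.
suff /negbTE -> : a != i by [].
by apply: contra ia => /eqP e; apply/eqP/val_inj.
Qed.

(** A vertical strip is the set of rows that receive a cell. Listed from the top they form an
    increasing word, and the enlarged shape decreases exactly when this word can be read after c as
    a lattice word. *)
Lemma pieri_words c r : supp D c -> dec c -> (sz D c + r < D)%N ->
  ecoef xs r * spoly D true xs c =
  \sum_(u <- all_words D.+1 r | sorted ltn u && lattice_from c u) spoly D true xs (add_word c u).
Proof.
move=> sc dc cr; rewrite pieri //.
have uP u : u \in all_words D.+1 r -> sorted ltn u -> lattice_from c u ->
    rowlen (mkdiag D (add_word c u)) = add_word c u.
  rewrite mem_all_words => /andP[/eqP su uD] _ _.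
  have sa := supp_add_word sc uD; apply: mkdiagK => // i.
  by apply: leq_trans (row_le_sz _ sa) _; rewrite sz_add_word // su ltnW.
pose L := [seq u <- all_words D.+1 r | sorted ltn u && lattice_from c u].
transitivity (\sum_(f <- [seq mkdiag D (add_word c u) | u <- L]) spoly D true xs (rowlen f)); last first.
  rewrite big_map big_filter big_seq_cond [RHS]big_seq_cond; apply: eq_bigr => u.
  by move=> /andP[ur /andP[su lu]]; rewrite uP.
rewrite -big_filter; apply: perm_big; apply: uniq_perm.
- by rewrite filter_uniq ?index_enum_uniq.
- rewrite map_inj_in_uniq ?filter_uniq ?all_words_uniq // => u v.
  rewrite !mem_filter => /andP[/andP[su lu] ur] /andP[/andP[sv lv] vr] /(congr1 (@rowlen D)).
  rewrite !uP // => E; apply: (irr_sorted_eq ltn_trans ltnn) => // a.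
  have /addnI e := congr1 (fun g => g a) E.
  by rewrite -!has_pred1 !has_count e.
move=> f; rewrite mem_filter mem_index_enum andbT; apply/andP/mapP; last first.
  move=> [u]; rewrite mem_filter => /andP[/andP[su lu] ur] ->; rewrite uP //.
  move: (ur); rewrite mem_all_words => /andP[/eqP zu uD].
  rewrite sz_add_word // zu eqxx; split=> //.
  have du := lattice_from_dec dc lu.
  apply/and3P; split; [exact/(decbP (supp_add_word sc uD))|exact/(decbP sc)|].
  apply/forallP => i; rewrite /add_word leq_addr (count_uniq_mem _ (sorted_uniq ltn_trans ltnn su)).
  by case: (_ \in u); lia.
move=> [/= h /eqP fz].
have sf := @supp_rowlen D f; have df : dec (rowlen f) by apply/(decbP sf); case/and3P: h.
have hi i : (c i <= rowlen f i <= (c i).+1)%N.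
  case: (ltnP D i) => Di; first by rewrite sc // sf.
  by case/and3P: h => _ _ /forallP /(_ (Ordinal (Di : (i < D.+1)%N))).
pose u := [seq i <- iota 0 D.+1 | (c i < rowlen f i)%N].
have fE : rowlen f = add_word c u.
  apply/funext => i; rewrite /add_word (count_uniq_mem _ (filter_uniq _ (iota_uniq _ _))).
  rewrite mem_filter mem_iota; have := hi i; case: (ltnP D i) => Di; last by lia.
  by rewrite sc // sf.
have su : sorted ltn u by rewrite sorted_filter ?iota_ltn_sorted //; apply: ltn_trans.
have uD : all (fun a => a < D.+1)%N u.
  by apply/allP => a; rewrite mem_filter mem_iota => /andP[].
have lu : lattice_from c u by apply: lattice_from_incr; rewrite // -fE.
have ur : u \in all_words D.+1 r.
  by rewrite mem_all_words uD andbT; move: fz; rewrite fE sz_add_word // => /addnI /eqP.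
exists u; first by rewrite mem_filter su lu.
by apply: rowlen_inj; rewrite uP.
Qed.

Lemma pieri_blocks rs c : supp D c -> dec c -> (sz D c + sumn rs < D)%N ->
  \prod_(r <- rs) ecoef xs r * spoly D true xs c =
  \sum_(u <- all_words D.+1 (sumn rs) | lattice_from c u)
    blk (incr_word A) rs u * spoly D true xs (add_word c u).
Proof.
elim: rs c => [|r rs IH] c sc dc cr.
  by rewrite big_nil big_mkcond big_seq1 /= add_word0 mulr1n.
have cr' : (sz D c + r < D)%N by move: cr => /=; lia.
rewrite big_cons mulrAC pieri_words // mulr_suml big_mkcond [RHS]big_mkcond /= big_all_wordsD.
rewrite big_seq [RHS]big_seq; apply: eq_bigr => u ur.
move: (ur); rewrite mem_all_words => /andP[/eqP zu uD].
have bE v : incr_word A r (take r (u ++ v)) * blk (incr_word A) rs (drop r (u ++ v)) = (sorted ltn u)%:R * blk (incr_word A) rs v.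
  by rewrite take_size_cat // drop_size_cat // /incr_word zu eqxx.
case: (boolP (sorted ltn u)) => su /=; last first.
  by rewrite big1 // => v _; case: ifP => // _; rewrite bE (negbTE su) !mul0r.
under [RHS]eq_bigr => v _ do rewrite lattice_from_cat.
case: (boolP (lattice_from c u)) => lu /=; last by rewrite big1.
rewrite mulrC IH; first last.
- by rewrite sz_add_word // zu -addnA.
- exact: lattice_from_dec.
- exact: supp_add_word.
rewrite big_mkcond; apply: eq_bigr => v _; case: ifP => // _.
by rewrite add_word_cat bE su mul1r.
Qed.

End Pieri.

Section WordType.
Implicit Types (u : seq nat).

Lemma nth_filter_dec (f : nat -> nat) s n a : dec f -> (forall i, (s + n <= i)%N -> f i = 0%N) ->
  nth 0%N [seq c <- map f (iota s n) | (0 < c)%N] a = f (s + a)%N.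
Proof.
move=> df; elim: n s a => [|n IH] s a f0 /=; first by rewrite nth_nil f0 // addn0 leq_addr.
have f0' i : (s.+1 + n <= i)%N -> f i = 0%N by rewrite addSnnS; apply: f0.
case: ifP => fs.
  by case: a => [|a]; rewrite /= ?addn0 // IH // addSnnS.
have z i : (s <= i)%N -> f i = 0%N by move=> si; have := dec_le df si; lia.
by rewrite IH // !z //; lia.
Qed.

Lemma lattice_letters u : lattice_from (fun=> 0%N) u -> all (fun a => a < size u)%N u.
Proof.
move=> lu; have du : dec (add_word (fun=> 0%N) u) by apply: lattice_from_dec.
apply/allP => a au; rewrite -[a.+1](size_iota 0); apply: uniq_leq_size (iota_uniq _ _) _ => b.
rewrite mem_iota add0n ltnS => /= ba; rewrite -has_pred1 has_count.
have := dec_le du ba; rewrite /add_word !add0n; apply: leq_trans.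
by rewrite -has_count has_pred1.
Qed.

Lemma nth_word_type u : lattice_from (fun=> 0%N) u ->
  nth 0%N (word_type u) = add_word (fun=> 0%N) u.
Proof.
move=> lu; apply/funext => a; rewrite /word_type.
rewrite (nth_filter_dec (f := fun a => count_mem a u)) //.
- exact: lattice_from_dec lu.
- move=> i; rewrite add0n => si; apply/count_memPn/negP => /(allP (lattice_letters lu)).
  by rewrite ltnNge si.
Qed.

Lemma word_type_part u : lattice_from (fun=> 0%N) u -> is_part (word_type u).
Proof.
move=> lu; have du : dec (add_word (fun=> 0%N) u) by apply: lattice_from_dec.
rewrite /is_part /word_type mem_filter ltnn andbT.
have tr : transitive geq by move=> x y z yx xz; apply: leq_trans yx.
rewrite sorted_filter // sorted_map; apply: sub_sorted (iota_ltn_sorted _ _) => i j /= /ltnW ij.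
by have := dec_le du ij; rewrite /add_word !add0n.
Qed.

Lemma sumn_word_type u : lattice_from (fun=> 0%N) u -> sumn (word_type u) = size u.
Proof.
move=> lu; have lD : all (fun a => a < (size u).+1)%N u.
  by apply/allP => a /(allP (lattice_letters lu)) /ltnW.
have z : sz (size u) (fun=> 0%N) = 0%N by rewrite /sz big1.
have := sz_add_word (fun=> 0%N) lD; rewrite z add0n => <-.
rewrite /sz big_ord_recr /= [X in _ = (_ + X)%N](_ : _ = 0%N); last first.
  by apply/count_memPn/negP => /(allP (lattice_letters lu)); rewrite ltnn.
rewrite addn0 /word_type -(big_mkord xpredT (fun i => add_word (fun=> 0%N) u i)) /index_iota subn0.
elim: (iota 0 _) => [|i s IH] /=; first by rewrite big_nil.
by rewrite big_cons -IH /add_word add0n; case: (count_mem i u).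
Qed.

End WordType.

Section LatticeExpansion.
Variable F : fieldType.

Lemma blk_incr_mul rs u (f : series F) m :
  (blk (incr_word (series F)) rs u * f) m = blk (incr_word F) rs u * f m.
Proof.
have bE (b : bool) (g : series F) : (b%:R * g) m = b%:R * g m.
  by case: b; rewrite ?mul1r // !mul0r szeroE.
elim: rs u => [|r rs IH] u; first exact: bE.
by rewrite -mulrA bE IH mulrA.
Qed.

(** [pieri_blocks] started from the empty shape. The strict size bound in the Pieri rule is met by D
    = n + 1, whence an alphabet of n + 2 letters. *)
Lemma elems_lattice (rs : seq nat) n N m : sumn rs = n -> letters_lt N m ->
  elems F rs m = \sum_(u <- all_words n.+2 n | lattice_from (fun=> 0%N) u)
    blk (incr_word F) rs u * schur F (word_type u) m.
Proof.
move=> srs mN; rewrite -(truncE _ mN) /elems sprodE big_map trunc_prod.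
under eq_bigr do rewrite trunc_elem.
have s0 : sz n.+1 (fun=> 0%N) = 0%N by rewrite /sz big1.
have := @pieri_blocks n.+1 _ (xvars F N) rs (fun=> 0%N); rewrite s0 add0n srs.
rewrite spoly_sz0 // mulr1 => -> //; rewrite ssumE.
rewrite big_seq_cond [RHS]big_seq_cond; apply: eq_bigr => u /andP[un lu].
move: un; rewrite mem_all_words => /andP[/eqP su _].
have st : (sumn (word_type u) <= n.+1)%N by rewrite sumn_word_type // su.
by rewrite blk_incr_mul -nth_word_type // -(trunc_schur F N (word_type_part lu) st) truncE.
Qed.

End LatticeExpansion.

(** Moebius inversion by induction on the cardinal: the proper subsets of E contribute equally to
    both sums. *)
Lemma sum_subsets_inj (T : finType) (V : zmodType) (f g : {set T} -> V) :
  (forall E : {set T}, \sum_(D : {set T} | D \subset E) f D =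
                       \sum_(D : {set T} | D \subset E) g D) ->
  forall E, f E = g E.
Proof.
move=> h E; have [d] := ubnP #|E|; elim: d E => // d IH E Ed.
have := h E; rewrite (bigD1 E) //= [RHS](bigD1 E) //=.
rewrite (eq_bigr g) => [/addIr //|D /andP[DE ne]]; apply: IH.
have : (#|D| < #|E|)%N by apply: proper_card; rewrite finset.properEneq ne.
by rewrite ltnS in Ed; move/leq_trans; apply.
Qed.

(** * Words with a prescribed set of weak descents *)

Section WeakDescents.
Variable n : nat.
Hypothesis n0 : (0 < n)%N.

Definition wdes_set (u : seq nat) : {set 'I_n} :=
  [set i : 'I_n | (i.+1 < n)%N && (nth 0 u i.+1 <= nth 0 u i)%N].

Definition cuts (E : {set 'I_n}) : seq nat :=
  [seq i <- iota 0 n | (0 < i)%N && (i.-1 \in [seq val o | o <- enum E])].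

(** Cuts after each position of E, so that the corresponding product of e_r enumerates the words
    whose weak descents all lie in E. *)
Definition cut_comp (E : {set 'I_n}) : seq nat :=
  pairmap (fun a b => (b - a)%N) 0%N (rcons (cuts E) n).

Lemma cuts_path E : path ltn 0 (rcons (cuts E) n).
Proof. exact: path_filter_iota. Qed.

Lemma sumn_cut_comp E : sumn (cut_comp E) = n.
Proof.
by rewrite /cut_comp sumn_pairmap_sub ?subn0 //; apply: sub_path (cuts_path E) => x y /ltnW.
Qed.

Lemma mem_val_enum (E : {set 'I_n}) (i : 'I_n) : (val i \in [seq val o | o <- enum E]) = (i \in E).
Proof. by rewrite mem_map ?mem_enum //; apply: val_inj. Qed.

Lemma blk_cut_comp (R : comNzRingType) E u : size u = n ->
  blk (incr_word R) (cut_comp E) u = (wdes_set u \subset E)%:R.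
Proof.
move=> su; rewrite blk_incr_cuts ?cuts_path ?subn0 // su; congr (nat_of_bool _)%:R.
apply/allP/fintype.subsetP => [h i|h i].
  rewrite inE => /andP[i1 w]; have := h i; rewrite mem_iota => /(_ ltac:(lia)).
  rewrite add0n mem_filter mem_iota /= mem_val_enum [(nth _ _ _ < _)%N]ltnNge w orbF.
  by case/andP.
rewrite mem_iota => i1; have lt : (i < n)%N by lia.
rewrite add0n mem_filter mem_iota /= (_ : (i.+1 < n)%N); last lia.
rewrite andbT (mem_val_enum E (Ordinal lt)) [(nth _ _ _ < _)%N]ltnNge orbC -implybE; apply/implyP => w.
by apply: h; rewrite inE /= w andbT; lia.
Qed.

Lemma column_identity (F : fieldType) N m E : letters_lt N m ->
  \sum_(x : n.-tuple 'I_N | wdes_set (map val x) == E) (m == seq_mset (map val x))%:R =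
  \sum_(x : n.-tuple 'I_n.+2 | wdes_set (map val x) == E)
     `[< lattice_word (map val x) >]%:R * schur F (word_type (map val x)) m.
Proof.
move=> mN; move: E; apply: sum_subsets_inj => E.
have part (I : finType) (wd : I -> {set 'I_n}) (f : I -> F) :
    \sum_(D : {set 'I_n} | D \subset E) \sum_(x | wd x == D) f x = \sum_(x | wd x \subset E) f x.
  by rewrite [RHS](partition_big wd (fun D => D \subset E)) //=; apply: eq_bigr => D DE;
     apply: eq_bigl => x; case: eqP => [->|]; rewrite ?DE ?andbT ?andbF.
(* Once the descents are only bounded by E, this product is the sum of all such words on the left,
   and on the right its expansion by [elems_lattice]. *)
rewrite !part; transitivity (elems F (cut_comp E) m).
  move/letters_ltP: (mN) => mN'; rewrite elemsE (@wsum_tuple _ n N) //; last first.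
    by move=> u su; apply: blk_size; rewrite ?sumn_cut_comp // => *; apply: incr_word0.
  rewrite big_mkcond; apply: eq_bigr => x _; rewrite blk_cut_comp ?size_map ?size_tuple //.
  by case: (_ \subset _); rewrite ?mulr1n ?mulr0n ?mulr1 ?mulr0.
rewrite (elems_lattice F (sumn_cut_comp E) mN) big_mkcond -big_tuple_words [RHS]big_mkcond.
apply: eq_bigr => x _; rewrite blk_cut_comp ?size_map ?size_tuple //.
have -> : `[< lattice_word (map val x) >] = lattice_from (fun=> 0%N) (map val x).
  by apply/asboolP/idP => /lattice_from0.
by case: lattice_from; case: (_ \subset _); rewrite ?mulr1n ?mulr0n ?mul0r.
Qed.

End WeakDescents.

(** * From all labels to lattice labels *)

Section ThirdFormula.
Variables (k n : nat).
Hypothesis n0 : (0 < n)%N.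

Definition set_wdes (D : {ffun 'I_k -> {set 'I_n}}) i : nat :=
  #|[pred j | i \in [seq val o | o <- enum (D j)]]|.

Definition word_wdes (w : 'M[nat]_(n, k)) : {ffun 'I_k -> {set 'I_n}} :=
  [ffun j => wdes_set n (word w j)].

Lemma set_wdesE (w : 'M[nat]_(n, k)) i : (i.+1 < n)%N ->
  wdes (word w) i = set_wdes (word_wdes w) i.
Proof.
move=> i1; apply: eq_card => j; rewrite !inE /=.
by rewrite (mem_val_enum _ (Ordinal (ltnW i1))) ffunE inE /= i1.
Qed.

(* The part of the summand that depends only on the path and on the weak
   descents of the words *)
Definition path_weight (p : seq bool) (m : monom) (D : {ffun 'I_k -> {set 'I_n}}) : Qq :=
  (all (fun i => (set_wdes D i <= col p i.+1 - col p i)%N) (iota 0 n.-1))%:R *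
  elems Qq (pairmap (fun a b => (b - a)%N) 0%N
    (rcons [seq i <- iota 0 n | (0 < i)%N && (set_wdes D i.-1 < col p i - col p i.-1)%N] n)) m.

Lemma path_weightE p m (w : 'M[nat]_(n, k)) : dyck k n p ->
  `[< LD k n k (p, w) >]%:R * elems Qq (eta (p, w)) m = path_weight p m (word_wdes w).
Proof.
move=> pd; rewrite /path_weight /eta eta_sumsE //.
have -> : [seq i <- iota 0 n | (0 < i)%N && (wdes (word w) i.-1 < col p i - col p i.-1)%N] =
    [seq i <- iota 0 n | (0 < i)%N && (set_wdes (word_wdes w) i.-1 < col p i - col p i.-1)%N].
  by apply: eq_in_filter => -[|i] //; rewrite mem_iota => i1; rewrite /= set_wdesE.
suff -> : `[< LD k n k (p, w) >] =
    all (fun i => (set_wdes (word_wdes w) i <= col p i.+1 - col p i)%N) (iota 0 n.-1) by [].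
apply/asboolP/allP => [/LD_wdes [_ h] i|h].
  by rewrite mem_iota => i1; rewrite -set_wdesE; [apply: h|]; lia.
apply/LD_wdes; split=> // i i1; rewrite set_wdesE //; apply: h.
by rewrite mem_iota; lia.
Qed.

(** For a fixed path, admissibility and eta depend on the labels only through the k-tuple of their
    weak descent sets. Grouping by this tuple makes the columns independent, and [column_identity]
    is applied to each. *)
Lemma area_sum_schur :
  area_sum k (LD k n k) (fun L => tcons (elems Qq (eta L)) (Xmon Qq L)) =
  area_sum k (LLD k n) (fun L => tcons (elems Qq (eta L))
                          (tens (fun j => schur Qq (word_type (word (snd L) j))))).
Proof.
apply/funext => m; have [N mN] := ex_common_letters m.
rewrite (@area_sum_finite _ _ _ _ N); first last.
- move=> L _ h; apply: (@Xmon_bound n Qq k L _ N (fun j => mN (lift ord0 j))).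
  by apply: contraNneq h => e; rewrite /tcons e mulr0.
- by move=> L [].
(* The letters of a lattice word of length n are below n; the bound [n.+2] is the alphabet of
   [column_identity]. *)
rewrite (@area_sum_finite _ _ _ _ n.+2); first last.
- move=> [p w] [_ lw] _ i j; have /lattice_from0 /lattice_letters /allP h := lw j.
  have wij : w i j \in word w j by rewrite -nth_word mem_nth // size_map size_enum_ord.
  by have := h _ wij; rewrite size_map size_enum_ord /=; lia.
- by move=> L [[]].
rewrite big_seq [RHS]big_seq; apply: eq_bigr => p /mem_dyck pd; congr (_ * _).
pose X N' (Y : seq nat -> monom -> Qq) := \sum_(f : labels n k N')
  path_weight p (m ord0) (word_wdes (label_mx f)) *
    \prod_j Y (map val (f j)) (m (lift ord0 j)).
have XE N' Y : X N' Y = \sum_(D : {ffun 'I_k -> {set 'I_n}}) path_weight p (m ord0) D *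
    \prod_j \sum_(x : n.-tuple 'I_N' | wdes_set n (map val x) == D j) Y (map val x) (m (lift ord0 j)).
  rewrite /X (partition_big (fun f => word_wdes (label_mx f)) xpredT) //=.
  apply: eq_bigr => D _; rewrite bigA_distr_big_dep /= mulr_sumr.
  apply: eq_big => [f|f /eqP -> //].
  apply/eqP/familyP => [<- j|h]; first by rewrite unfold_in /= ffunE word_label_mx.
  by apply/ffunP => j; rewrite ffunE word_label_mx; apply/eqP; have := h j; rewrite unfold_in.
transitivity (X N (fun u m' => (m' == seq_mset u)%:R)).
  apply: eq_bigr => f _; rewrite /tcons mulrA (path_weightE _ _ pd).
  apply: (f_equal2 *%R); first by [].
  by rewrite XmonE; apply: eq_bigr => j _; rewrite word_label_mx.
transitivity (X n.+2 (fun u m' => `[< lattice_word u >]%:R * schur Qq (word_type u) m')).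
  rewrite !XE; apply: eq_bigr => D _; apply: (f_equal2 *%R) => //; apply: eq_bigr => j _.
  exact: column_identity.
apply: eq_bigr => f _; rewrite /tcons -path_weightE // big_split /=.
have -> : `[< LLD k n (p, label_mx f) >] = `[< LD k n k (p, label_mx f) >] &&
    [forall j, `[< lattice_word (map val (f j)) >]].
  apply/asboolP/andP => [[h1 h2]|[/asboolP h1 /forallP h2]].
    by split; [apply/asboolP|apply/forallP => j; apply/asboolP; rewrite -word_label_mx].
  by split=> // j; apply/asboolP; rewrite word_label_mx.
have -> : \prod_j `[< lattice_word (map val (f j)) >]%:R =
    [forall j, `[< lattice_word (map val (f j)) >]]%:R :> Qq.
  case: (boolP [forall j, _]) => [/forallP h|]; first by rewrite big1 // => j _; rewrite h.
  rewrite negb_forall => /existsP [j /negbTE h]; rewrite (bigD1 j) //= h mul0r //.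
have -> : tens (fun j => schur Qq (word_type (word (p, label_mx f).2 j))) (fun j => m (lift ord0 j)) =
    \prod_j schur Qq (word_type (map val (f j))) (m (lift ord0 j)).
  by apply: eq_bigr => j _; rewrite word_label_mx.
rewrite -mulnb natrM; set a := _%:R; set b := _%:R; move: a b => a b; ring.
Qed.

End ThirdFormula.

Local Close Scope ring_scope.

Theorem theorem1p3 (n k : nat) (H : seq nat -> series Qqt)
    (nabla : series Qqt -> tseries k.+1 Qqt) :
  (0 < n)%N -> (0 < k)%N ->
  modified_macdonald H -> is_nabla_iter H nabla ->
  [/\ forall m : 'I_k.+1 -> monom,
        at_t1 (nabla (elem Qqt n) m)
              (area_sum k (LD k n k.+1) (fun L => Xmon Qq L) m),
      area_sum k (LD k n k.+1) (fun L => Xmon Qq L) =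
      area_sum k (LD k n k)
        (fun L => tcons (elems Qq (eta L)) (Xmon Qq L)) &
      area_sum k (LD k n k)
        (fun L => tcons (elems Qq (eta L)) (Xmon Qq L)) =
      area_sum k (LLD k n)
        (fun L => tcons (elems Qq (eta L))
                          (tens (fun j => schur Qq (word_type (word (snd L) j)))))].
Proof.
move=> n0 _ macH nablaH; split; last exact: (area_sum_schur _ n0).
  by move=> m; rewrite (area_sum_Wprod n0); apply: (nabla_elem_at_t1 macH nablaH).
exact: (area_sum_elems _ n0).
Qed.
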